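(* Let $\Gamma_1,\Gamma_2$ be the linear maps from $\mathrm{Dom}(L_{\max})$ onto $\mathbb{C}^{2m}$ given by $$\Gamma_1 y := (\Gamma_{1,1}y_1,\Gamma_{1,2}y_2,\dots,\Gamma_{1,m}y_m),\qquad \Gamma_2 y := (\Gamma_{2,1}y_1,\Gamma_{2,2}y_2,\dots,\Gamma_{2,m}y_m),$$ where $y=\oplus_{i=1}^m y_i\in \mathrm{Dom}(L_{\max})$. Then the triplet $(\mathbb{C}^{2m},\Gamma_1,\Gamma_2)$ is a boundary triplet for the operator $L_{\min}$.
   Context: Setting. Let $m\in\mathbb{N}$ and let $a=a_0<a_1<\dots<a_m=b$ be a partition of a finite interval $[a,b]$. For each $i\in\{1,\dots,m\}$ let $p_i,Q_i$ be measurable, finite, real-valued functions on $[a_{i-1},a_i]$ such that $$1/p_i,\quad Q_i/p_i,\quad Q_i^2/p_i\in L_1([a_{i-1},a_i],\mathbb{R}).$$ Consider the formal Sturm--Liouville expression $l_i(y)=-(p_i y')'+q_i y$ on $(a_{i-1},a_i)$, where $q_i=Q_i'$ in the sense of distributions. Define quasi-derivatives $$D_i^{[0]}y=y,\qquad D_i^{[1]}y=p_iy'-Q_iy,\qquad D_i^{[2]}y=(D_i^{[1]}y)'+\frac{Q_i}{p_i}D_i^{[1]}y+\frac{Q_i^2}{p_i}y,$$ and interpret $l_i[y]:=-D_i^{[2]}y$. Operators. In $L_2((a_{i-1},a_i),\mathbb{C})$ define the maximal operator $L_{i,1}y=l_i[y]$ with $$\mathrm{Dom}(L_{i,1})=\{y\in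 L_2 : y,\,D_i^{[1]}y\in AC([a_{i-1},a_i],\mathbb{C}),\ D_i^{[2]}y\in L_2\},$$ and the minimal operator $L_{i,0}y=l_i[y]$ with $$\mathrm{Dom}(L_{i,0})=\{y\in\mathrm{Dom}(L_{i,1}) : D_i^{[k]}y(a_{i-1})=D_i^{[k]}y(a_i)=0,\ k=0,1\}.$$ Identify $L_2([a,b],\mathbb{C})$ with $\oplus_{i=1}^m L_2([a_{i-1},a_i],\mathbb{C})$, so that $y=\oplus_i y_i$, and put $L_{\max}=\oplus_{i=1}^m L_{i,1}$, $L_{\min}=\oplus_{i=1}^m L_{i,0}$. The operators $L_{\max},L_{\min}$ are closed and densely defined, $L_{\min}$ is symmetric with deficiency indices $(2m,2m)$, and $L_{\min}^*=L_{\max}$, $L_{\max}^*=L_{\min}$. Boundary maps on each interval. For $y\in\mathrm{Dom}(L_{i,1})$, $$\Gamma_{1,i}y:=\bigl(D_i^{[1]}y(a_{i-1}+),\,-D_i^{[1]}y(a_i-)\bigr)\in\mathbb{C}^2,\qquad \Gamma_{2,i}y:=\bigl(y(a_{i-1}+),\,y(a_i-)\bigr)\in\mathbb{C}^2.$$ Boundary triplet. For a closed densely defined symmetric operator $T$ with equal deficiency indices in a Hilbert space $\mathcal{H}$, a boundary triplet is a triplet $(H,\Gamma_1,\Gamma_2)$, where $H$ is a Hilbert space and $\Gamma_1,\Gamma_2:\mathrm{Dom}(T^* )\to H$ are linear maps such that: (1) for all $f,g\in\mathrm{Dom}(T^* )$, $(T^*f,g)_{\mathcal{H}}-(f,T^*g)_{\mathcal{H}}=(\Gamma_1f,\Gamma_2g)_H-(\Gamma_2f,\Gamma_1g)_H$;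 (2) for any $g_1,g_2\in H$ there is $f\in\mathrm{Dom}(T^* )$ with $\Gamma_1f=g_1$ and $\Gamma_2f=g_2$. *)

(* Defs.v *)
From HB Require Import structures.
From mathcomp Require Import all_boot all_order all_algebra.
From mathcomp Require Import all_classical all_reals all_analysis.
From mathcomp Require Import measurable_realfun complex.
From mathcomp Require Import ring lra.
Set Implicit Arguments.
Unset Strict Implicit.
Unset Printing Implicit Defensive.
Import Order.TTheory GRing.Theory Num.Theory Num.Def.
Import numFieldNormedType.Exports.
Local Open Scope classical_set_scope.
Local Open Scope ring_scope.

(* A (possibly unbounded) operator is represented by its graph. The abstract
   notions are stated over an inner-product space, linear in the first argument;
   completeness of the space plays no role in their formulation. *)
Section LinearRelations.
Context (C : numClosedFieldType) (V : lmodType C) (dot : {dot V for @conjC C}).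
Implicit Types (T : set (V * V)) (S : set V) (u v : V).

Definition dom T : set V := [set u | exists v, T (u, v)].

Definition is_linear_operator T :=
  [/\ T (0, 0),
      forall (k : C) u u' v v', T (u, u') -> T (v, v') ->
        T (k *: u + v, k *: u' + v')
    & forall u u' u'', T (u, u') -> T (u, u'') -> u' = u''].

Definition densely_defined T :=
  forall u (e : C), 0 < e -> exists2 v, dom T v & dot (u - v) (u - v) < e.

Definition closed_operator T :=
  forall u u',
    (forall e : C, 0 < e -> exists v v',
      [/\ T (v, v'), dot (u - v) (u - v) < e & dot (u' - v') (u' - v') < e]) ->
    T (u, u').

Definition adjoint T : set (V * V) :=
  [set vw | forall u u', T (u, u') -> dot u' vw.1 = dot u vw.2].

Definition symmetric_operator T :=
  forall u u' v v', T (u, u') -> T (v, v') -> dot u' v = dot u v'.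

Definition deficiency_space T (z : C) : set V :=
  [set u | adjoint T (u, z *: u)].

(* For a closed subspace S of a Hilbert space, this is an orthonormal (Hilbert)
   basis of S: the last clause says that the span of e is dense in S. *)
Definition orthonormal_basis (I : Type) (e : I -> V) S :=
  [/\ forall i, S (e i),
      forall i, dot (e i) (e i) = 1,
      forall i j, i <> j -> dot (e i) (e j) = 0
    & forall u, S u -> (forall i, dot u (e i) = 0) -> u = 0].

(* The deficiency indices are the Hilbert dimensions of ker (T^* -+ i); two
   such dimensions are equal iff there are bases with a common index type. *)
Definition equal_deficiency_indices T :=
  exists (I : Type) (e e' : I -> V),
    orthonormal_basis e (deficiency_space T 'i) /\
    orthonormal_basis e' (deficiency_space T (- 'i)).

End LinearRelations.

(* G1 and G2 are maps with domain D (their values outside D are irrelevant). *)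
Record boundary_triplet (C : numClosedFieldType) (V K : lmodType C)
    (dotV : {dot V for @conjC C}) (dotK : {dot K for @conjC C})
    (T : set (V * V)) (D : set V) (G1 G2 : V -> K) : Prop := BoundaryTriplet {
  bt_operator : is_linear_operator T;
  bt_dense : densely_defined dotV T;
  bt_closed : closed_operator dotV T;
  bt_symmetric : symmetric_operator dotV T;
  bt_deficiency : equal_deficiency_indices dotV T;
  bt_domain : D = dom (adjoint dotV T);
  bt_linear1 : forall k f g, D f -> D g -> G1 (k *: f + g) = k *: G1 f + G1 g;
  bt_linear2 : forall k f g, D f -> D g -> G2 (k *: f + g) = k *: G2 f + G2 g;
  bt_green : forall f f' g g',
    adjoint dotV T (f, f') -> adjoint dotV T (g, g') ->
    dotV f' g - dotV f g' = dotK (G1 f) (G2 g) - dotK (G2 f) (G1 g);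
  bt_onto : forall g1 g2, exists f, [/\ D f, G1 f = g1 & G2 f = g2]
}.

Local Open Scope quotient_scope.
Local Open Scope complex_scope.

(* L2 a b is the space of square-integrable functions [a, b] -> R[i] modulo
   equality a.e. on [a, b]; representatives are defined on the whole line, and
   only their restriction to [a, b] matters. Representatives are Borel
   measurable, which yields the same space as Lebesgue measurability since
   every a.e.-class of Lebesgue measurable functions contains a Borel one. *)
Section SquareIntegrable.
Context {R : realType}.
Local Notation mu := (@lebesgue_measure R).
Local Notation Re := (@complex.Re R).
Local Notation Im := (@complex.Im R).
Implicit Types (a b : R) (f g : R -> R[i]).

Definition cnormsq (z : R[i]) : R := Re z ^+ 2 + Im z ^+ 2.

Definition sq_integrable a b f :=
  [/\ measurable_fun `[a, b] (Re \o f), measurable_fun `[a, b] (Im \o f)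
    & mu.-integrable `[a, b] (EFin \o (cnormsq \o f))].

Local Notation ae_eq_on a b f g := (@ae_eq _ _ _ mu (fun=> R[i]) `[a, b]%classic f g).
Let aeF : Filter (almost_everywhere mu) := ae_filter_ringOfSetsType mu.

Definition cintegral a b f : R[i] :=
  (\int[mu]_(x in `[a, b]) Re (f x)) +i* (\int[mu]_(x in `[a, b]) Im (f x)).

Definition cintegrable a b f :=
  mu.-integrable `[a, b] (EFin \o (Re \o f)) /\
  mu.-integrable `[a, b] (EFin \o (Im \o f)).

Lemma sq_integrable_lin a b k f g : sq_integrable a b f -> sq_integrable a b g ->
  sq_integrable a b (k *: f + g).
Proof.
case: k => kr ki [mf1 mf2 If] [mg1 mg2 Ig].
have mR : measurable_fun `[a, b] (Re \o ((kr +i* ki) *: f + g)).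
  rewrite (_ : _ \o _ = fun x => (kr * Re (f x) - ki * Im (f x)) + Re (g x)); last first.
    by apply/funext => x /=; rewrite /GRing.add /= /GRing.scale /=; case: (f x) (g x) => ? ? [].
  apply: measurable_funD => //; apply: measurable_funB; exact: measurable_funM.
have mI : measurable_fun `[a, b] (Im \o ((kr +i* ki) *: f + g)).
  rewrite (_ : _ \o _ = fun x => (kr * Im (f x) + ki * Re (f x)) + Im (g x)); last first.
    by apply/funext => x /=; rewrite /GRing.add /= /GRing.scale /=; case: (f x) (g x) => ? ? [].
  apply: measurable_funD => //; apply: measurable_funD; exact: measurable_funM.
split => //.
have If' := @integrableZl _ _ _ mu _ (measurable_itv _) (2 * (kr ^+ 2 + ki ^+ 2)) _ If.
have Ig' := @integrableZl _ _ _ mu _ (measurable_itv _) 2 _ Ig.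
apply: le_integrable (integrableD _ If' Ig') => //.
  apply/measurable_EFinP; rewrite /cnormsq; apply: measurable_funD; exact: measurable_funX.
move=> x _ /=; rewrite lee_fin.
have -> : (kr +i* ki *: f + g) x = (kr +i* ki) * f x + g x by [].
case: (f x) (g x) => fr fi [gr gi]; rewrite /cnormsq /=.
rewrite [leLHS]ger0_norm ?[leRHS]ger0_norm.
rewrite -subr_ge0.
  set z := (X in 0 <= X).
  have -> : z = (kr * fr - ki * fi - gr) ^+ 2 + (kr * fi + ki * fr - gi) ^+ 2.
    by rewrite /z; ring.
  by rewrite addr_ge0 ?sqr_ge0.
- by rewrite addr_ge0 // mulr_ge0 // ?mulr_ge0 // addr_ge0 ?sqr_ge0.
- by rewrite addr_ge0 ?sqr_ge0.
Qed.

Lemma sq_integrable0 a b : sq_integrable a b 0.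
Proof.
split; [exact: measurable_cst|exact: measurable_cst|].
rewrite (_ : EFin \o _ = cst 0%E); last first.
  by apply/funext => x /=; rewrite /cnormsq /= expr0n addr0.
exact: integrable0.
Qed.


Definition L2pred a b : {pred R -> R[i]} := fun f => `[< sq_integrable a b f >].

Lemma L2pred_submod_closed a b : submod_closed (L2pred a b).
Proof.
split; first exact/asboolP/sq_integrable0.
by move=> k f g /asboolP Hf /asboolP Hg; apply/asboolP/sq_integrable_lin.
Qed.

HB.instance Definition _ a b :=
  GRing.isSubmodClosed.Build R[i] (R -> R[i]) (L2pred a b)
    (@L2pred_submod_closed a b).

Record L2fun a b := MkL2fun { L2fun_val :> R -> R[i] ; _ : L2fun_val \in L2pred a b }.
HB.instance Definition _ a b := [isSub for @L2fun_val a b].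
HB.instance Definition _ a b := [Choice of L2fun a b by <:].
HB.instance Definition _ a b := [SubChoice_isSubLmodule of L2fun a b by <:].

Definition ae_null a b : {pred L2fun a b} := fun f : L2fun a b => `[< ae_eq_on a b f 0 >].

Lemma ae_null_zmod_closed a b : zmod_closed (@ae_null a b).
Proof.
split; first exact/asboolP/ae_eq_refl.
move=> f g /asboolP Hf /asboolP Hg; apply/asboolP.
apply: (@filterS2 _ _ aeF) Hf Hg => x Hf Hg xab.
by rewrite /= [LHS](_ : _ = f x - g x) // Hf // Hg // subr0.
Qed.

HB.instance Definition _ a b :=
  GRing.isZmodClosed.Build (L2fun a b) (@ae_null a b) (@ae_null_zmod_closed a b).

Definition L2 a b : Type := @Quotient.quot (L2fun a b) (@ae_null a b).
HB.instance Definition _ a b := Choice.on (L2 a b).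
HB.instance Definition _ a b := GRing.Zmodule.on (L2 a b).
HB.instance Definition _ a b := EqQuotient.on (L2 a b).

Definition L2repr a b (u : L2 a b) : R -> R[i] := L2fun_val (repr u).

Lemma pi_eqP a b (f g : L2fun a b) :
  \pi_(L2 a b) f = \pi_(L2 a b) g <-> ae_eq_on a b f g.
Proof.
have E : (f - g \in @ae_null a b) = (\pi_(L2 a b) f == \pi_(L2 a b) g).
  exact: (@Quotient.idealrBE _ (@ae_null a b)).
split=> [/eqP|fg].
  rewrite -E => /asboolP; apply: (@filterS _ _ aeF) => x H xab; apply/eqP; rewrite -subr_eq0.
  by apply/eqP; exact: H.
apply/eqP; rewrite -E; apply/asboolP; apply: (@filterS _ _ aeF) fg => x H xab.
by rewrite [LHS](_ : _ = f x - g x) // H // subrr.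
Qed.

Lemma L2repr_pi a b (f : L2fun a b) : ae_eq_on a b (L2repr (\pi_(L2 a b) f)) f.
Proof. by apply/pi_eqP; rewrite reprK. Qed.

Lemma L2repr_sq a b (u : L2 a b) : sq_integrable a b (L2repr u).
Proof. by rewrite /L2repr; case: (repr u) => f /= /asboolP. Qed.

Lemma L2_eqP a b (u v : L2 a b) : u = v <-> ae_eq_on a b (L2repr u) (L2repr v).
Proof. by rewrite -{1}[u]reprK -{1}[v]reprK; exact: pi_eqP. Qed.

Definition L2scale a b (k : R[i]) (u : L2 a b) : L2 a b := \pi_(L2 a b) (k *: repr u).

Lemma L2scale_pi a b k (f : L2fun a b) : L2scale k (\pi_(L2 a b) f) = \pi_(L2 a b) (k *: f).
Proof.
apply/pi_eqP; have := L2repr_pi f; apply: (@filterS _ _ aeF) => x H xab.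
rewrite [LHS](_ : _ = k * L2repr (\pi_(L2 a b) f) x) // [RHS](_ : _ = k * f x) //.
by rewrite H.
Qed.

Lemma pi_L2D a b (f g : L2fun a b) :
  \pi_(L2 a b) (f + g) = \pi_(L2 a b) f + \pi_(L2 a b) g.
Proof. exact: (@Quotient.pi_add _ (@ae_null a b)). Qed.

Lemma pi_L20 a b : \pi_(L2 a b) 0 = 0.
Proof. by apply: (addrI (\pi_(L2 a b) 0)); rewrite -pi_L2D !addr0. Qed.

Fact L2scaleA a b k l (u : L2 a b) : L2scale k (L2scale l u) = L2scale (k * l) u.
Proof. by elim/quotW: u => f; rewrite (L2scale_pi l) !L2scale_pi scalerA. Qed.
Fact L2scale1 a b : left_id 1 (@L2scale a b).
Proof. by elim/quotW => f; rewrite L2scale_pi scale1r. Qed.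
Fact L2scaleDr a b : right_distributive (@L2scale a b) +%R.
Proof.
move=> k; elim/quotW => f; elim/quotW => g.
by rewrite -pi_L2D !L2scale_pi scalerDr pi_L2D.
Qed.
Fact L2scaleDl a b (u : L2 a b) : {morph (@L2scale a b)^~ u : k l / k + l}.
Proof.
by move=> k l; elim/quotW: u => f; rewrite !L2scale_pi scalerDl pi_L2D.
Qed.

HB.instance Definition _ a b := GRing.Zmodule_isLmodule.Build R[i] (L2 a b)
  (@L2scaleA a b) (@L2scale1 a b) (@L2scaleDr a b) (@L2scaleDl a b).

Lemma L2reprP a b k (u v : L2 a b) :
  ae_eq_on a b (L2repr (k *: u + v)) (fun x => k * L2repr u x + L2repr v x).
Proof.
have -> : k *: u + v = \pi_(L2 a b) (k *: repr u + repr v).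
  by rewrite pi_L2D reprK -L2scale_pi reprK.
exact: L2repr_pi.
Qed.

Definition cprod f g : R -> R[i] := fun x => f x * (g x)^*.

Lemma cprodE f g x : cprod f g x =
  (Re (f x) * Re (g x) + Im (f x) * Im (g x)) +i*
  (Im (f x) * Re (g x) - Re (f x) * Im (g x)).
Proof.
rewrite /cprod; case: (f x) (g x) => fr fi [gr gi] /=.
by congr (_ +i* _); ring.
Qed.

Let norm_mulD_le (p q r s : R) :
  `|p * q + r * s| <= p ^+ 2 + r ^+ 2 + (q ^+ 2 + s ^+ 2).
Proof.
have A x y : `|x * y : R| <= x ^+ 2 + y ^+ 2.
  rewrite ler_norml -subr_ge0; have := sqr_ge0 (x + y); have := sqr_ge0 (x - y).
  have := sqr_ge0 x; have := sqr_ge0 y; rewrite !sqrrD sqrrN mulrN.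
  by move=> *; apply/andP; split; lra.
apply: le_trans (ler_normD _ _) _; apply: le_trans (lerD (A _ _) (A _ _)) _.
by rewrite addrACA.
Qed.

Lemma cintegrable_cprod a b f g : sq_integrable a b f -> sq_integrable a b g ->
  cintegrable a b (cprod f g).
Proof.
move=> [mf1 mf2 If] [mg1 mg2 Ig]; split.
- apply: le_integrable (integrableD _ If Ig) => //.
    apply/measurable_EFinP.
    rewrite (_ : _ \o _ = fun x => Re (f x) * Re (g x) + Im (f x) * Im (g x)).
      by apply: measurable_funD; apply: measurable_funM.
    by apply/funext => x /=; rewrite cprodE.
  move=> x _; rewrite /= lee_fin cprodE /= /cnormsq.
  case: (f x) (g x) => fr fi [gr gi] /=.
  by rewrite [leRHS]ger0_norm ?addr_ge0 ?sqr_ge0 //.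
- apply: le_integrable (integrableD _ If Ig) => //.
    apply/measurable_EFinP.
    rewrite (_ : _ \o _ = fun x => Im (f x) * Re (g x) - Re (f x) * Im (g x)).
      by apply: measurable_funB; apply: measurable_funM.
    by apply/funext => x /=; rewrite cprodE.
  move=> x _; rewrite /= lee_fin cprodE /= /cnormsq.
  case: (f x) (g x) => fr fi [gr gi] /=.
  rewrite [leRHS]ger0_norm ?addr_ge0 ?sqr_ge0 // -mulNr [fr ^+ 2 + _]addrC -[fr ^+ 2]sqrrN.
  exact: norm_mulD_le.
Qed.

Lemma cintegralD a b f g : cintegrable a b f -> cintegrable a b g ->
  cintegral a b (fun x => f x + g x) = cintegral a b f + cintegral a b g.
Proof.
move=> [f1 f2] [g1 g2]; rewrite /cintegral [RHS]/GRing.add /=; congr (_ +i* _).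
- rewrite -RintegralD //; apply: eq_Rintegral => x _.
  by case: (f x) (g x) => ? ? [].
- rewrite -RintegralD //; apply: eq_Rintegral => x _.
  by case: (f x) (g x) => ? ? [].
Qed.

Lemma cintegralZ a b k f : cintegrable a b f ->
  cintegral a b (fun x => k * f x) = k * cintegral a b f.
Proof.
case: k => kr ki [f1 f2]; rewrite /cintegral [RHS]/GRing.mul /=.
have mD : measurable (`[a, b]%classic : set R) by exact: measurable_itv.
have I1 k : mu.-integrable `[a, b] (EFin \o (fun x => k * Re (f x))).
  exact: (@integrableZl _ _ _ mu _ mD k _ f1).
have I2 k : mu.-integrable `[a, b] (EFin \o (fun x => k * Im (f x))).
  exact: (@integrableZl _ _ _ mu _ mD k _ f2).
congr (_ +i* _).
- transitivity (\int[mu]_(x in `[a, b]) (kr * Re (f x) - ki * Im (f x))).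
    by apply: eq_Rintegral => x _; case: (f x).
  by rewrite (@RintegralB _ _ _ mu _ _ _ mD (I1 kr) (I2 ki)) !RintegralZl.
- transitivity (\int[mu]_(x in `[a, b]) (kr * Im (f x) + ki * Re (f x))).
    by apply: eq_Rintegral => x _; case: (f x).
  by rewrite (@RintegralD _ _ _ mu _ _ _ mD (I2 kr) (I1 ki)) !RintegralZl.
Qed.

Lemma cintegralC a b f : cintegrable a b f ->
  cintegral a b (fun x => (f x)^*) = (cintegral a b f)^*.
Proof.
move=> [f1 f2]; rewrite /cintegral /=; congr (_ +i* _).
  by apply: eq_Rintegral => x _; case: (f x).
rewrite -mulN1r -RintegralZl //; apply: eq_Rintegral => x _.
by case: (f x) => u v /=; rewrite mulN1r.
Qed.

Lemma ae_eq_cintegral a b f g : cintegrable a b f -> cintegrable a b g ->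
  ae_eq_on a b f g -> cintegral a b f = cintegral a b g.
Proof.
move=> [f1 f2] [g1 g2] fg; rewrite /cintegral; congr (_ +i* _).
- congr fine; apply: ae_eq_integral => //.
  + exact: measurable_int f1.
  + exact: measurable_int g1.
  + by apply: (@filterS _ _ aeF) fg => x H /= xab; rewrite H.
- congr fine; apply: ae_eq_integral => //.
  + exact: measurable_int f2.
  + exact: measurable_int g2.
  + by apply: (@filterS _ _ aeF) fg => x H /= xab; rewrite H.
Qed.

Definition L2dot a b (u v : L2 a b) : R[i] :=
  cintegral a b (cprod (L2repr u) (L2repr v)).

Lemma L2dot_hermitian a b (u v : L2 a b) :
  L2dot u v = (-1) ^+ false * conjC (L2dot v u).
Proof.
rewrite expr0 mul1r /L2dot -[conjC _]/(conjc _) -cintegralC; last exact: cintegrable_cprod (L2repr_sq _) (L2repr_sq _).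
congr cintegral; apply/funext => x; rewrite /cprod.
by case: (L2repr u x) (L2repr v x) => ? ? [? ?] /=; congr (_ +i* _); ring.
Qed.

Lemma L2dot_linearl a b (w : L2 a b) :
  GRing.linear_for ( *%R : R[i] -> R[i] -> R[i]) ((@L2dot a b) ^~ w).
Proof.
move=> k u v /=; rewrite /L2dot.
have S := @L2repr_sq a b.
have Iu := cintegrable_cprod (S u) (S w).
have Iv := cintegrable_cprod (S v) (S w).
rewrite -cintegralZ // -cintegralD //; last first.
  have := cintegrable_cprod (sq_integrable_lin k (S u) (@sq_integrable0 a b)) (S w).
  by congr cintegrable; apply/funext => x; rewrite /cprod [X in X * _](_ : _ = k * L2repr u x + 0) // addr0 mulrA.
apply: ae_eq_cintegral.
- exact: cintegrable_cprod.
- have := cintegrable_cprod (sq_integrable_lin k (S u) (S v)) (S w).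
  by congr cintegrable; apply/funext => x; rewrite /cprod [X in X * _](_ : _ = k * L2repr u x + L2repr v x) // mulrDl mulrA.
- by apply: (@filterS _ _ aeF) (L2reprP k u v) => x H xab; rewrite /cprod H // mulrDl mulrA.
Qed.

Lemma L2dot_linearr a b (w : L2 a b) :
  GRing.linear_for (conjC \; *%R : R[i] -> R[i] -> R[i]) (@L2dot a b w).
Proof.
move=> k u v /=; rewrite L2dot_hermitian L2dot_linearl rmorphD rmorphM mulrDr.
by rewrite !expr0 !mul1r [in RHS]L2dot_hermitian expr0 mul1r [L2dot w v]L2dot_hermitian expr0 mul1r.
Qed.

HB.instance Definition _ a b := bilinear_isBilinear.Build R[i] (L2 a b) (L2 a b)
  R[i] *%R (conjC \; *%R) (@L2dot a b) (@L2dot_linearl a b, @L2dot_linearr a b).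
HB.instance Definition _ a b := isHermitianSesquilinear.Build R[i] (L2 a b)
  false conjC (@L2dot a b) (@L2dot_hermitian a b).

Lemma L2dot_gt0 a b (u : L2 a b) : u != 0 -> 0 < L2dot u u.
Proof.
move=> u0; have [m1 m2 I] := L2repr_sq u.
have -> : L2dot u u = (\int[mu]_(x in `[a, b]) cnormsq (L2repr u x))%:C.
  rewrite /L2dot /cintegral; congr (_ +i* _).
    by apply: eq_Rintegral => x _; rewrite cprodE /= -!expr2.
  rewrite -[RHS](@Rintegral_set0 _ _ _ mu (cst 0)).
  rewrite Rintegral_set0 /Rintegral integral0_eq // => x _.
  by rewrite cprodE /= mulrC subrr.
rewrite ltcE /= eqxx /= lt_neqAle; apply/andP; split; last first.
  by apply: Rintegral_ge0 => x _; rewrite addr_ge0 ?sqr_ge0.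
apply: contra u0 => /eqP H; apply/eqP.
suff: ae_eq_on a b (L2repr u) 0.
  have := L2repr_pi (0 : L2fun a b) => /ae_eq_sym H0 /ae_eq_trans /(_ H0).
  move=> /L2_eqP ->.
  exact: pi_L20.
have J : (\int[mu]_(x in `[a, b]) `|(EFin \o (cnormsq \o L2repr u)) x| = 0)%E.
  rewrite (_ : integral _ _ _ = (\int[mu]_(x in `[a, b]) cnormsq (L2repr u x))%:E).
    by rewrite -H.
  rewrite /Rintegral fineK; last exact: integrable_fin_num.
  apply: eq_integral => x _ /=; rewrite ger0_norm //.
  by rewrite addr_ge0 ?sqr_ge0.
have /(ae_eq_integral_abs _ _ (measurable_int _ I)) := J.
move=> /(_ (measurable_itv _)); apply: (@filterS _ _ aeF) => x /= + xab => /(_ xab) [].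
rewrite /cnormsq; case: (L2repr u x) => p q /= /eqP.
by rewrite paddr_eq0 ?sqr_ge0 // !sqrf_eq0 => /andP[/eqP -> /eqP ->].
Qed.

HB.instance Definition _ a b := isDotProduct.Build R[i] (L2 a b) (@L2dot a b)
  (@L2dot_gt0 a b).

Definition L2class a b f : L2 a b := \pi_(L2 a b) (insubd (0 : L2fun a b) f).

Lemma L2repr_class a b f : sq_integrable a b f ->
  ae_eq_on a b (L2repr (L2class a b f)) f.
Proof.
move=> If; have := L2repr_pi (insubd (0 : L2fun a b) f).
by rewrite insubdK //; exact/asboolP.
Qed.

Definition L2restr a b c d (u : L2 a b) : L2 c d := L2class c d (L2repr u).

Lemma L2repr_restr a b c d (u : L2 a b) : a <= c -> d <= b ->
  ae_eq_on c d (L2repr (L2restr c d u)) (L2repr u).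
Proof.
move=> ac db; apply: L2repr_class; have [m1 m2 I] := L2repr_sq u.
have S : `[c, d] `<=` `[a, b].
  move=> x; rewrite /= !in_itv /= => /andP[cx xd].
  by rewrite (le_trans ac cx) (le_trans xd db).
have mab : measurable (`[a, b]%classic : set R) by exact: measurable_itv.
have mcd : measurable (`[c, d]%classic : set R) by exact: measurable_itv.
split.
- exact: measurable_funS m1.
- exact: measurable_funS m2.
- exact: integrableS I.
Qed.

End SquareIntegrable.

Section SturmLiouville.
Context {R : realType}.
Local Notation mu := (@lebesgue_measure R).
Local Notation Re := (@complex.Re R).
Local Notation Im := (@complex.Im R).
Implicit Types (p Q : R -> R) (a b x : R) (y : R -> R[i]).

(* Lebesgue measurability and integrability of a coefficient on [a, b]; the
   measurable sets are those of the completed Lebesgue measure. *)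
Definition lebesgue_measurable_fun a b p :=
  measurable_fun (T := caratheodory_type (@wlength R idfun)^*%mu)
    `[a, b]%classic p.

Definition lebesgue_L1 a b p : Prop :=
  (@completed_lebesgue_measure R).-integrable `[a, b] (EFin \o p).

Definition abs_continuous a b y :=
  forall e : R, 0 < e -> exists2 d : R, 0 < d &
    forall (n : nat) (s t : 'I_n -> R),
      (forall k, a <= s k /\ s k <= t k /\ t k <= b) ->
      (forall k l, k != l -> t k <= s l \/ t l <= s k) ->
      \sum_(k < n) (t k - s k) < d ->
      \sum_(k < n) `|y (t k) - y (s k)| < e%:C.

Definition is_cderive x y (dy : R[i]) :=
  is_derive x (1 : R) (Re \o y) (Re dy) /\ is_derive x (1 : R) (Im \o y) (Im dy).

(* y1 is a version of the first quasi-derivative p y' - Q y on [a, b]; it is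
   unique when it is required to be absolutely continuous. *)
Definition quasi_deriv1 p Q a b y y1 :=
  \forall x \ae mu, x \in `[a, b] ->
    exists2 dy, is_cderive x y dy & y1 x = (p x)%:C * dy - (Q x)%:C * y x.

(* y2 is a version of the second quasi-derivative, y1 being the first one. *)
Definition quasi_deriv2 p Q a b y y1 y2 :=
  \forall x \ae mu, x \in `[a, b] ->
    exists2 dy1, is_cderive x y1 dy1 &
      y2 x = dy1 + (Q x / p x)%:C * y1 x + (Q x ^+ 2 / p x)%:C * y x.

Definition max_domain p Q a b y y1 y2 :=
  [/\ sq_integrable a b y, abs_continuous a b y /\ abs_continuous a b y1,
      quasi_deriv1 p Q a b y y1, quasi_deriv2 p Q a b y y1 y2
    & sq_integrable a b y2].

Definition Lmax_itv p Q a b : set (L2 a b * L2 a b) :=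
  [set uv | exists y y1 y2, [/\ max_domain p Q a b y y1 y2,
     uv.1 = L2class a b y & uv.2 = - L2class a b y2]].

Definition Lmin_itv p Q a b : set (L2 a b * L2 a b) :=
  [set uv | exists y y1 y2, [/\ max_domain p Q a b y y1 y2,
     [/\ y a = 0, y b = 0, y1 a = 0 & y1 b = 0],
     uv.1 = L2class a b y & uv.2 = - L2class a b y2]].

(* The absolutely continuous representative of a class in the domain of the
   maximal operator, paired with its first quasi-derivative. Both are
   continuous on [a, b], so that their one-sided limits at the endpoints are
   their values there. *)
Definition quasi_rep p Q a b (u : L2 a b) : (R -> R[i]) * (R -> R[i]) :=
  xget (0, 0) [set yy | exists y2,
    max_domain p Q a b yy.1 yy.2 y2 /\ u = L2class a b yy.1].

Definition Gamma1_itv p Q a b (u : L2 a b) : 'rV[R[i]]_2 :=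
  let: (_, y1) := quasi_rep p Q u in
  \row_(j < 2) (if j == 0 then y1 a else - y1 b).

Definition Gamma2_itv p Q a b (u : L2 a b) : 'rV[R[i]]_2 :=
  let: (y, _) := quasi_rep p Q u in
  \row_(j < 2) (if j == 0 then y a else y b).

Section Partition.
Context (m : nat) (a : 'I_m.+1 -> R) (p Q : 'I_m -> R -> R).

Definition lend (i : 'I_m) : R := a (widen_ord (leqnSn m) i).
Definition rend (i : 'I_m) : R := a (lift ord0 i).

Definition L2sum : lmodType R[i] := L2 (a ord0) (a ord_max).

(* The identification of L2 over [a_0, a_m] with the direct sum of the L2
   spaces of the subintervals is given by the restriction maps. *)
Definition piece (i : 'I_m) (u : L2sum) : L2 (lend i) (rend i) :=
  L2restr (lend i) (rend i) u.

Definition direct_sum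
    (T : forall i, set (L2 (lend i) (rend i) * L2 (lend i) (rend i))) :
    set (L2sum * L2sum) :=
  [set uv | forall i, T i (piece i uv.1, piece i uv.2)].

Definition Lmax : set (L2sum * L2sum) :=
  direct_sum (fun i => @Lmax_itv (p i) (Q i) (lend i) (rend i)).
Definition Lmin : set (L2sum * L2sum) :=
  direct_sum (fun i => @Lmin_itv (p i) (Q i) (lend i) (rend i)).

Definition Gamma1 (u : L2sum) : 'rV[R[i]]_(m * 2) :=
  mxvec (\matrix_(i < m) Gamma1_itv (p i) (Q i) (piece i u)).

Definition Gamma2 (u : L2sum) : 'rV[R[i]]_(m * 2) :=
  mxvec (\matrix_(i < m) Gamma2_itv (p i) (Q i) (piece i u)).

End Partition.
End SturmLiouville.

Arguments Lmax {R m} a p Q.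
Arguments Lmin {R m} a p Q.
Arguments Gamma1 {R m} a p Q u.
Arguments Gamma2 {R m} a p Q u.

(* Main.v *)
Require Import Defs.
From mathcomp Require Import all_boot all_order all_algebra.
From mathcomp Require Import all_classical all_reals all_analysis.
From mathcomp Require Import complex measurable_realfun ring lra.
Set Implicit Arguments.
Unset Strict Implicit.
Unset Printing Implicit Defensive.
Import Order.TTheory GRing.Theory Num.Theory.
Import numFieldNormedType.Exports.
Local Open Scope classical_set_scope.
Local Open Scope ring_scope.

(** Write [r = Q/p], [s = 1/p] and [t = Q^2/p].  On one interval the expression
    [-D^[2] y] is a first-order system in disguise: [y] lies in the maximal
    domain with first quasi-derivative [y1] and second quasi-derivative [y2]
    exactly when [y] and [y1] are absolutely continuous and
    [y' = r y + s y1], [y1' = y2 - r y1 - t y] almost everywhere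
    ([max_domainP]).  The coefficients of this system are integrable.

    Three facts about the system carry the proof.  It is solvable for any
    square-integrable [y2] and any values of [y] and [y1] at the left endpoint
    ([solves_system_exists]), by Picard iteration in a norm weighted by the
    exponential of the integral of the coefficients
    ([linear_system_solution]).  The class of [y] in L2 determines [y], and
    then [y1] because [s] vanishes almost nowhere, and then [y2]
    ([solves_class_eq]); so the boundary maps are well defined.  Finally
    [(y conj(z1) - y1 conj(z))' = y conj(z2) - y2 conj(z)], as the terms with
    [r], [s], [t] cancel; integrating this product of absolutely continuous
    functions gives the Green formula ([green_formula], [Green_itv]).

    Let [z], [w] be the homogeneous solutions with Wronskian 1.  The Green
    formula against [z] and [w] turns the values of a solution at the right
    endpoint into the scalar products of its image with [z] and [w]
    ([transfer]).  Since the Gram matrix of [z], [w] is invertible, the image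
    can be chosen so that all four boundary values are prescribed
    ([solution_with_endpoints]).  The same computation shows that the minimal
    operator has range the orthogonal complement of [z] and [w], so that a
    vector in the domain of its adjoint differs from a solution of the
    inhomogeneous equation by a vector orthogonal to this complement, i.e. by
    a combination of [z] and [w] ([adjoint_Lmin_itv]).

    The remaining claims are formal consequences
    ([boundary_triplet_of_green]).  The minimal operator is the adjoint of the
    maximal one, hence closed.  If [h] is orthogonal to its domain, then
    the pair [(0, h)] is in the graph of its adjoint, i.e. of the maximal
    operator, so [h = 0]; as L2 is complete ([L2_complete]), this yields
    density ([L2_orth_dense]).  Complex
    conjugation commutes with the maximal operator because [p] and [Q] are
    real, and so it exchanges the two deficiency spaces.  All of this passes
    to the partition because L2 over the whole interval is the orthogonal sum
    of the L2 spaces of the pieces ([L2dot_pieces], [glue_pieces]). *)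

(** * Absolutely continuous functions *)

Section AbsolutelyContinuous.
Context {R : realType}.
Local Notation mu := (@lebesgue_measure R).
Implicit Types (a b c x : R) (f g : R -> R).

(** Real-valued counterpart of [abs_continuous], which it describes componentwise
    through [abs_continuousP]; real and imaginary parts are integrated
    separately. *)
Definition abscont a b f :=
  forall e : R, 0 < e -> exists2 d : R, 0 < d &
    forall (n : nat) (s t : 'I_n -> R),
      (forall k, a <= s k /\ s k <= t k /\ t k <= b) ->
      (forall k l, k != l -> t k <= s l \/ t l <= s k) ->
      \sum_(k < n) (t k - s k) < d ->
      \sum_(k < n) `|f (t k) - f (s k)| < e.

(** The supremum of the points reached by [P] is itself reached, and nothing stops
    there.  Letting [u] and [v] range on both sides of [c] makes each step a
    tagged interval, as in a proof by Cousin partitions. *)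
Lemma real_induction (P : R -> Prop) a b : a <= b -> P a ->
  (forall c, a <= c -> c <= b -> exists2 d, 0 < d & forall u v,
     a <= u -> u <= c -> c <= v -> v <= b -> c - d < u -> v < c + d ->
     P u -> P v) ->
  P b.
Proof.
move=> ab Pa step.
pose S := [set x | a <= x <= b /\ P x].
have Sa : S a by split => //; rewrite lexx.
have hS : has_sup S.
  by split; [exists a|exists b => x [/andP[_ ?] _]].
set c := sup S.
have ac : a <= c by exact: (ub_le_sup hS.2).
have cb : c <= b.
  by apply: ge_sup; [exists a|move=> x [/andP[_ ?] _]].
have [d d0 H] := step c ac cb.
have [u [/andP[au ub] Pu] ucd] : exists2 u, S u & c - d < u.
  by apply: sup_adherent => //.
have uc : u <= c by apply: (ub_le_sup hS.2); split => //; rewrite au.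
pose v := Num.min b (c + d / 2).
have vb : v <= b by rewrite /v ge_min lexx.
have cv : c <= v by rewrite /v le_min cb lerDl divr_ge0 // ltW.
have Pv : P v.
  apply: (H u v) => //; rewrite /v gt_min; apply/orP; right.
  by rewrite ltrD2l ltr_pdivrMr // ltr_pMr // ltr1n.
have : v <= c.
  by apply: (ub_le_sup hS.2); split => //; rewrite vb (le_trans ac cv).
rewrite /v ge_min => /orP[bc|].
  by move: Pv; rewrite /v min_l // (le_trans bc) // lerDl divr_ge0 // ltW.
by rewrite leNgt ltrDl divr_gt0.
Qed.

Lemma is_derive_near x f (l : R) : is_derive x 1 f l -> forall e, 0 < e ->
  exists2 d, 0 < d & forall z, `|z - x| < d ->
    `|f z - f x - l * (z - x)| <= e * `|z - x|.
Proof.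
move=> [df <-] e e0.
have /cvgrPdist_le /(_ e e0) :
  (fun h => h^-1 *: ((f \o shift x) (h *: 1) - f x)) @ 0^' --> 'D_1 f x := df.
move=> [d /= d0 H]; exists d => // z zd.
have [->|zx] := eqVneq z x; first by rewrite !subrr mulr0 subrr normr0 mulr0.
have zx0 : z - x != 0 by rewrite subr_eq0.
have := H (z - x); rewrite /= sub0r normrN => /(_ zd zx0).
rewrite scaler1 subrK => {}H.
have -> : f z - f x - 'D_1 f x * (z - x) =
    - ('D_1 f x - (z - x)^-1 *: (f z - f x)) * (z - x).
  by rewrite opprB mulrBl [_ *: _ * _]mulrAC mulVf // mul1r.
by rewrite normrM normrN ler_wpM2r.
Qed.

Lemma abscont_subset a b c d f : a <= c -> d <= b -> abscont a b f -> abscont c d f.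
Proof.
move=> ac db Hf e e0; have [d0 d00 H] := Hf e e0; exists d0 => // n s t st.
apply: H => k; have [h1 [h2 h3]] := st k.
by split; [exact: le_trans h1|split => //; exact: le_trans db].
Qed.

(** Points with zero derivative contribute at most [e] times the length, and the
    exceptional null set sits in an open set so small that absolute continuity
    makes its contribution less than [e].  Real induction replaces the Vitali
    covering theorem here: the invariant [P x] records the intervals spent so
    far inside the open set. *)
Lemma abscont_derive0 a b f : a <= b -> abscont a b f ->
  (\forall x \ae mu, a < x -> x < b -> is_derive x (1 : R) f 0) -> f b = f a.
Proof.
move=> ab ACf [N [mN N0 HN]].
apply/eqP; rewrite -subr_eq0 -normr_le0; apply/ler_addgt0Pl => eps eps0.
rewrite addr0.
pose e := eps / (b - a + 1).
have ba1 : 0 < b - a + 1 by rewrite addrC ltr_pwDl // subr_ge0.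
have e0 : 0 < e by rewrite divr_gt0.
have [d d0 Hd] := ACf e e0.
pose N' := N `|` [set a] `|` [set b].
have mNa : @measurable _ (measurableTypeR R) (N `|` [set a]).
  exact: (@measurableU _ (measurableTypeR R) _ _ mN (measurable_set1 a)).
have mN' : @measurable _ (measurableTypeR R) N'.
  exact: (@measurableU _ (measurableTypeR R) _ _ mNa (measurable_set1 b)).
have N'0 : mu N' = 0%E.
  have E1 := measureU0 mNa (measurable_set1 b) (lebesgue_measure_set1 b).
  by rewrite [LHS]E1 (measureU0 mN (measurable_set1 a) (lebesgue_measure_set1 a)).
have N'fin : (mu N' < +oo)%E by rewrite N'0.
have [U [oU NU Ud]] := lebesgue_regularity_outer mN' N'fin d0.
have mU : measurable U by exact: open_measurable.
have {}Ud : (mu U < d%:E)%E.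
  have -> : mu U = (mu N' + mu (U `\` N'))%E.
    have /= := @measureD _ _ _ mu U N' mU mN'.
    rewrite -measureU //; last 2 first.
    - exact: measurableD.
    - by rewrite setDIK.
    by move=> _; rewrite setDUK.
  by rewrite N'0 add0e.
pose P x := exists n (s t : nat -> R),
  [/\ forall k, (k < n)%N -> a <= s k /\ s k <= t k /\ t k <= x,
      forall k l, (k < l < n)%N -> t k <= s l,
      ((\sum_(k < n) (t k - s k))%:E <= mu (U `&` `]a, x]))%E
    & `|f x - f a| <= e * (x - a) + \sum_(k < n) `|f (t k) - f (s k)|].
have : P b.
  apply: (@real_induction P a b) => //.
    exists 0%N, (fun=> 0), (fun=> 0); split; first by [].
    - by move=> k l /andP[_].
    - by rewrite big_ord0; exact: measure_ge0.
    - by rewrite big_ord0 addr0 !subrr normr0 mulr0.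
  move=> c ac cb.
  have [cU|cU] := pselect (U c).
    have [r /= r0 Hr] : nbhs c U by apply: open_nbhs_nbhs.
    exists r => // u v au uc cv vb cu vc [n [s [t [st disj sumU dist]]]].
    exists n.+1, (fun k => if k == n then u else s k), (fun k => if k == n then v else t k).
    have nE (k : 'I_n) : (k == n :> nat) = false by apply/negbTE; rewrite neq_ltn ltn_ord.
    split.
    - move=> k; rewrite ltnS leq_eqVlt => /orP[/eqP ->|kn].
        by rewrite eqxx; split => //; split => //; exact: le_trans cv.
      have [h1 [h2 h3]] := st k kn.
      rewrite (ltn_eqF kn); split => //; split => //.
      by rewrite (le_trans h3) // (le_trans uc).
    - move=> k l /andP[kl]; rewrite ltnS leq_eqVlt => /orP[/eqP ln|ln].
        rewrite ln eqxx (ltn_eqF (leq_trans kl _)) ?ln //.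
        by have [] := st k; [rewrite -ln|move=> _ []].
      by rewrite (ltn_eqF ln) (ltn_eqF (ltn_trans kl ln)); apply: disj; rewrite kl.
    - rewrite big_ord_recr /= eqxx.
      under eq_bigr do rewrite nE.
      have -> : U `&` `]a, v] = (U `&` `]a, u]) `|` `]u, v].
        apply/seteqP; split => x /=; rewrite !in_itv /=.
          move=> [Ux /andP[ax xv]]; have [xu|ux] := leP x u.
            by left; rewrite ax.
          by right; rewrite xv.
        move=> [[Ux /andP[ax xu]]|/andP[ux xv]].
          by split => //; rewrite ax (le_trans xu) // (le_trans uc).
        split; last by rewrite xv (le_lt_trans au).
        apply: Hr; rewrite /ball /= ltr_norml; apply/andP; split; lra.
      rewrite measureU //; last 2 first.
        exact: measurableI.
        apply/seteqP; split => x //= [[_]]; rewrite !in_itv /= => /andP[_ xu] /andP[].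
        by rewrite ltNge xu.
      rewrite EFinD leeD //.
      suff : ((v - u)%:E <= mu `]u, v])%E by [].
      rewrite lebesgue_measure_itv /= lte_fin; case: ifPn => [uv|].
        by rewrite EFinB.
      by rewrite -leNgt => vu; rewrite lee_fin subr_le0.
    - rewrite big_ord_recr /= eqxx.
      under eq_bigr do rewrite nE.
      have -> : f v - f a = (f u - f a) + (f v - f u) by lra.
      rewrite (le_trans (ler_normD _ _)) // addrA lerD2r (le_trans dist) // lerD2r.
      by rewrite ler_pM2l // lerD2r (le_trans uc).
  have [|d1 d10 H1] := @is_derive_near c f 0 _ e e0.
    apply: contrapT => h; apply: cU; apply: NU.
    have [->|ca] := eqVneq c a; first by left; right.
    have [->|cb'] := eqVneq c b; first by right.
    left; left; apply: HN => /= h2; apply: h; apply: h2.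
      by rewrite lt_neqAle eq_sym ca.
    by rewrite lt_neqAle cb'.
  exists d1 => // u v au uc cv vb cu vc [n [s [t [st disj sumU dist]]]].
  exists n, s, t; split => //.
  - move=> k kn; have [h1 [h2 h3]] := st k kn; split => //; split => //.
    by rewrite (le_trans h3) // (le_trans uc).
  - apply: le_trans sumU _; apply: le_measure; rewrite ?inE.
    + exact: measurableI.
    + exact: measurableI.
    + move=> x [Ux] /=; rewrite !in_itv /= => /andP[ax xu]; split => //.
      by rewrite ax (le_trans xu) // (le_trans uc).
  - have -> : f v - f a = (f u - f a) + ((f v - f c) - (f u - f c)) by lra.
    have := H1 v; have := H1 u; rewrite !mul0r !subr0.
    rewrite (ger0_norm (_ : 0 <= v - c)) ?subr_ge0 //.
    rewrite (ler0_norm (_ : u - c <= 0)) ?subr_le0 // => /(_ _)Hu /(_ _)Hv.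
    have {}Hu : `|f u - f c| <= e * - (u - c) by apply: Hu; lra.
    have {}Hv : `|f v - f c| <= e * (v - c) by apply: Hv; lra.
    have h1 := ler_normD (f u - f a) ((f v - f c) - (f u - f c)).
    have h2 := ler_normB (f v - f c) (f u - f c).
    apply: le_trans h1 _; rewrite -[leRHS]addrC.
    have -> : e * (v - a) = e * (u - a) + (e * (v - c) + e * - (u - c)) by ring.
    lra.
move=> [n [s [t [st disj sumU dist]]]].
apply: (le_trans dist).
have : \sum_(k < n) `|f (t k) - f (s k)| < e.
  apply: Hd.
  - by move=> k; exact: st.
  - move=> k l; rewrite neq_ltn => /orP[kl|lk].
      by left; apply: disj; rewrite kl ltn_ord.
    by right; apply: disj; rewrite lk ltn_ord.
  - rewrite -lte_fin; apply: le_lt_trans sumU _; apply: le_lt_trans Ud.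
    apply: le_measure; rewrite ?inE //.
    + exact: measurableI.
move=> h; apply: le_trans (lerD (lexx _) (ltW h)) _.
have -> : e * (b - a) + e = e * (b - a + 1) by ring.
by rewrite /e divfK // gt_eqF.
Qed.

(** The closure properties of absolute continuity all follow from this one, by an
    elementary bound on the increments. *)
Lemma abscont_dominated a b (M : R) f g h : abscont a b f -> abscont a b g ->
  (forall s t, a <= s -> s <= t -> t <= b ->
     `|h t - h s| <= M * (`|f t - f s| + `|g t - g s|)) ->
  abscont a b h.
Proof.
move=> Hf Hg H e e0.
pose k := e / (`|M| + 1) / 2.
have k0 : 0 < k by rewrite !divr_gt0 // ltr_wpDl.
have [d1 d10 H1] := Hf k k0; have [d2 d20 H2] := Hg k k0.
exists (Num.min d1 d2); first by rewrite lt_min d10.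
move=> n s t st disj; rewrite lt_min => /andP[/(H1 _ _ _ st disj) h1 /(H2 _ _ _ st disj) h2].
apply: (@le_lt_trans _ _ ((`|M| + 1) * (\sum_(k < n) `|f (t k) - f (s k)| +
                                      \sum_(k < n) `|g (t k) - g (s k)|))).
  rewrite -big_split mulr_sumr; apply: ler_sum => i _.
  have [s1 [s2 s3]] := st i.
  apply: le_trans (H _ _ s1 s2 s3) _; rewrite ler_wpM2r ?addr_ge0 //.
  by rewrite (le_trans (ler_norm _)) // lerDl.
have -> : e = (`|M| + 1) * (k + k).
  rewrite /k -mulr2n -[_ / 2 *+ 2]mulr_natr divfK ?pnatr_eq0 //.
  by rewrite mulrC divfK // gt_eqF // ltr_wpDl.
by rewrite ltr_pM2l ?ltrD // ltr_wpDl.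
Qed.

Lemma abscont_cst a b c : abscont a b (fun=> c).
Proof.
move=> e e0; exists 1 => // n s t _ _ _; rewrite big1 // => k _.
by rewrite subrr normr0.
Qed.

Lemma eq_abscont a b f g : (forall x, a <= x -> x <= b -> f x = g x) ->
  abscont a b f -> abscont a b g.
Proof.
move=> fg Hf; apply: (abscont_dominated (M := 1) Hf Hf) => s t s1 s2 s3.
have as_ := le_trans s1 s2; have sb := le_trans s2 s3.
by rewrite !fg // mul1r lerDl.
Qed.

Lemma abscont_lin a b c f g : abscont a b f -> abscont a b g ->
  abscont a b (fun x => c * f x + g x).
Proof.
move=> Hf Hg; apply: (abscont_dominated (M := `|c| + 1) Hf Hg) => s t s1 s2 s3.
have -> : c * f t + g t - (c * f s + g s) = c * (f t - f s) + (g t - g s) by ring.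
rewrite (le_trans (ler_normD _ _)) // normrM mulrDr !mulrDl !mul1r.
have := normr_ge0 (f t - f s); have := normr_ge0 (g t - g s); have := normr_ge0 c.
move=> *; have := mulr_ge0 (normr_ge0 c) (normr_ge0 (g t - g s)); lra.
Qed.

Lemma abscont_add a b f g : abscont a b f -> abscont a b g -> abscont a b (fun x => f x + g x).
Proof.
move=> Hf Hg; apply: eq_abscont (abscont_lin 1 Hf Hg) => x _ _.
by rewrite mul1r.
Qed.

Lemma abscont_opp a b f : abscont a b f -> abscont a b (fun x => - f x).
Proof.
move=> Hf; apply: eq_abscont (abscont_lin (-1) Hf (abscont_cst a b 0)) => x _ _.
by rewrite mulN1r addr0.
Qed.

Lemma abscont_sub a b f g : abscont a b f -> abscont a b g -> abscont a b (fun x => f x - g x).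
Proof. by move=> Hf /abscont_opp; exact: abscont_add. Qed.

Lemma abscont_continuous a b f : abscont a b f -> {within `[a, b], continuous f}.
Proof.
move=> Hf; apply/subspace_continuousP => x /=; rewrite in_itv /= => /andP[ax xb].
apply/cvgrPdist_lt => e e0; have [d d0 H] := Hf e e0.
rewrite /= near_withinE; near=> z; rewrite /= in_itv /= => /andP[az zb].
have zx : `|z - x| < d.
  rewrite distrC; near: z; exact: (@nbhsx_ballx _ _ x d d0).
have [xz|/ltW zx'] := leP x z.
  have := H 1%N (fun=> x) (fun=> z); rewrite !big_ord1 distrC; apply => //.
    by move=> k l; rewrite !ord1.
  by rewrite (le_lt_trans (ler_norm _)).
have := H 1%N (fun=> z) (fun=> x); rewrite !big_ord1; apply => //.
  by move=> k l; rewrite !ord1.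
by rewrite (le_lt_trans (ler_norm _)) // distrC.
Unshelve. all: by end_near. Qed.

Lemma continuous_itv_bounded a b f : {within `[a, b], continuous f} ->
  exists2 M, 0 <= M & forall x, a <= x -> x <= b -> `|f x| <= M.
Proof.
move=> cf.
have /compact_bounded[M [_ mrt]] := continuous_compact cf (@segment_compact R a b).
exists (`|M| + 1); first by rewrite addr_ge0.
move=> x ax xb; apply: (mrt (`|M| + 1)); first by rewrite (le_lt_trans (ler_norm _)) // ltrDl.
by exists x => //=; rewrite in_itv /= ax.
Qed.

Lemma abscont_bounded a b f : abscont a b f ->
  exists2 M, 0 <= M & forall x, a <= x -> x <= b -> `|f x| <= M.
Proof. by move/abscont_continuous/continuous_itv_bounded. Qed.

Lemma abscont_mul a b f g : abscont a b f -> abscont a b g -> abscont a b (fun x => f x * g x).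
Proof.
move=> Hf Hg; have [M M0 HM] := abscont_bounded Hf; have [N N0 HN] := abscont_bounded Hg.
apply: (abscont_dominated (M := M + N) Hf Hg) => s t s1 s2 s3.
have -> : f t * g t - f s * g s = (f t - f s) * g t + f s * (g t - g s) by ring.
rewrite (le_trans (ler_normD _ _)) // !normrM.
have h1 : `|f t - f s| * `|g t| <= `|f t - f s| * N.
  by rewrite ler_wpM2l // HN // (le_trans s1).
have h2 : `|f s| * `|g t - g s| <= M * `|g t - g s|.
  by rewrite ler_wpM2r // HM // (le_trans s2).
have h3 := mulr_ge0 M0 (normr_ge0 (f t - f s)).
have h4 := mulr_ge0 N0 (normr_ge0 (g t - g s)).
rewrite mulrDl !mulrDr; lra.
Qed.

Lemma abscont_expR a b f : abscont a b f -> abscont a b (fun x => expR (f x)).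
Proof.
move=> Hf; have [M M0 HM] := abscont_bounded Hf.
have K u v : u <= v -> v <= M -> `|expR v - expR u| <= expR M * `|v - u|.
  move=> uv vM; rewrite !ger0_norm ?subr_ge0 ?ler_expR //.
  apply: (@le_trans _ _ (expR v * (v - u))).
    have -> : expR v - expR u = expR v * (1 - expR (u - v)).
      by rewrite mulrBr mulr1 -expRD [v + _]addrC subrK.
    by rewrite ler_pM2l ?expR_gt0 //; have := expR_ge1Dx (u - v); lra.
  by rewrite ler_wpM2r ?subr_ge0 // ler_expR.
apply: (abscont_dominated (M := expR M) Hf (abscont_cst a b 0)) => s t s1 s2 s3.
rewrite subrr normr0 addr0.
have ft : f t <= M by rewrite (le_trans (ler_norm _)) // HM // (le_trans s1).
have fs : f s <= M by rewrite (le_trans (ler_norm _)) // HM // (le_trans s2).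
have [h|/ltW h] := leP (f s) (f t); first exact: K.
by rewrite distrC [`|f t - _|]distrC; exact: K.
Qed.

Lemma continuous_itv_integrable a b f : {within `[a, b], continuous f} ->
  mu.-integrable `[a, b] (EFin \o f).
Proof. by move=> cf; apply: continuous_compact_integrable => //; exact: segment_compact. Qed.

Lemma continuous_itv_measurable a b f : {within `[a, b], continuous f} ->
  measurable_fun `[a, b] f.
Proof. by move=> cf; apply: subspace_continuous_measurable_fun. Qed.

(** Cutting [g] off outside [[a, b]] makes this an integral of a fixed function
    integrable on the whole line. *)
Definition primitive a b g x := \int[mu]_(t in `[a, x]) (g \_ `[a, b]) t.

Lemma primitiveE a b g x : x <= b -> primitive a b g x = \int[mu]_(t in `[a, x]) g t.
Proof.
move=> xb; apply: eq_Rintegral => t; rewrite inE /= in_itv /= => /andP[at_ tx].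
by rewrite patchE mem_set //= in_itv /= at_ (le_trans tx).
Qed.

Section Primitive.
Variables (a b : R) (g : R -> R).
Hypothesis ig : mu.-integrable `[a, b] (EFin \o g).

Let h := g \_ `[a, b].

Let ih : mu.-integrable setT (EFin \o h).
Proof.
by rewrite /h -restrict_EFin -integrable_mkcond.
Qed.

Let ihS (i : interval R) : mu.-integrable [set` i] (EFin \o h).
Proof. exact: integrableS ih. Qed.

Lemma primitive_start : primitive a b g a = 0.
Proof. by rewrite /primitive set_itv1 Rintegral_set1. Qed.

Lemma primitiveB s t : a <= s -> s <= t ->
  primitive a b g t - primitive a b g s = \int[mu]_(x in `]s, t]) h x.
Proof. by move=> as_ st; rewrite /primitive Rintegral_itvB. Qed.

Lemma abscont_primitive : abscont a b (primitive a b g).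
Proof.
move=> e e0; have [d [d0 H]] := integral_normr_continuous ih e0.
exists d => // n s t st disj sumd.
pose F (k : 'I_n) : set R := `]s k, t k]%classic.
have mF k : measurable (F k) by exact: measurable_itv.
have tF : trivIset setT F.
  apply/trivIsetP => k l _ _ kl; apply/seteqP; split => // x [] /=.
  rewrite /F /= !in_itv /= => /andP[h1 h2] /andP[h3 h4].
  by case: (disj k l kl) => h5; lra.
pose D := \big[setU/set0]_(k < n) F k.
have mD : @measurable _ (measurableTypeR R) D by apply: bigsetU_measurable => k _; exact: mF.
have muD : (mu D < d%:E)%E.
  rewrite /D (@measure_bigsetU_ord _ _ _ mu n xpredT F) //.
  apply: (@le_lt_trans _ _ (\sum_(k < n) (t k - s k))%:E); last by rewrite lte_fin.
  rewrite -sumEFin; apply: lee_sum => k _; have [_ [st1 _]] := st k.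
  suff : (mu (F k) <= (t k - s k)%:E)%E by [].
  rewrite lebesgue_measure_itv /= lte_fin; case: ifPn => // _.
  by rewrite lee_fin subr_ge0.
apply: le_lt_trans (H D mD muD).
have -> : \int[mu]_(x in D) `|h x| = \sum_(k < n) \int[mu]_(x in F k) `|h x|.
  apply: EFin_inj; rewrite -sumEFin.
  have iD A : measurable A -> (\int[mu]_(x in A) `|h x|)%:E = (\int[mu]_(x in A) `|h x|%:E)%E.
    move=> mA; rewrite fineK //.
    apply: integrable_fin_num => //.
    exact: (integrableS measurableT mA (@subsetT _ A) (integrable_norm ih)).
  rewrite iD //; under eq_bigr => k _ do rewrite (iD _ (mF k)).
  rewrite /D (@integral_bigsetU_EFin _ _ _ mu _ F) //.
  - exact: index_enum_uniq.
  - exact: sub_trivIset tF.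
  - exact: (measurable_funS measurableT (@subsetT _ _) (measurable_int _ (integrable_norm ih))).
apply: ler_sum => k _; have [st1 [st2 st3]] := st k.
rewrite primitiveB // le_normr_Rintegral //; exact: ihS.
Qed.

Lemma primitive_derive :
  \forall x \ae mu, a < x -> x < b -> is_derive x (1 : R) (primitive a b g) (g x).
Proof.
have /lebesgue_differentiation := integrable_locally (measurable_itv _) ig.
apply: filterS; first exact: (ae_filter_ringOfSetsType mu).
move=> x Hx ax xb.
have [] := @FTC1_lebesgue_pt R h (BLeft a) x (x + 1) _ _ _ Hx.
- by rewrite ltrDl.
- exact: ihS.
- by rewrite (@lte_fin R).
rewrite derive1E => d1 d2; apply: DeriveDef => //.
rewrite [LHS]d2 /h patchE mem_set //= in_itv /= !ltW //.
Qed.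

End Primitive.

(** [f] minus the primitive of [g] is absolutely continuous, and Lebesgue
    differentiation gives it derivative [0] almost everywhere. *)
Lemma abscont_FTC a b f g : a <= b -> abscont a b f -> mu.-integrable `[a, b] (EFin \o g) ->
  (\forall x \ae mu, a < x -> x < b -> is_derive x (1 : R) f (g x)) ->
  forall x, a <= x -> x <= b -> f x = f a + primitive a b g x.
Proof.
move=> ab ACf ig df x ax xb.
have AC1 : abscont a b (fun x => f x - primitive a b g x).
  by apply: abscont_sub => //; exact: abscont_primitive.
suff : f x - primitive a b g x = f a - primitive a b g a.
  by rewrite primitive_start subr0 => <-; rewrite subrK.
apply: (@abscont_derive0 a x (fun x => f x - primitive a b g x)) => //.
  exact: abscont_subset AC1.
apply: (@filterS2 _ _ (ae_filter_ringOfSetsType mu)) df (primitive_derive ig) => z h1 h2 az zx.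
have zb := lt_le_trans zx xb.
have := is_deriveB (h1 az zb) (h2 az zb); rewrite subrr; exact.
Qed.

End AbsolutelyContinuous.

(** * Linear systems with integrable coefficients *)

Section LinearSystem.
Context {R : realType}.
Local Notation mu := (@lebesgue_measure R).
Implicit Types (a b c x : R) (f g h : R -> R).

Definition L1 a b g : Prop := mu.-integrable `[a, b] (EFin \o g).

Lemma L1_add a b f g : L1 a b f -> L1 a b g -> L1 a b (fun x => f x + g x).
Proof. by move=> If Ig; exact: (@integrableD _ _ R mu _ (measurable_itv _) _ _ If Ig). Qed.

Lemma L1_opp a b f : L1 a b f -> L1 a b (fun x => - f x).
Proof. by move=> If; exact: (@integrableN _ _ R mu _ _ If). Qed.

Lemma L1_scale a b c f : L1 a b f -> L1 a b (fun x => c * f x).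
Proof. by move=> If; exact: (@integrableZl _ _ R mu _ (measurable_itv _) c _ If). Qed.

Lemma L1_sub a b f g : L1 a b f -> L1 a b g -> L1 a b (fun x => f x - g x).
Proof. by move=> If /L1_opp; exact: L1_add. Qed.

Lemma L1_norm a b f : L1 a b f -> L1 a b (fun x => `|f x|).
Proof. by move=> If; exact: (@integrable_norm _ _ R mu _ _ If). Qed.

Lemma L1_sum a b (I : Type) (s : seq I) (F : I -> R -> R) :
  (forall i, L1 a b (F i)) -> L1 a b (fun x => \sum_(i <- s) F i x).
Proof.
move=> IF; elim: s => [|i s IHs].
  under eq_fun do rewrite big_nil; exact: integrable0.
by under eq_fun do rewrite big_cons; exact: L1_add.
Qed.

Lemma L1_mul a b g u : L1 a b g -> {within `[a, b], continuous u} ->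
  L1 a b (fun x => g x * u x).
Proof.
move=> Ig cu; apply: (@integrableMl _ _ R mu _ (measurable_itv _) (EFin \o g) u Ig).
  exact: continuous_itv_measurable.
have [M _ HM] := continuous_itv_bounded cu.
exists M; split; first exact: num_real.
move=> N MN x /=; rewrite in_itv /= => /andP[ax xb].
by rewrite (le_trans (HM x ax xb)) // ltW.
Qed.

Lemma L1_subset a b f c d : a <= c -> d <= b -> L1 a b f -> L1 c d f.
Proof.
move=> ac db; apply: integrableS => // x; rewrite /= !in_itv /= => /andP[cx xd].
by rewrite (le_trans ac cx) (le_trans xd db).
Qed.

Lemma primitive_norm_le a b g h x : L1 a b g -> L1 a b h -> x <= b ->
  (forall t, a <= t -> t <= b -> `|g t| <= h t) ->
  `|primitive a b g x| <= primitive a b h x.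
Proof.
move=> Ig Ih xb gh; rewrite !primitiveE //.
have Ig' : L1 a x g by exact: L1_subset Ig.
have Ih' : L1 a x h by exact: L1_subset Ih.
apply: le_trans (@le_normr_Rintegral _ _ R mu _ g (measurable_itv _) Ig') _.
apply: le_Rintegral => //; first exact: L1_norm.
by move=> t /=; rewrite in_itv /= => /andP[at_ tx]; apply: gh => //; exact: le_trans xb.
Qed.

Lemma primitive_sub a b g h x : L1 a b g -> L1 a b h -> x <= b ->
  primitive a b (fun t => g t - h t) x = primitive a b g x - primitive a b h x.
Proof.
move=> Ig Ih xb; rewrite !primitiveE // -RintegralB //.
- exact: L1_subset Ig.
- exact: L1_subset Ih.
Qed.

Lemma primitive_scale a b g c x : L1 a b g -> x <= b ->
  primitive a b (fun t => c * g t) x = c * primitive a b g x.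
Proof.
move=> Ig xb; rewrite !primitiveE // -RintegralZl //.
exact: L1_subset Ig.
Qed.

(** The sequences [v n + 2 C / 2^n] and [v n - 2 C / 2^n] are monotone and enclose
    the limit. *)
Lemma geometric_cauchy (v : nat -> R) (C : R) :
  (forall n, `|v n.+1 - v n| <= C * 2^-1 ^+ n) ->
  forall n, `|limn v - v n| <= 2 * C * 2^-1 ^+ n.
Proof.
move=> Hv; pose g n := 2 * C * 2^-1 ^+ n.
have gS n : g n = g n.+1 + C * 2^-1 ^+ n.
  by rewrite /g exprS; field.
have up : nonincreasing_seq (v + g).
  apply/nonincreasing_seqP => n.
  have -> : (v + g) n = v n + g n by []. have -> : (v + g) n.+1 = v n.+1 + g n.+1 by [].
  by rewrite (gS n); have := Hv n; rewrite ler_norml => /andP[]; lra.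
have lo : nondecreasing_seq (v - g).
  apply/nondecreasing_seqP => n.
  have -> : (v - g) n = v n - g n by []. have -> : (v - g) n.+1 = v n.+1 - g n.+1 by [].
  by rewrite (gS n); have := Hv n; rewrite ler_norml => /andP[]; lra.
have C0 : 0 <= C by have := Hv 0%N; rewrite expr0 mulr1; exact: le_trans.
have g0 n : 0 <= g n by rewrite /g !mulr_ge0 // exprn_ge0.
have lu n : (v - g) 0%N <= (v + g) n.
  apply: (@le_trans _ _ ((v - g) n)); first exact: lo.
  have -> : (v - g) n = v n - g n by []. have -> : (v + g) n = v n + g n by [].
  by have := g0 n; lra.
have ul n : (v - g) n <= (v + g) 0%N.
  apply: (@le_trans _ _ ((v + g) n)); last exact: up.
  have -> : (v - g) n = v n - g n by []. have -> : (v + g) n = v n + g n by [].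
  by have := g0 n; lra.
have cg : g @ \oo --> (0 : R).
  by apply: (@cvg_geometric R (2 * C) 2^-1); rewrite gtr0_norm ?invf_lt1 ?ltr1n.
have cup : cvgn (v + g).
  apply: nonincreasing_is_cvgn => //; exists ((v - g) 0%N) => _ [n _ <-]; exact: lu.
have clo : cvgn (v - g).
  apply: nondecreasing_is_cvgn => //; exists ((v + g) 0%N) => _ [n _ <-]; exact: ul.
have cv : cvgn v.
  have -> : v = (v + g) - g by rewrite addrK.
  by apply: is_cvgB => //; apply/cvg_ex; exists 0.
have Eup : limn (v + g) = limn v.
  by rewrite limD // ?(cvg_lim _ cg) ?addr0 //; apply/cvg_ex; exists 0.
have Elo : limn (v - g) = limn v.
  by rewrite limB // ?(cvg_lim _ cg) ?subr0 //; apply/cvg_ex; exists 0.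
move=> n; rewrite ler_norml; apply/andP; split.
  have := nondecreasing_cvgn_le lo clo n; rewrite Elo.
  have -> : (v - g) n = v n - g n by [].
  by rewrite /g; lra.
have := nonincreasing_cvgn_ge up cup n; rewrite Eup.
have -> : (v + g) n = v n + g n by [].
by rewrite /g; lra.
Qed.

Lemma le_geometric0 (x y C : R) : (forall n, x <= y + C * 2^-1 ^+ n) -> x <= y.
Proof.
move=> H.
have cg : (fun n => y + C * 2^-1 ^+ n) @ \oo --> y + 0.
  apply: cvgD; first exact: cvg_cst.
  by apply: (@cvg_geometric R C 2^-1); rewrite gtr0_norm ?invf_lt1 ?ltr1n.
rewrite addr0 in cg; rewrite -(cvg_lim _ cg) //.
apply: limr_ge; first by apply/cvg_ex; exists y.
by near=> n; exact: H.
Unshelve. all: by end_near. Qed.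

Section Existence.
Variables (n : nat) (a b : R) (A : 'I_n -> 'I_n -> R -> R) (f : 'I_n -> R -> R).
Variable c : 'I_n -> R.
Hypothesis ab : a <= b.
Hypothesis IA : forall i j, L1 a b (A i j).
Hypothesis If : forall i, L1 a b (f i).

Let rhs (u : 'I_n -> R -> R) i t := \sum_j A i j t * u j t + f i t.

Let Irhs u : (forall i, {within `[a, b], continuous (u i)}) -> forall i, L1 a b (rhs u i).
Proof.
move=> cu i; apply: L1_add => //; apply: L1_sum => j; exact: L1_mul.
Qed.

Let picard (u : 'I_n -> R -> R) i x := c i + primitive a b (rhs u i) x.

Let ACpicard u : (forall i, {within `[a, b], continuous (u i)}) ->
  forall i, abscont a b (picard u i).
Proof.
move=> cu i; apply: abscont_add; first exact: abscont_cst.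
by apply: abscont_primitive; exact: Irhs.
Qed.

Let k t := \sum_i \sum_j `|A i j t|.

Let Ik : L1 a b k.
Proof. by apply: L1_sum => i; apply: L1_sum => j; exact: L1_norm. Qed.

Let kge i t : \sum_j `|A i j t| <= k t.
Proof.
by rewrite /k [leRHS](bigD1 i) //= lerDl sumr_ge0 // => j _; rewrite sumr_ge0.
Qed.

Let k0 t : 0 <= k t.
Proof. by rewrite sumr_ge0 // => j _; rewrite sumr_ge0. Qed.

Let E x := expR (2 * primitive a b k x).

Let ACE : abscont a b E.
Proof.
apply: abscont_expR.
apply: (eq_abscont _ (abscont_lin 2 (abscont_primitive Ik) (abscont_cst a b 0))).
by move=> x _ _; rewrite addr0.
Qed.

Let E1 x : x <= b -> 1 <= E x.
Proof.
move=> xb; rewrite /E -[leLHS]expR0 ler_expR mulr_ge0 //.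
by apply: Rintegral_ge0 => t _; rewrite patchE; case: ifP.
Qed.

Let primitive_kE x : a <= x -> x <= b -> primitive a b (fun t => k t * E t) x <= 2^-1 * E x.
Proof.
move=> ax xb.
have H := @abscont_FTC R a b E (fun t => 2 * (k t * E t)) ab ACE _ _ x ax xb.
have IkE : L1 a b (fun t => k t * E t).
  by apply: L1_mul => //; exact: abscont_continuous.
rewrite primitive_scale // in H.
have {}H : E x = E a + 2 * primitive a b (fun t => k t * E t) x.
  apply: H; first exact: L1_scale.
  have := primitive_derive Ik; apply: (@filterS _ _ (ae_filter_ringOfSetsType mu)).
  move=> t Ht at_ tb.
  have d1 := is_deriveZ (2 : R) (Ht at_ tb).
  have d2 := is_derive_expR (2 * primitive a b k t).
  have -> : 2 * (k t * E t) = expR (2 * primitive a b k t) * (2 *: k t).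
    by rewrite /E -[2 *: k t]/(2 * k t); ring.
  exact: (@is_derive1_comp R expR (2 \*: primitive a b k) t _ _ d2 d1).
rewrite H mulrDr mulrA mulVf // mul1r lerDr mulr_ge0 //.
exact: expR_ge0.
Qed.

Let step (u v : 'I_n -> R -> R) C :
  (forall i, {within `[a, b], continuous (u i)}) ->
  (forall i, {within `[a, b], continuous (v i)}) ->
  (forall i t, a <= t -> t <= b -> `|u i t - v i t| <= C * E t) ->
  (forall i t, a <= t -> t <= b -> `|picard u i t - picard v i t| <= C * 2^-1 * E t).
Proof.
move=> cu cv uv i x ax xb.
have C0 : 0 <= C.
  have := le_trans (normr_ge0 _) (uv i a (lexx _) ab).
  by rewrite pmulr_lge0 // (lt_le_trans ltr01) // E1.
have rhsB t : a <= t -> t <= b -> `|rhs u i t - rhs v i t| <= C * (k t * E t).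
  move=> at_ tb; rewrite /rhs opprD addrACA subrr addr0 -sumrB.
  rewrite (le_trans (ler_norm_sum _ _ _)) //.
  apply: (@le_trans _ _ (\sum_j `|A i j t| * (C * E t))).
    by apply: ler_sum => j _; rewrite -mulrBr normrM ler_wpM2l // uv.
  by rewrite -mulr_suml mulrCA ler_wpM2l // ler_wpM2r // expR_ge0.
have IkE : L1 a b (fun t => k t * E t).
  by apply: L1_mul => //; exact: abscont_continuous.
rewrite /picard opprD addrACA subrr add0r -primitive_sub //; [|exact: Irhs..].
apply: le_trans (primitive_norm_le _ _ xb rhsB) _.
- by apply: L1_sub; exact: Irhs.
- exact: L1_scale.
- by rewrite primitive_scale // -mulrA ler_wpM2l // primitive_kE.
Qed.

Let U m := iter m picard (fun _ _ => 0).

Let cU m i : {within `[a, b], continuous (U m i)}.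
Proof.
elim: m i => [|m IHm] i; last by apply: abscont_continuous; exact: ACpicard.
exact: abscont_continuous (abscont_cst a b 0).
Qed.

(** Picard iteration.  Let [k] be the sum of the absolute values of the
    coefficients and [E] the exponential of twice its primitive.  As
    [k E = (E / 2)'], one Picard step halves errors measured in units of [E],
    so the iterates converge geometrically and uniformly. *)
Lemma linear_system_solution : exists u : 'I_n -> R -> R,
  [/\ forall i, abscont a b (u i), forall i, u i a = c i &
      forall i, \forall x \ae mu, a < x -> x < b ->
        is_derive x (1 : R) (u i) (\sum_j A i j x * u j x + f i x)].
Proof.
have [C HC] : exists C, forall i x, a <= x -> x <= b -> `|U 1%N i x - U 0%N i x| <= C * E x.
  have /choice[M HM] i : exists M, forall x, a <= x -> x <= b -> `|U 1%N i x| <= M.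
    by have [M _ HM] := continuous_itv_bounded (@cU 1%N i); exists M.
  exists (\sum_i `|M i|) => i x ax xb; rewrite subr0.
  apply: le_trans (HM i x ax xb) _; apply: le_trans (ler_norm _) _.
  apply: (@le_trans _ _ (\sum_i `|M i|)).
    by rewrite (bigD1 i) //= lerDl sumr_ge0.
  by rewrite ler_peMr ?E1 // sumr_ge0.
have HU m i x : a <= x -> x <= b -> `|U m.+1 i x - U m i x| <= C * 2^-1 ^+ m * E x.
  elim: m i x => [|m IHm] i x ax xb; first by rewrite mulr1; exact: HC.
  by rewrite exprSr mulrA; exact: (@step (U m.+1) (U m) _ (@cU m.+1) (@cU m) IHm i x ax xb).
have [M M0 HM] := abscont_bounded ACE.
pose u i x := limn (fun m => U m i x).
have ulim m i x : a <= x -> x <= b -> `|u i x - U m i x| <= 2 * (`|C| * M) * 2^-1 ^+ m.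
  move=> ax xb; apply: (@geometric_cauchy (fun m => U m i x)) => l.
  apply: le_trans (HU l i x ax xb) _; rewrite mulrAC ler_wpM2r ?exprn_ge0 //.
  apply: (@le_trans _ _ (`|C| * E x)).
    by rewrite ler_wpM2r ?ler_norm // expR_ge0.
  by rewrite ler_wpM2l // (le_trans (ler_norm _)) // HM.
(* [M] bounds [E], so [D / 2^m] bounds the uniform distance from [U m] to its limit. *)
pose D := 2 * (`|C| * M).
have D0 m : 0 <= D * 2^-1 ^+ m by rewrite /D !mulr_ge0 // exprn_ge0.
have cu i : {within `[a, b], continuous (u i)}.
  apply/subspace_continuousP => x xab; have := xab; rewrite /= in_itv /= => /andP[ax xb].
  apply/cvgrPdist_le => e e0.
  have [m Hm] : exists m, D * 2^-1 ^+ m <= e / 3.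
    have : (fun m => D * 2^-1 ^+ m) @ \oo --> (0 : R).
      by apply: (@cvg_geometric R D 2^-1); rewrite gtr0_norm ?invf_lt1 ?ltr1n.
    move=> /cvgrPdist_le /(_ (e / 3)) [|m _ Hm]; first by rewrite divr_gt0.
    by exists m; have := Hm m (leqnn m); rewrite sub0r normrN; exact: le_trans (ler_norm _).
  have /subspace_continuousP /(_ x xab) /cvgrPdist_le /(_ (e / 3)) := @cU m i.
  rewrite /= !near_withinE => /(_ _)H.
  have {}H := H (divr_gt0 e0 (ltr0Sn _ 2)).
  near=> z => /[dup] zab; rewrite /= in_itv /= => /andP[az zb].
  have h1 := ulim m i x ax xb; have h2 := ulim m i z az zb.
  have h3 : `|U m i x - U m i z| <= e / 3 by move: zab; near: z.
  have -> : u i x - u i z = (u i x - U m i x) + (U m i x - U m i z) - (u i z - U m i z) by ring.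
  rewrite (le_trans (ler_normB _ _)) //.
  have h4 := ler_normD (u i x - U m i x) (U m i x - U m i z).
  move: h1 h2; rewrite -/D => h1 h2; lra.
have uE i x : a <= x -> x <= b -> u i x = picard u i x.
  move=> ax xb; apply/eqP; rewrite -subr_eq0 -normr_le0.
  apply: (@le_geometric0 _ _ (D * 2^-1 + D * 2^-1 * M)) => m; rewrite add0r.
  have -> : u i x - picard u i x = (u i x - U m.+1 i x) - (picard u i x - U m.+1 i x) by ring.
  rewrite (le_trans (ler_normB _ _)) // mulrDl lerD //.
    have -> : D / 2 * 2^-1 ^+ m = D * 2^-1 ^+ m.+1 by rewrite exprS mulrA.
    exact: ulim.
  have uUm j t : a <= t -> t <= b -> `|u j t - U m j t| <= D * 2^-1 ^+ m * E t.
    move=> at_ tb; apply: le_trans (ulim m j t at_ tb) _.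
    by rewrite -/D ler_peMr ?E1.
  apply: le_trans (@step u (U m) _ cu (@cU m) uUm i x ax xb) _.
  have -> : D * 2^-1 * M * 2^-1 ^+ m = D * 2^-1 ^+ m * 2^-1 * M by ring.
  apply: ler_wpM2l; first by rewrite mulr_ge0.
  by apply: le_trans (ler_norm _) _; exact: HM.
(* [picard u] equals [u] on the interval, but is a primitive by construction. *)
exists (picard u); split.
- exact: ACpicard.
- by move=> i; rewrite /picard primitive_start addr0.
- move=> i; have := primitive_derive (Irhs cu i).
  apply: (@filterS _ _ (ae_filter_ringOfSetsType mu)).
  move=> x Hx ax xb.
  have -> : \sum_j A i j x * picard u j x + f i x = 0 + rhs u i x.
    by rewrite add0r /rhs; congr (_ + _); apply: eq_bigr => j _; rewrite uE // ltW.
  have := is_deriveD (is_derive_cst (c i) x (1 : R)) (Hx ax xb); exact.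
Unshelve. all: by end_near. Qed.

End Existence.
End LinearSystem.

(** * Borel versions of Lebesgue measurable coefficients *)

Section Completion.
Context {R : realType}.
Local Notation mu := (@lebesgue_measure R).
Local Notation cmu := (@completed_lebesgue_measure R).
Local Notation cR := (caratheodory_type (@wlength R idfun)^*%mu).
Implicit Types (a b : R) (f g h : R -> R).

Lemma completed_measurable_decomp (S : set R) : @measurable _ cR S ->
  exists A N, [/\ @measurable _ (measurableTypeR R) A, mu.-negligible N & A `|` N = S].
Proof.
move=> mS.
have : completed_algebra_gen mu S.
  by rewrite -g_sigma_completed_algebra_genE completed_caratheodory_measurable.
by move=> [A mA [N nN AN]]; exists A, N.
Qed.

(** Each of the countably many sets where [g] exceeds a rational is a Borel set up
    to a null set, and [B] is a Borel null set covering all the corrections. *)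
Lemma completed_measurable_borel (D : set R) g : @measurable _ (measurableTypeR R) D ->
  measurable_fun (T := cR) D g ->
  exists B : set R, [/\ @measurable _ (measurableTypeR R) B, mu B = 0 &
    measurable_fun (T := measurableTypeR R) (D `\` B) g].
Proof.
move=> mD mg.
have mDc : @measurable _ cR D by exact: sub_caratheodory.
have /choice[A /choice[N AN]] (q : rat) : exists A N, [/\ @measurable _ (measurableTypeR R) A,
    mu.-negligible N & A `|` N = D `&` g @^-1` `]ratr q, +oo[].
  by apply: completed_measurable_decomp; apply: mg => //; exact: measurable_itv.
have nN (q : rat) : mu.-negligible (N q) by have [] := AN q.
have [B [mB B0 NB]] : mu.-negligible (\bigcup_(q : rat) N q).
  have -> : \bigcup_(q : rat) N q = \bigcup_k (if @unpickle rat k is Some q then N q else set0).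
    apply/seteqP; split => x [].
      by move=> q _ Nx; exists (@pickle rat q); [exact: I|rewrite pickleK].
    by move=> k _; case: unpickle => // q Nx; exists q.
  apply: negligible_bigcup => k; case: unpickle => //; exact: negligible_set0.
exists B; split => //.
move=> mDB; apply: (measurability _ (RGenOInfty.measurableE R)) => //.
move=> /= _ [_ [y ->] <-].
have -> : (D `\` B) `&` g @^-1` `]y, +oo[ =
    \bigcup_(q : rat) (if y <= ratr q then A q `\` B else set0).
  apply/seteqP; split => x.
    move=> [[Dx Bx]]; rewrite /= in_itv /= andbT => /rat_in_itvoo[q].
    rewrite in_itv /= => /andP[yq qg]; exists q => //; rewrite ltW //; split => //.
    have [_ _ E] := AN q; have : (A q `|` N q) x by rewrite E; split => //=; rewrite in_itv /= qg.
    by case=> // Nx; exfalso; apply: Bx; apply: NB; exists q.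
  move=> [q _]; case: ifPn => // yq [Ax Bx].
  have [_ _ E] := AN q; have : (D `&` g @^-1` `]ratr q, +oo[) x by rewrite -E; left.
  move=> [Dx] /=; rewrite !in_itv /= !andbT => qg.
  by split => //; exact: le_lt_trans qg.
apply: bigcupT_measurable_rat => q; case: ifP => // _; apply: measurableD => //.
by have [] := AN q.
Qed.

(** Integrability passes from the completed measure to the Borel one because the
    latter is the image of the former under the identity. *)
Lemma lebesgue_L1_borel a b g : lebesgue_L1 a b g ->
  exists2 h, L1 a b h & \forall x \ae mu, x \in `[a, b] -> g x = h x.
Proof.
move=> Ig; have /integrableP[/measurable_EFinP mg fing] := Ig.
have mI : @measurable _ (measurableTypeR R) `[a, b]%classic by exact: measurable_itv.
have [B [mB B0 mgB]] := completed_measurable_borel mI mg.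
pose h := g \_ (`[a, b] `\` B).
have mDB : @measurable _ (measurableTypeR R) (`[a, b] `\` B) by exact: measurableD.
have mh : @measurable_fun _ _ (measurableTypeR R) _ setT h.
  exact: (measurable_restrictT g mDB).1.
exists h; last first.
  exists B; split => // x /= /not_implyP[xab gh]; apply: contrapT => Bx; apply: gh.
  by rewrite /h patchE mem_set.
have mid : measurable_fun (T := cR) (U := measurableTypeR R) setT (@id R).
  by move=> _ A mA; rewrite setTI preimage_id; exact: sub_caratheodory.
apply/integrableP; split.
  by apply/measurable_EFinP; exact: measurable_funTS.
have -> : (\int[mu]_(x in `[a, b]) `|(EFin \o h) x| =
    \int[pushforward cmu (id : cR -> measurableTypeR R)]_(x in `[a, b]) `|(EFin \o h) x|)%E.
  by apply: eq_measure_integral => A mA _.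
rewrite ge0_integral_pushforward //; last first.
  by apply/measurable_funTS; apply: measurableT_comp => //; apply/measurable_EFinP.
have mhc : @measurable_fun _ _ cR R `[a, b]%classic h.
  exact: (measurable_funS measurableT (@subsetT _ _) (measurableT_comp mh mid)).
have mhn : @measurable_fun _ _ cR _ `[a, b]%classic (EFin \o (Num.norm \o h)).
  by apply/measurable_EFinP; apply: measurableT_comp.
have mgn : @measurable_fun _ _ cR _ `[a, b]%classic (EFin \o (Num.norm \o g)).
  by apply/measurable_EFinP; apply: measurableT_comp.
have mIc : @measurable _ cR `[a, b]%classic by exact: sub_caratheodory.
apply: le_lt_trans fing.
apply: (@ge0_le_integral _ cR R cmu _ mIc (EFin \o (Num.norm \o h))
  (EFin \o (Num.norm \o g))) => //.
  by move=> x _ /=; rewrite lee_fin.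
by move=> x _ /=; rewrite /h patchE; case: ifP => //; rewrite normr0 lee_fin.
Qed.

End Completion.

(** * Boundary triplets from a Green formula *)

Lemma sqr_normB_le {C : numClosedFieldType} (p q : C) :
  `|p - q| ^+ 2 <= 2 * (`|p| ^+ 2 + `|q| ^+ 2).
Proof.
rewrite -subr_ge0 !normCK !rmorphB /=.
have -> : 2 * (p * p^* + q * q^*) - (p - q) * (p^* - q^*) = (p + q) * (p^* + q^*) by ring.
by rewrite -rmorphD -normCK exprn_ge0.
Qed.

Section InnerProduct.
Context {C : numClosedFieldType} {V : lmodType C} (dot : {dot V for @Num.conj_op C}).
Implicit Types (u v w x : V) (k : C) (D : set V) (T : set (V * V)).

Lemma dotZl k u v : dot (k *: u) v = k * dot u v.
Proof. exact: linearZl_LR. Qed.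

Lemma dotZr k u v : dot u (k *: v) = k^* * dot u v.
Proof. exact: linearZr_LR. Qed.

Lemma dotDl u v w : dot (u + v) w = dot u w + dot v w.
Proof. exact: linearDl. Qed.

Lemma dotDr u v w : dot u (v + w) = dot u v + dot u w.
Proof. exact: linearDr. Qed.

Lemma dotBl u v w : dot (u - v) w = dot u w - dot v w.
Proof. exact: linearBl. Qed.

Lemma dotBr u v w : dot u (v - w) = dot u v - dot u w.
Proof. exact: linearBr. Qed.

Lemma dot0l u : dot 0 u = 0.
Proof. exact: linear0l. Qed.

Lemma dot0r u : dot u 0 = 0.
Proof. exact: linear0r. Qed.

Lemma dotC u v : dot u v = (dot v u)^*.
Proof. by rewrite hermC expr0 mul1r. Qed.

Lemma dot_gt0 u : u != 0 -> 0 < dot u u.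
Proof. exact: neq0_dnorm_gt0. Qed.

Lemma dot_ge0 u : 0 <= dot u u.
Proof.
have [->|u0] := eqVneq u 0; first by rewrite dot0l.
by rewrite ltW // dot_gt0.
Qed.

Lemma dot_eq0 u : dot u u = 0 -> u = 0.
Proof.
move=> u0; apply: contrapT => /eqP /dot_gt0.
by rewrite u0 ltxx.
Qed.

(** If all points of the line through [x] directed by [v] have squared norm at least
    [d], compare with the point of this line closest to the origin.  The case
    [d = 0] is the Cauchy-Schwarz inequality; positive [d] is for minimizing
    sequences. *)
Lemma dot_cauchy_schwarz_gap x v (d : C) :
  (forall k, d <= dot (x + k *: v) (x + k *: v)) ->
  `|dot x v| ^+ 2 <= dot v v * (dot x x - d).
Proof.
move=> H; have [->|v0] := eqVneq v 0.
  by rewrite dot0r normr0 expr0n /= dot0r mul0r.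
have vv : 0 < dot v v by exact: dot_gt0.
have := H (- (dot x v / dot v v)).
rewrite dotDl !dotDr !dotZl !dotZr (dotC v x) rmorphN rmorphM /= fmorphV /=.
rewrite -(dotC v v).
have -> : dot x x + - ((dot x v)^* / dot v v) * dot x v +
   (- (dot x v / dot v v) * (dot x v)^* +
    - (dot x v / dot v v) * (- ((dot x v)^* / dot v v) * dot v v)) =
   dot x x - (dot x v * (dot x v)^*) / dot v v.
  by field; rewrite gt_eqF.
rewrite -normCK => h.
by rewrite mulrC -ler_pdivrMr // lerBrDr addrC -lerBrDr.
Qed.

Lemma dot_cauchy_schwarz x v : `|dot x v| ^+ 2 <= dot v v * dot x x.
Proof.
by rewrite -[dot x x]subr0; apply: dot_cauchy_schwarz_gap => k; exact: dot_ge0.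
Qed.

Lemma small_eq0 (z K : C) : (forall e, 0 < e -> `|z| ^+ 2 <= K * e) -> z = 0.
Proof.
move=> H; apply: contrapT => /eqP z0.
have p0 : 0 < `|z| ^+ 2 by rewrite exprn_gt0 // normr_gt0.
have K0 : 0 < K by have := lt_le_trans p0 (H 1 ltr01); rewrite mulr1.
have e0 : 0 < `|z| ^+ 2 / K / 2 by rewrite !divr_gt0.
have := H _ e0; rewrite mulrA [K * _]mulrC divfK ?gt_eqF //.
rewrite ler_pdivlMr // mulr_natr mulr2n => h.
by have := lt_le_trans (ltr_pwDl p0 (lexx _)) h; rewrite ltxx.
Qed.

Lemma adjoint_closed T : closed_operator dot (adjoint dot T).
Proof.
move=> u u' H x x' Txx' /=.
apply/eqP; rewrite -subr_eq0; apply/eqP.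
apply: (@small_eq0 _ (2 * (dot x' x' + dot x x))) => e e0.
have [v [v' [Avv' uv uv']]] := H e e0.
have E := Avv' _ _ Txx'; rewrite /= in E.
have -> : dot x' u - dot x u' = dot x' (u - v) - dot x (u' - v').
  by rewrite !dotBr /= E; ring.
set p := dot x' (u - v); set q := dot x (u' - v').
have hp : `|p| ^+ 2 <= dot x' x' * e.
  rewrite mulrC (le_trans (dot_cauchy_schwarz _ _)) // ler_wpM2r ?dot_ge0 //.
  exact: ltW.
have hq : `|q| ^+ 2 <= dot x x * e.
  rewrite mulrC (le_trans (dot_cauchy_schwarz _ _)) // ler_wpM2r ?dot_ge0 //.
  exact: ltW.
apply: le_trans (sqr_normB_le p q) _; rewrite -mulrA ler_wpM2l // mulrDl; exact: lerD.
Qed.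

Definition orthonormal_set (S E : set V) := [/\ E `<=` S,
  forall u, E u -> dot u u = 1 & forall u v, E u -> E v -> u <> v -> dot u v = 0].

(** A maximal orthonormal subset of [S], given by Zorn's lemma, is a basis: a
    nonzero vector of [S] orthogonal to it could be normalized and added. *)
Lemma orthonormal_basis_exists (S : set V) :
  (forall k u v, S u -> S v -> S (k *: u + v)) ->
  exists (I : Type) (e : I -> V), orthonormal_basis dot e S.
Proof.
move=> Slin.
have [E [[ES E1 E0] Emax]] : exists E, orthonormal_set S E /\
    forall B, E `<` B -> ~ orthonormal_set S B.
  apply: Zorn_bigcup => F FP tot; split.
  - by move=> x [X FX Xx]; have [h _ _] := FP X FX; exact: h.
  - by move=> x [X FX Xx]; have [_ h _] := FP X FX; exact: h.
  - move=> x y [X FX Xx] [Y FY Yy] xy.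
    case: (tot X Y FX FY) => XY.
      by have [_ _ h] := FP Y FY; apply: h => //; exact: XY.
    by have [_ _ h] := FP X FX; apply: h => //; exact: XY.
exists {x : V | E x}, (fun x : {x : V | E x} => sval x); split.
- by move=> [x Ex] /=; exact: ES.
- by move=> [x Ex] /=; exact: E1.
- move=> [x Ex] [y Ey] /= xy; apply: E0 => // xy'; apply: xy.
  by move: Ex Ey; rewrite xy' => Ex Ey; congr exist; exact: Prop_irrelevance.
move=> u Su uE; apply: contrapT => /eqP u0.
have uu : 0 < dot u u by exact: dot_gt0.
pose k := (sqrtC (dot u u))^-1.
have S0 : S 0 by have := Slin (-1) u u Su Su; rewrite scaleN1r addNr.
have kk : k * (k^* * dot u u) = 1.
  rewrite mulrA -normCK normfV exprVn ger0_norm ?sqrtC_ge0 ?ltW //.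
  by rewrite sqrtCK mulVf // gt_eqF.
pose w := k *: u.
have ww : dot w w = 1 by rewrite /w dotZl dotZr.
have wE x : E x -> dot w x = 0.
  by move=> Ex; rewrite /w dotZl (uE (exist _ x Ex)) mulr0.
have Ew : ~ E w by move=> /wE /eqP; rewrite ww oner_eq0.
apply: (Emax (E `|` [set w])).
  split; last by move=> h; apply: Ew; apply: h; right.
  by move=> x Ex; left.
split.
- move=> x [/ES //|->]; rewrite /w -[_ *: u]addr0; exact: Slin.
- by move=> x [/E1 //|->].
- move=> x y [Ex|->] [Ey|->] xy.
  + exact: E0.
  + by rewrite dotC wE // rmorph0.
  + exact: wE.
  + by [].
Qed.

End InnerProduct.

Lemma linear_on_dom0 {C : numClosedFieldType} {V K : lmodType C} (M : set (V * V))
    (G : V -> K) : M (0, 0) ->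
  (forall k f g, dom M f -> dom M g -> G (k *: f + g) = k *: G f + G g) -> G 0 = 0.
Proof.
move=> M0 Glin; have d0 : dom M 0 by exists 0.
by have := Glin (-1) 0 0 d0 d0; rewrite !scaleN1r oppr0 addr0 addNr.
Qed.

Section Triplet.
Context {C : numClosedFieldType} {V K : lmodType C}
  (dotV : {dot V for @Num.conj_op C}) (dotK : {dot K for @Num.conj_op C}).
Variables (M T : set (V * V)) (G1 G2 : V -> K) (J : V -> V).
Hypothesis M_lin : is_linear_operator M.
Hypothesis G1_lin : forall k f g, dom M f -> dom M g -> G1 (k *: f + g) = k *: G1 f + G1 g.
Hypothesis G2_lin : forall k f g, dom M f -> dom M g -> G2 (k *: f + g) = k *: G2 f + G2 g.
Hypothesis green : forall f f' g g', M (f, f') -> M (g, g') ->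
  dotV f' g - dotV f g' = dotK (G1 f) (G2 g) - dotK (G2 f) (G1 g).
Hypothesis onto : forall g1 g2, exists f, [/\ dom M f, G1 f = g1 & G2 f = g2].
Hypothesis TE : forall f f', T (f, f') <-> [/\ M (f, f'), G1 f = 0 & G2 f = 0].
Hypothesis adjT : adjoint dotV T `<=` M.
Hypothesis orth_dense : forall D : set V, (forall k u v, D u -> D v -> D (k *: u + v)) ->
  D 0 -> (forall h, (forall v, D v -> dotV v h = 0) -> h = 0) ->
  forall u (e : C), 0 < e -> exists2 v, D v & dotV (u - v) (u - v) < e.
Hypothesis J_dot : forall u v, dotV (J u) (J v) = (dotV u v)^*.
Hypothesis JK : involutive J.
Hypothesis J_scale : forall k u, J (k *: u) = k^* *: J u.
Hypothesis J_M : forall u u', M (u, u') -> M (J u, J u').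

Lemma adjoint_minimal : adjoint dotV T = M.
Proof.
apply/seteqP; split=> // -[g g'] Mg f f' /TE[Mf f1 f2] /=.
apply/eqP; rewrite -subr_eq0 (green Mf Mg) f1 f2.
by rewrite !dot0l subrr.
Qed.

Lemma minimal_linear : is_linear_operator T.
Proof.
have [M0 MD MF] := M_lin; split.
- by apply/TE; split => //; [exact: linear_on_dom0 G1_lin|exact: linear_on_dom0 G2_lin].
- move=> k u u' v v' /TE[Mu u1 u2] /TE[Mv v1 v2]; apply/TE; split.
  + exact: MD.
  + by rewrite G1_lin ?u1 ?v1 ?scaler0 ?addr0 //; [exists u'|exists v'].
  + by rewrite G2_lin ?u2 ?v2 ?scaler0 ?addr0 //; [exists u'|exists v'].
- by move=> u u' u'' /TE[h1 _ _] /TE[h2 _ _]; exact: MF h1 h2.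
Qed.

Lemma minimal_densely_defined : densely_defined dotV T.
Proof.
have [T0 TD TF] := minimal_linear; have [M0 _ MF] := M_lin.
move=> u e e0; apply: orth_dense => //.
- by move=> k f g [f' Tf] [g' Tg]; exists (k *: f' + g'); exact: TD.
- by exists 0.
- move=> h Hh; have : adjoint dotV T (0, h).
    by move=> f f' Tf /=; rewrite dot0r Hh //; exists f'.
  by move=> /adjT /MF /(_ M0).
Qed.

(** The Green formula kills the boundary form of [g] against all boundary data;
    since these are arbitrary, both boundary values of [g] vanish. *)
Lemma adjoint_maximal : adjoint dotV M = T.
Proof.
apply/seteqP; split=> -[g g'].
  move=> adjg; have Mg : M (g, g').
    by apply: adjT => f f' /TE[Mf _ _]; exact: adjg.
  have form0 f : dom M f -> dotK (G1 f) (G2 g) = dotK (G2 f) (G1 g).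
    move=> [f' Mf]; apply/eqP; rewrite -subr_eq0 -(green Mf Mg).
    by have /= -> := adjg _ _ Mf; rewrite subrr.
  apply/TE; split => //.
    have [f [df f1 f2]] := onto 0 (G1 g); apply: (dot_eq0 (dot := dotK)).
    by have := form0 f df; rewrite f1 f2 dot0l.
  have [f [df f1 f2]] := onto (G2 g) 0; apply: (dot_eq0 (dot := dotK)).
  by have := form0 f df; rewrite f1 f2 dot0l.
move=> /TE[Mg g1 g2] f f' Mf /=; apply/eqP.
by rewrite -subr_eq0 (green Mf Mg) g1 g2 !dot0r subrr.
Qed.

(** Everything that the notion of boundary triplet asks of [T] follows from the
    Green formula for [M], the surjectivity of the boundary maps and the
    inclusion of the adjoint of [T] in [M].  [J] is a conjugation that
    commutes with [M]: it maps the deficiency space at [z] onto the one at the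
    conjugate of [z], and an orthonormal basis to an orthonormal basis. *)
Lemma boundary_triplet_of_green : boundary_triplet dotV dotK T (dom M) G1 G2.
Proof.
have [M0 MD MF] := M_lin.
split.
- exact: minimal_linear.
- exact: minimal_densely_defined.
- by rewrite -adjoint_maximal; exact: adjoint_closed.
- move=> f f' g g' /TE[Mf f1 f2] /TE[Mg g1 g2]; apply/eqP.
  by rewrite -subr_eq0 (green Mf Mg) f1 f2 !dot0l subrr.
- have Slin z k u v : deficiency_space dotV T z u -> deficiency_space dotV T z v ->
     deficiency_space dotV T z (k *: u + v).
    rewrite /deficiency_space adjoint_minimal /= => Mu Mv.
    by rewrite scalerDr scalerA [z * k]mulrC -scalerA; exact: MD.
  have SJ z u : deficiency_space dotV T z u -> deficiency_space dotV T z^* (J u).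
    by rewrite /deficiency_space adjoint_minimal /= => /J_M; rewrite J_scale.
  have [I [e [eS e1 e0 emax]]] := orthonormal_basis_exists dotV (Slin 'i).
  exists I, e, (J \o e); split => //; split => /=.
  + by move=> i; rewrite -conjCi; exact: SJ.
  + by move=> i; rewrite J_dot e1 rmorph1.
  + by move=> i j ij; rewrite J_dot e0 // rmorph0.
  + move=> u Su ue; rewrite -[u]JK.
    have -> : J u = 0.
      apply: emax => [|i].
        by rewrite -[X in deficiency_space _ _ X]conjCK conjCi; exact: SJ.
      by have := ue i; rewrite -{1}[u]JK J_dot => /eqP; rewrite conjC_eq0 => /eqP.
    by have := J_scale 0 0; rewrite scaler0 rmorph0 scale0r.
- by rewrite adjoint_minimal.
- exact: G1_lin.
- exact: G2_lin.
- by rewrite adjoint_minimal; exact: green.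
- exact: onto.
Qed.

End Triplet.

(** * The Hilbert space of square-integrable functions *)

Section L2Classes.
Local Open Scope complex_scope.
Context {R : realType}.
Local Notation mu := (@lebesgue_measure R).
Local Notation Re := (@complex.Re R).
Local Notation Im := (@complex.Im R).
Local Notation ae_eq_on a b f g := (@ae_eq _ _ _ mu (fun=> R[i]) `[a, b]%classic f g).
Implicit Types (a b : R) (f g : R -> R[i]).

Let aeF : Filter (almost_everywhere mu) := ae_filter_ringOfSetsType mu.

Lemma ReB (z w : R[i]) : Re (z - w) = Re z - Re w.
Proof. by case: z w => ? ? []. Qed.

Lemma ImB (z w : R[i]) : Im (z - w) = Im z - Im w.
Proof. by case: z w => ? ? []. Qed.

Lemma sqr_Re_le (z : R[i]) : Re z ^+ 2 <= cnormsq z.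
Proof. by rewrite lerDl sqr_ge0. Qed.

Lemma sqr_Im_le (z : R[i]) : Im z ^+ 2 <= cnormsq z.
Proof. by rewrite lerDr sqr_ge0. Qed.

Lemma cnormsq_ge0 (z : R[i]) : 0 <= cnormsq z.
Proof. by rewrite addr_ge0 ?sqr_ge0. Qed.

Lemma L2class_eqP a b f g : sq_integrable a b f -> sq_integrable a b g ->
  L2class a b f = L2class a b g <-> ae_eq_on a b f g.
Proof.
move=> sf sg; rewrite L2_eqP; have Ef := L2repr_class sf; have Eg := L2repr_class sg.
split=> h.
  exact: ae_eq_trans (ae_eq_sym Ef) (ae_eq_trans h Eg).
exact: ae_eq_trans Ef (ae_eq_trans h (ae_eq_sym Eg)).
Qed.

Lemma L2class_repr a b (u : L2 a b) : L2class a b (L2repr u) = u.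
Proof. by apply/L2_eqP; apply: L2repr_class; exact: L2repr_sq. Qed.

Lemma L2class_lin a b k f g : sq_integrable a b f -> sq_integrable a b g ->
  L2class a b (k *: f + g) = k *: L2class a b f + L2class a b g.
Proof.
move=> sf sg; apply/L2_eqP.
apply: ae_eq_trans (L2repr_class (sq_integrable_lin k sf sg)) _.
apply: ae_eq_sym; apply: ae_eq_trans (L2reprP _ _ _) _.
apply: (@filterS2 _ _ aeF) (L2repr_class sf) (L2repr_class sg) => x h1 h2 xab.
by rewrite h1 // h2.
Qed.

Lemma L2class0 a b : L2class a b 0 = 0.
Proof.
have := L2class_lin (-1) (@sq_integrable0 R a b) (@sq_integrable0 R a b).
by rewrite scaler0 addr0 scaleN1r addNr.
Qed.

Lemma sq_integrableN a b f : sq_integrable a b f -> sq_integrable a b (- f).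
Proof.
move=> sf; have := sq_integrable_lin (-1) sf (@sq_integrable0 R a b).
by rewrite scaleN1r addr0.
Qed.

Lemma L2classN a b f : sq_integrable a b f -> L2class a b (- f) = - L2class a b f.
Proof.
move=> sf; have := L2class_lin (-1) sf (@sq_integrable0 R a b).
by rewrite L2class0 !addr0 !scaleN1r.
Qed.

Lemma L2dot_class a b f g : sq_integrable a b f -> sq_integrable a b g ->
  L2dot (L2class a b f) (L2class a b g) = cintegral a b (cprod f g).
Proof.
move=> sf sg; apply: ae_eq_cintegral.
- by apply: cintegrable_cprod; exact: L2repr_sq.
- exact: cintegrable_cprod.
- apply: (@filterS2 _ _ aeF) (L2repr_class sf) (L2repr_class sg) => x h1 h2 xab.
  by rewrite /cprod h1 // h2.
Qed.

Definition cconj f : R -> R[i] := fun x => (f x)^*.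

Lemma sq_integrable_conj a b f : sq_integrable a b f -> sq_integrable a b (cconj f).
Proof.
move=> [m1 m2 I]; split.
- by apply: eq_measurable_fun m1 => x _; rewrite /cconj /=; case: (f x).
- apply: eq_measurable_fun (measurable_funN m2) => x _; rewrite /cconj /=; by case: (f x).
- apply: eq_integrable I => // x _ /=; rewrite /cconj /cnormsq; case: (f x) => p q /=.
  by rewrite sqrrN.
Qed.

Definition L2conj a b (u : L2 a b) : L2 a b := L2class a b (cconj (L2repr u)).

Lemma L2conj_class a b f : sq_integrable a b f ->
  L2conj (L2class a b f) = L2class a b (cconj f).
Proof.
move=> sf; apply/L2class_eqP.
- by apply: sq_integrable_conj; exact: L2repr_sq.
- exact: sq_integrable_conj.
- apply: (@filterS _ _ aeF) (L2repr_class sf) => x h xab.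
  by rewrite /cconj h.
Qed.

Lemma L2conjK a b : involutive (@L2conj a b).
Proof.
move=> u; rewrite {2}/L2conj L2conj_class; last first.
  by apply: sq_integrable_conj; exact: L2repr_sq.
rewrite -[RHS](L2class_repr u); congr L2class; apply/funext => x.
by rewrite /cconj conjcK.
Qed.

Lemma L2conj_scale a b (k : R[i]) (u : L2 a b) :
  L2conj (k *: u) = k^* *: L2conj u.
Proof.
have su := L2repr_sq u; have s0 := @sq_integrable0 R a b.
rewrite -{1}(L2class_repr u).
have -> : k *: L2class a b (L2repr u) = L2class a b (k *: L2repr u + 0).
  by rewrite L2class_lin // L2class0 addr0.
rewrite L2conj_class; last exact: sq_integrable_lin.
have -> : cconj (k *: L2repr u + 0) = k^* *: cconj (L2repr u) + 0.
  by rewrite !addr0; apply/funext => x; rewrite /cconj [LHS](rmorphM (@conjc R)).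
rewrite L2class_lin ?L2class0 ?addr0 //; exact: sq_integrable_conj.
Qed.

Lemma L2conj_dot a b (u v : L2 a b) : L2dot (L2conj u) (L2conj v) = (L2dot u v)^*.
Proof.
rewrite L2dot_class; [|by apply: sq_integrable_conj; exact: L2repr_sq..].
rewrite /L2dot -cintegralC; last by apply: cintegrable_cprod; exact: L2repr_sq.
congr cintegral; apply/funext => x; rewrite /cprod /cconj.
by rewrite [RHS](rmorphM (@conjc R)).
Qed.

Definition normsq a b (u : L2 a b) : R := \int[mu]_(x in `[a, b]) cnormsq (L2repr u x).

Lemma L2dot_normsq a b (u : L2 a b) : L2dot u u = (normsq u)%:C.
Proof.
rewrite /L2dot /cintegral; congr (_ +i* _).
  by apply: eq_Rintegral => x _; rewrite cprodE /= -!expr2.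
rewrite /Rintegral integral0_eq // => x _.
by rewrite cprodE /= mulrC subrr.
Qed.

Lemma normsq_class a b f : sq_integrable a b f ->
  normsq (L2class a b f) = \int[mu]_(x in `[a, b]) cnormsq (f x).
Proof.
move=> sf; have := L2dot_class sf sf; rewrite L2dot_normsq => /(congr1 Re) /= ->.
by apply: eq_Rintegral => x _; rewrite cprodE /= -!expr2.
Qed.

Definition crestrict (D : set R) f : R -> R[i] := fun x => if x \in D then f x else 0.

Lemma sq_integrable_restrict a b (D : set R) f : measurable D ->
  sq_integrable a b f -> sq_integrable a b (crestrict D f).
Proof.
move=> mD [m1 m2 I].
have mab : measurable (`[a, b]%classic : set R) by exact: measurable_itv.
have mr (h : R -> R) : measurable_fun `[a, b] h -> measurable_fun `[a, b] (h \_ D).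
  move=> mh; apply/(measurable_restrict _ mD mab).
  by apply: measurable_funS mh => //; exact: subIsetr.
have E1 : Re \o crestrict D f = (Re \o f) \_ D.
  by apply/funext => x /=; rewrite /crestrict !patchE; case: ifP.
have E2 : Im \o crestrict D f = (Im \o f) \_ D.
  by apply/funext => x /=; rewrite /crestrict !patchE; case: ifP.
have m1' : measurable_fun `[a, b] (Re \o crestrict D f) by rewrite E1; exact: mr.
have m2' : measurable_fun `[a, b] (Im \o crestrict D f) by rewrite E2; exact: mr.
split => //.
apply: le_integrable I => //.
  apply/measurable_EFinP; rewrite /cnormsq; apply: measurable_funD; exact: measurable_funX.
move=> x _ /=; rewrite lee_fin !ger0_norm ?cnormsq_ge0 // /crestrict.
by case: ifP => // _; rewrite /cnormsq /= expr0n /= addr0 addr_ge0 ?sqr_ge0.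
Qed.

Lemma L2classB a b f g : sq_integrable a b f -> sq_integrable a b g ->
  L2class a b f - L2class a b g = L2class a b (fun x => f x - g x).
Proof.
move=> sf sg; have sNg := sq_integrableN sg.
rewrite -(L2classN sg) -[L2class a b f]scale1r -(L2class_lin 1 sf sNg).
by rewrite scale1r.
Qed.

Lemma sq_integrableB a b f g : sq_integrable a b f -> sq_integrable a b g ->
  sq_integrable a b (fun x => f x - g x).
Proof.
move=> sf sg; have := sq_integrable_lin 1 sf (sq_integrableN sg).
by rewrite scale1r.
Qed.

Section Completeness.
Variables (a b : R) (w : nat -> L2 a b).
Hypothesis wfast : forall n, normsq (w n.+1 - w n) <= 16^-1 ^+ n.

Let f n := L2repr (w n).
Let D : set R := `[a, b]%classic.
Let mD : @measurable _ (measurableTypeR R) D. Proof. exact: measurable_itv. Qed.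
Let sf n : sq_integrable a b (f n). Proof. exact: L2repr_sq. Qed.
Let gap n : R -> R := fun x => cnormsq (f n.+1 x - f n x).

Let sgap n : sq_integrable a b (fun x => f n.+1 x - f n x).
Proof. exact: sq_integrableB. Qed.

Let igap n : mu.-integrable D (EFin \o gap n).
Proof. by have [_ _] := sgap n. Qed.

Let intgap n : (\int[mu]_(x in D) (gap n x)%:E <= (16^-1 ^+ n)%:E)%E.
Proof.
have := wfast n; rewrite -lee_fin; apply: le_trans.
have -> : w n.+1 - w n = L2class a b (fun x => f n.+1 x - f n x).
  by rewrite -(L2classB (sf n.+1) (sf n)) !L2class_repr.
rewrite normsq_class // /Rintegral fineK //.
exact: (@integrable_fin_num _ _ R mu D mD _ (igap n)).
Qed.

Let S x : \bar R := (\sum_(n <oo) (4 ^+ n * gap n x)%:E)%E.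

Let wgap_ge0 n x : (0 <= (4 ^+ n * gap n x)%:E)%E.
Proof. by rewrite lee_fin mulr_ge0 ?exprn_ge0 ?cnormsq_ge0. Qed.

Let mwgap n : measurable_fun D (fun x => (4 ^+ n * gap n x)%:E).
Proof.
apply/measurable_EFinP; apply: measurable_funM => //.
by apply/measurable_EFinP; exact: measurable_int (igap n).
Qed.

Let S_ge0 x : (0 <= S x)%E.
Proof. by apply: nneseries_ge0 => n _ _. Qed.

Let mS : measurable_fun D S.
Proof. by apply: ge0_emeasurable_sum => // n x _ _. Qed.

Let intS : (\int[mu]_(x in D) S x < +oo)%E.
Proof.
rewrite integral_nneseries //.
apply: (@le_lt_trans _ _ (\sum_(n <oo) (geometric (1 : R) 4^-1 n)%:E)%E).
  apply: lee_nneseries => n _; first by move=> _; apply: integral_ge0.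
  under eq_integral do rewrite EFinM.
  rewrite ge0_integralZl_EFin ?exprn_ge0 //; last 2 first.
    by move=> x _; rewrite lee_fin cnormsq_ge0.
    exact: measurable_int (igap n).
  apply: le_trans (lee_wpmul2l _ (intgap n)) _; first by rewrite lee_fin exprn_ge0.
  rewrite -EFinM lee_fin /geometric /= mul1r -exprMn.
  by rewrite (_ : 4 * 16^-1 = 4^-1 :> R) //; field.
rewrite (_ : (\sum_(n <oo) _)%E = (1 * (1 - 4^-1)^-1 : R)%:E) ?ltry //.
apply/cvg_lim => //.
under eq_fun do rewrite sumEFin.
apply: cvg_EFin; first exact: nearW.
by apply: (@cvg_geometric_series R 1 4^-1); rewrite gtr0_norm // invf_lt1 // ltr1n.
Qed.

Let iS : mu.-integrable D S.
Proof.
apply/integrableP; split => //.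
by under eq_integral do rewrite gee0_abs //.
Qed.

Let D' := D `&` [set x | S x \is a fin_num].

Let mD' : @measurable _ (measurableTypeR R) D'.
Proof. exact: emeasurable_fin_num. Qed.

Let h n := crestrict D' (f n).

Let sh n : sq_integrable a b (h n). Proof. exact: sq_integrable_restrict. Qed.

Let hf n : ae_eq_on a b (h n) (f n).
Proof.
have Sae := integrable_ae mD iS.
apply: (@filterS _ _ aeF _ _ _ Sae) => x Sx xab.
by rewrite /h /crestrict mem_set //; split => //; exact: Sx.
Qed.

Let gap_le n x : D' x -> cnormsq (h n.+1 x - h n x) <= fine (S x) * 4^-1 ^+ n.
Proof.
move=> D'x; rewrite /h /crestrict !mem_set //.
rewrite exprVn ler_pdivlMr ?exprn_gt0 // mulrC -lee_fin fineK; last by have [] := D'x.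
apply: (@le_trans _ _ (\sum_(0 <= k < n.+1) (4 ^+ k * gap k x)%:E)%E).
  by rewrite big_nat_recr //= leeDr // sume_ge0.
by apply: nneseries_lim_ge => k _ _.
Qed.

Let step_le (P : R[i] -> R) n x : (forall z, P z ^+ 2 <= cnormsq z) -> 
  `|P (h n.+1 x - h n x)| <= Num.sqrt (fine (S x)) * 2^-1 ^+ n.
Proof.
move=> HP.
have [D'x|nD] := pselect (D' x); last first.
  have -> : h n.+1 x - h n x = 0.
    by rewrite /h /crestrict; case: ifPn => [/set_mem//|_]; rewrite subrr.
  have := HP 0; rewrite /cnormsq /= expr0n /= addr0 => P0.
  have /eqP : P 0 ^+ 2 = 0 by apply/eqP; rewrite eq_le P0 sqr_ge0.
  rewrite sqrf_eq0 => /eqP ->; rewrite normr0 mulr_ge0 ?sqrtr_ge0 ?exprn_ge0 //.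
rewrite -ler_sqr ?nnegrE ?mulr_ge0 ?sqrtr_ge0 ?exprn_ge0 //.
rewrite real_normK ?num_real // exprMn sqr_sqrtr ?fine_ge0 //.
rewrite -exprM mulnC exprM (_ : 2^-1 ^+ 2 = 4^-1 :> R); last by field.
exact: le_trans (HP _) (gap_le n D'x).
Qed.

Let l x : R[i] := limn (fun n => Re (h n x)) +i* limn (fun n => Im (h n x)).

Let Re_tail n x : `|Re (l x) - Re (h n x)| <= 2 * Num.sqrt (fine (S x)) * 2^-1 ^+ n.
Proof.
apply: (@geometric_cauchy R (fun n => Re (h n x))) => k.
by rewrite -ReB; apply: step_le; exact: sqr_Re_le.
Qed.

Let Im_tail n x : `|Im (l x) - Im (h n x)| <= 2 * Num.sqrt (fine (S x)) * 2^-1 ^+ n.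
Proof.
apply: (@geometric_cauchy R (fun n => Im (h n x))) => k.
by rewrite -ImB; apply: step_le; exact: sqr_Im_le.
Qed.

Let cvg_tail (v : nat -> R) (c C : R) : (forall n, `|c - v n| <= C * 2^-1 ^+ n) ->
  v @ \oo --> c.
Proof.
move=> H; apply/cvgrPdist_le => e e0.
have : (fun m => C * 2^-1 ^+ m) @ \oo --> (0 : R).
  by apply: (@cvg_geometric R C 2^-1); rewrite gtr0_norm ?invf_lt1 ?ltr1n.
move=> /cvgrPdist_le /(_ e e0); apply: filterS => n; rewrite sub0r normrN => Hn.
by apply: le_trans (H n) _; apply: le_trans Hn; exact: ler_norm.
Qed.

Let mRe : measurable_fun D (Re \o l).
Proof.
apply: (@measurable_fun_cvg _ _ R D (fun n => Re \o h n)) => [n|x _].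
  by have [] := sh n.
exact: cvg_tail (fun n => Re_tail n x).
Qed.

Let mIm : measurable_fun D (Im \o l).
Proof.
apply: (@measurable_fun_cvg _ _ R D (fun n => Im \o h n)) => [n|x _].
  by have [] := sh n.
exact: cvg_tail (fun n => Im_tail n x).
Qed.

Let l_tail n x : ((cnormsq (l x - h n x))%:E <= (8 * 4^-1 ^+ n)%:E * S x)%E.
Proof.
have [Sfin|] := boolP (S x \is a fin_num); last first.
  rewrite ge0_fin_numE // -leNgt leye_eq => /eqP ->.
  by rewrite gt0_muley ?leey // lte_fin mulr_gt0 // exprn_gt0.
rewrite -(fineK Sfin) -EFinM lee_fin.
have H (z : R) : `|z| <= 2 * Num.sqrt (fine (S x)) * 2^-1 ^+ n ->
    z ^+ 2 <= 4 * 4^-1 ^+ n * fine (S x).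
  move=> hz; rewrite -(real_normK (num_real z)).
  have c0 : 0 <= 2 * Num.sqrt (fine (S x)) * 2^-1 ^+ n by apply: le_trans hz.
  have -> : 4 * 4^-1 ^+ n * fine (S x) = (2 * Num.sqrt (fine (S x)) * 2^-1 ^+ n) ^+ 2.
    rewrite !exprMn sqr_sqrtr ?fine_ge0 // -exprM mulnC exprM.
    by rewrite (_ : 2^-1 ^+ 2 = 4^-1 :> R); [ring|field].
  by rewrite ler_sqr // nnegrE.
rewrite /cnormsq ReB ImB.
have -> : 8 * 4^-1 ^+ n * fine (S x) =
  4 * 4^-1 ^+ n * fine (S x) + 4 * 4^-1 ^+ n * fine (S x) by ring.
apply: lerD; apply: H; [exact: Re_tail|exact: Im_tail].
Qed.

Let sl_tail n : sq_integrable a b (fun x => l x - h n x).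
Proof.
have [m1 m2 _] := sh n.
have m1' : measurable_fun D (Re \o (fun x => l x - h n x)).
  by apply: eq_measurable_fun (measurable_funB mRe m1) => x _ /=; rewrite ReB.
have m2' : measurable_fun D (Im \o (fun x => l x - h n x)).
  by apply: eq_measurable_fun (measurable_funB mIm m2) => x _ /=; rewrite ImB.
split => //.
apply: le_integrable (integrableZl mD (8 * 4^-1 ^+ n) iS) => //.
  apply/measurable_EFinP; rewrite /cnormsq; apply: measurable_funD; exact: measurable_funX.
move=> x _; rewrite gee0_abs; last by rewrite lee_fin cnormsq_ge0.
rewrite gee0_abs; first exact: l_tail.
by rewrite mule_ge0 // lee_fin mulr_ge0 // exprn_ge0.
Qed.

Let sl : sq_integrable a b l.
Proof.
have := sq_integrable_lin 1 (sl_tail 0) (sh 0).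
by congr sq_integrable; apply/funext => x; rewrite scale1r [LHS]/GRing.add /= subrK.
Qed.

Let normsq_tail n : normsq (L2class a b l - w n) <= 8 * fine (\int[mu]_(x in D) S x)%E * 4^-1 ^+ n.
Proof.
have -> : L2class a b l - w n = L2class a b (fun x => l x - h n x).
  have -> : w n = L2class a b (h n).
    by rewrite -[LHS]L2class_repr; apply/(L2class_eqP (sf n) (sh n)); apply: ae_eq_sym; exact: hf.
  exact: L2classB.
rewrite normsq_class // -lee_fin /Rintegral fineK; last first.
  by apply: integrable_fin_num => //; have [_ _] := sl_tail n.
rewrite mulrAC EFinM fineK; last exact: integrable_fin_num. 
have c0 : 0 <= 8 * 4^-1 ^+ n :> R by rewrite mulr_ge0 ?exprn_ge0.
rewrite -ge0_integralZl_EFin //.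
apply: ge0_le_integral => //.
- by move=> x _; rewrite lee_fin cnormsq_ge0.
- by have [_ _] := sl_tail n; exact: measurable_int.
- exact: emeasurable_funM.
Qed.

(** The Riesz-Fischer theorem for rapidly convergent sequences.  The series
    [S = sum 4^n |f (n+1) - f n|^2] has a finite integral, hence is finite
    almost everywhere; where it is finite the increments of [f n x] are at most
    [sqrt (S x) / 2^n], so the pointwise limit exists and its squared distance
    to [f n] is at most [8 S / 4^n]. *)
Lemma L2_complete :
  exists (u : L2 a b) (K : R), forall n, normsq (u - w n) <= K * 4^-1 ^+ n.
Proof. by exists (L2class a b l), (8 * fine (\int[mu]_(x in D) S x)%E). Qed.

End Completeness.
End L2Classes.

Section L2Dot.
Local Open Scope complex_scope.
Context {R : realType} {a b : R}.
Implicit Types (u v w : L2 a b) (k : R[i]).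

Lemma L2dotDl u v w : L2dot (u + v) w = L2dot u w + L2dot v w.
Proof. exact: dotDl. Qed.

Lemma L2dotDr u v w : L2dot u (v + w) = L2dot u v + L2dot u w.
Proof. exact: dotDr. Qed.

Lemma L2dotBl u v w : L2dot (u - v) w = L2dot u w - L2dot v w.
Proof. exact: dotBl. Qed.

Lemma L2dotBr u v w : L2dot u (v - w) = L2dot u v - L2dot u w.
Proof. exact: dotBr. Qed.

Lemma L2dotZl k u v : L2dot (k *: u) v = k * L2dot u v.
Proof. exact: dotZl. Qed.

Lemma L2dotZr k u v : L2dot u (k *: v) = k^* * L2dot u v.
Proof. exact: dotZr. Qed.

Lemma L2dot0l u : L2dot 0 u = 0.
Proof. exact: dot0l. Qed.

Lemma L2dot0r u : L2dot u 0 = 0.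
Proof. exact: dot0r. Qed.

Lemma L2dotC u v : L2dot u v = (L2dot v u)^*.
Proof. exact: dotC. Qed.

End L2Dot.

Lemma cnormsq_eq0 {R : realType} (z : R[i]) : cnormsq z = 0 -> z = 0.
Proof.
case: z => p q /eqP; rewrite /cnormsq /= paddr_eq0 ?sqr_ge0 // !sqrf_eq0.
by move=> /andP[/eqP -> /eqP ->].
Qed.

Section L2Density.
Local Open Scope complex_scope.
Context {R : realType}.
Variables (a b : R) (D : set (L2 a b)) (u : L2 a b).
Hypothesis Dlin : forall k v w, D v -> D w -> D (k *: v + w).
Hypothesis D0 : D 0.
Hypothesis Dperp : forall h, (forall v, D v -> L2dot v h = 0) -> h = 0.

Let DD v w : D v -> D w -> D (v + w).
Proof. by move=> Dv Dw; rewrite -[v]scale1r; exact: Dlin. Qed.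

Let DZ k v : D v -> D (k *: v).
Proof. by move=> Dv; rewrite -[_ *: _]addr0; exact: Dlin. Qed.

Let normsq_ge0 (v : L2 a b) : 0 <= normsq v.
Proof. by rewrite -ler0c -L2dot_normsq; exact: dot_ge0. Qed.

Let parallelogram (x y : L2 a b) :
  normsq (x - y) + normsq (x + y) = 2 * normsq x + 2 * normsq y.
Proof.
apply: (@complexI R); rewrite !rmorphD !rmorphM /= -!L2dot_normsq.
rewrite !L2dotBl !L2dotBr !L2dotDl !L2dotDr rmorph_nat; ring.
Qed.

Let normsqZ k (x : L2 a b) : normsq (k *: x) = cnormsq k * normsq x.
Proof.
apply: (@complexI R); rewrite rmorphM /= -!L2dot_normsq L2dotZl L2dotZr mulrA.
by rewrite -normCK -add_Re2_Im2.
Qed.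

Let dset : set R := [set normsq (u - v) | v in D].
Let d := inf dset.

Let d_le v : D v -> d <= normsq (u - v).
Proof.
move=> Dv; apply: ge_inf; last by exists v.
by exists 0 => _ [w _ <-]; exact: normsq_ge0.
Qed.

Let minimizer n : exists2 v, D v & normsq (u - v) <= d + 16^-1 ^+ n / 4.
Proof.
have hi : has_inf dset.
  split; first by exists (normsq (u - 0)), 0.
  by exists 0 => _ [w _ <-]; exact: normsq_ge0.
have e0 : 0 < 16^-1 ^+ n / 4 :> R by rewrite divr_gt0 // exprn_gt0 // invr_gt0.
have [_ [v Dv <-] h] := inf_adherent e0 hi.
by exists v => //; exact: ltW.
Qed.

(** A minimizing sequence in [D] for the distance to [u] is Cauchy by the
    parallelogram law, and [u] minus its limit is orthogonal to [D]. *)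
Lemma L2_orth_dense (e : R[i]) : 0 < e -> exists2 v, D v & L2dot (u - v) (u - v) < e.
Proof.
move=> e0.
have /choice[v Hv] n : exists v, D v /\ normsq (u - v) <= d + 16^-1 ^+ n / 4.
  by have [v ? ?] := minimizer n; exists v.
have Dv n : D (v n) by have [] := Hv n.
have nv n : normsq (u - v n) <= d + 16^-1 ^+ n / 4 by have [] := Hv n.
have fast n : normsq (v n.+1 - v n) <= 16^-1 ^+ n.
  have := parallelogram (u - v n) (u - v n.+1).
  have -> : u - v n - (u - v n.+1) = v n.+1 - v n by rewrite opprB addrC addrA subrK.
  have -> : u - v n + (u - v n.+1) = 2 *: (u - 2^-1 *: (v n + v n.+1)).
    rewrite scalerBr scalerA divff ?pnatr_eq0 // scale1r scaler_nat mulr2n.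
    by rewrite opprD addrACA.
  rewrite normsqZ.
  have -> : cnormsq (2 : R[i]) = 4.
    have -> : (2 : R[i]) = (2 : R)%:C by rewrite rmorph_nat.
    by rewrite /cnormsq /= expr0n /= addr0 -natrX.
  have h1 := d_le (DZ 2^-1 (DD (Dv n) (Dv n.+1))).
  have h2 := nv n; have h3 := nv n.+1.
  have h4 : 16^-1 ^+ n.+1 <= 16^-1 ^+ n :> R.
    rewrite exprS ler_piMl ?exprn_ge0 ?invr_ge0 //.
    by rewrite invf_le1 // ler1n.
  lra.
have [l [K HK]] := L2_complete fast.
have geo n : 4^-1 ^+ n <= 2^-1 ^+ n :> R.
  by apply: lerXn2r; rewrite ?nnegrE ?invr_ge0 // lef_pV2 ?posrE // ler_nat.
have geo' n : 16^-1 ^+ n <= 2^-1 ^+ n :> R.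
  by apply: lerXn2r; rewrite ?nnegrE ?invr_ge0 // lef_pV2 ?posrE // ler_nat.
have geo0 n : 0 <= 2^-1 ^+ n :> R by rewrite exprn_ge0 // invr_ge0.
have HK' n : normsq (l - v n) <= `|K| * 2^-1 ^+ n.
  apply: le_trans (HK n) _; apply: (@le_trans _ _ (`|K| * 4^-1 ^+ n)).
    by rewrite ler_wpM2r ?ler_norm // exprn_ge0 // invr_ge0.
  by rewrite ler_wpM2l.
have ul : u - l = 0.
  apply: Dperp => x Dx; rewrite L2dotC.
  suff -> : L2dot (u - l) x = 0 by rewrite conjc0.
  set z := L2dot (u - l) x.
  suff : cnormsq z <= 0.
    move=> z0; apply: cnormsq_eq0; apply/eqP.
    by rewrite eq_le z0 addr_ge0 ?sqr_ge0.
  apply: (@le_geometric0 _ _ _ (2 * (normsq x * 4^-1 + normsq x * `|K|))) => n; rewrite add0r.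
  rewrite -lecR add_Re2_Im2.
  (* [v n] is nearly closest to [u], so [u - v n] is nearly orthogonal to [x]. *)
  have -> : z = L2dot (u - v n) x - L2dot (l - v n) x.
    by rewrite -L2dotBl opprB addrA subrK.
  set p := L2dot (u - v n) x; set q := L2dot (l - v n) x.
  have hp : `|p| ^+ 2 <= (normsq x * (16^-1 ^+ n / 4))%:C.
    apply: (@le_trans _ _ (L2dot x x * (L2dot (u - v n) (u - v n) - d%:C))).
      apply: dot_cauchy_schwarz_gap => k; rewrite [leRHS]L2dot_normsq lecR.
      have -> : u - v n + k *: x = u - (v n - k *: x) by rewrite opprB addrA addrAC.
      apply: d_le; rewrite -scaleNr addrC; exact: Dlin.
    rewrite !L2dot_normsq -rmorphB -rmorphM lecR ler_wpM2l //.
    by rewrite lerBlDl.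
  have hq : `|q| ^+ 2 <= (normsq x * (`|K| * 2^-1 ^+ n))%:C.
    apply: le_trans (dot_cauchy_schwarz _ _ _) _.
    by rewrite [X in X * _]L2dot_normsq [X in _ * X]L2dot_normsq -rmorphM lecR ler_wpM2l.
  apply: le_trans (sqr_normB_le p q) _.
  apply: (@le_trans _ _ (2 * ((normsq x * (16^-1 ^+ n / 4))%:C +
                              (normsq x * (`|K| * 2^-1 ^+ n))%:C))).
    by rewrite ler_wpM2l // lerD.
  rewrite -rmorphD -[2](rmorph_nat (real_complex R)) -rmorphM lecR -mulrA.
  rewrite ler_wpM2l // mulrDl lerD //.
    by rewrite -mulrA ler_wpM2l // mulrC ler_wpM2l // invr_ge0.
  by rewrite mulrA.
move: ul => /eqP; rewrite subr_eq0 => /eqP ul.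
apply: contrapT => H.
have : complex.Re e <= 0.
  apply: (@le_geometric0 _ _ _ `|K|) => n; rewrite add0r.
  apply: le_trans (HK' n); rewrite leNgt -ul; apply/negP => h.
  apply: H; exists (v n) => //; rewrite [ltLHS]L2dot_normsq ltcE /= h andbT.
  by move: e0; rewrite ltcE => /andP[/eqP ->].
by move: e0; rewrite ltcE /= leNgt => /andP[_ ->].
Qed.

End L2Density.

(** * Restriction and gluing along a partition *)

Section Pieces.
Local Open Scope complex_scope.
Context {R : realType}.
Local Notation mu := (@lebesgue_measure R).
Local Notation Re := (@complex.Re R).
Local Notation Im := (@complex.Im R).
Local Notation ae_eq_on a b f g := (@ae_eq _ _ _ mu (fun=> R[i]) `[a, b]%classic f g).
Let aeF : Filter (almost_everywhere mu) := ae_filter_ringOfSetsType mu.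

Lemma ae_eq_sub (a b c d : R) (f g : R -> R[i]) : a <= c -> d <= b ->
  ae_eq_on a b f g -> ae_eq_on c d f g.
Proof.
move=> ac db; apply: (@filterS _ _ aeF) => x h xcd; apply: h.
by move: xcd; rewrite /= !in_itv /= => /andP[cx xd]; rewrite (le_trans ac) // (le_trans xd).
Qed.

Lemma sq_integrable_sub (a b c d : R) f : a <= c -> d <= b ->
  sq_integrable a b f -> sq_integrable c d f.
Proof.
move=> ac db [m1 m2 I].
have S : `[c, d]%classic `<=` (`[a, b]%classic : set R).
  by move=> x; rewrite /= !in_itv /= => /andP[cx xd]; rewrite (le_trans ac) // (le_trans xd).
have mab : @measurable _ (measurableTypeR R) `[a, b]%classic by exact: measurable_itv.
split.
- exact: measurable_funS m1.
- exact: measurable_funS m2.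
- exact: L1_subset I.
Qed.

Lemma L2restr_class (a b c d : R) f : a <= c -> d <= b -> sq_integrable a b f ->
  L2restr c d (L2class a b f) = L2class c d f.
Proof.
move=> ac db sf; apply/L2class_eqP.
- exact: sq_integrable_sub (L2repr_sq _).
- exact: sq_integrable_sub sf.
- exact: ae_eq_sub (L2repr_class sf).
Qed.

Lemma L2restr_lin (a b c d : R) k (u v : L2 a b) : a <= c -> d <= b ->
  L2restr c d (k *: u + v) = k *: L2restr c d u + L2restr c d v.
Proof.
move=> ac db; have su := L2repr_sq u; have sv := L2repr_sq v.
rewrite -{1}(L2class_repr u) -{1}(L2class_repr v) -(L2class_lin k su sv).
rewrite L2restr_class //; last exact: sq_integrable_lin.
by rewrite L2class_lin //; exact: sq_integrable_sub (L2repr_sq _).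
Qed.

Lemma L2restr_conj (a b c d : R) (u : L2 a b) : a <= c -> d <= b ->
  L2restr c d (L2conj u) = L2conj (L2restr c d u).
Proof.
move=> ac db; have su := L2repr_sq u.
rewrite /L2restr [in RHS]L2conj_class; last exact: sq_integrable_sub su.
by apply: L2restr_class => //; exact: sq_integrable_conj.
Qed.

Variables (m : nat) (a : 'I_m.+1 -> R).
Hypothesis a_incr : forall i j : 'I_m.+1, (i < j)%N -> a i < a j.

Let a_le (i j : 'I_m.+1) : (i <= j)%N -> a i <= a j.
Proof.
rewrite leq_eqVlt => /orP[/eqP /val_inj -> //|/a_incr]; exact: ltW.
Qed.

Lemma lend_lt_rend i : lend a i < rend a i.
Proof. exact: a_incr. Qed.

Lemma start_le_lend i : a ord0 <= lend a i.
Proof. exact: a_le. Qed.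

Lemma rend_le_end i : rend a i <= a ord_max.
Proof. by apply: a_le; rewrite lift0. Qed.

Let A := a ord0.
Let B := a ord_max.

(** The integrals over the pieces are the increments of one primitive, and these
    telescope. *)
Lemma Rintegral_partition (g : R -> R) : L1 A B g ->
  \int[mu]_(x in `[A, B]) g x = \sum_i \int[mu]_(x in `[lend a i, rend a i]) g x.
Proof.
move=> Ig; pose P k := primitive A B g (a (inord k)).
transitivity (\sum_(i < m) (P i.+1 - P i)).
  rewrite -(big_mkord xpredT (fun i => P i.+1 - P i)) telescope_sumr // /P.
  have -> : inord m = ord_max :> 'I_m.+1 by apply: val_inj; rewrite /= inordK.
  have -> : inord 0 = ord0 :> 'I_m.+1 by apply: val_inj; rewrite /= inordK.
  by rewrite primitive_start subr0 primitiveE.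
apply: eq_bigr => i _; rewrite /P.
have -> : a (inord i.+1) = rend a i.
  by congr (a _); apply: val_inj; rewrite /= inordK // ltnS.
have -> : a (inord i) = lend a i.
  by congr (a _); apply: val_inj; rewrite /= inordK // ltnW // ltnS.
have h1 := start_le_lend i; have h2 := ltW (lend_lt_rend i); have h3 := rend_le_end i.
have Is : L1 (lend a i) (rend a i) g by exact: L1_subset Ig.
rewrite !primitiveE //; last exact: le_trans h3.
rewrite (@Rintegral_itvB R g (BLeft A) (BRight (rend a i)) (lend a i)); last 3 first.
- exact: L1_subset Ig.
- by rewrite bnd_simp.
- by rewrite bnd_simp.
rewrite Rintegral_itv_obnd_cbnd //.
apply: integrableS Is => // x /=; rewrite !in_itv /= => /andP[/ltW -> ->] //.
Qed.

Lemma L2dot_pieces (u v : L2 A B) :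
  L2dot u v = \sum_i L2dot (@piece R m a i u) (@piece R m a i v).
Proof.
have su := L2repr_sq u; have sv := L2repr_sq v.
have [I1 I2] := cintegrable_cprod su sv.
transitivity (\sum_i cintegral (lend a i) (rend a i) (cprod (L2repr u) (L2repr v))).
  rewrite /L2dot /cintegral (Rintegral_partition I1) (Rintegral_partition I2).
  apply/eqP; rewrite eq_complex /= !raddf_sum /=.
  by apply/andP; split; apply/eqP; apply: eq_bigr.
apply: eq_bigr => i _; have h1 := start_le_lend i; have h3 := rend_le_end i.
rewrite /L2dot; apply: ae_eq_cintegral.
- by apply: cintegrable_cprod; exact: sq_integrable_sub (L2repr_sq _).
- by apply: cintegrable_cprod; exact: L2repr_sq.
- apply: (@filterS2 _ _ aeF) (L2repr_restr u h1 h3) (L2repr_restr v h1 h3) => x e1 e2 xi.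
  by rewrite /cprod e1 // e2.
Qed.

Lemma piece_lin i k (u v : L2 A B) :
  @piece R m a i (k *: u + v) = k *: @piece R m a i u + @piece R m a i v.
Proof. by apply: L2restr_lin; [exact: start_le_lend|exact: rend_le_end]. Qed.

Lemma piece_conj i (u : L2 A B) : @piece R m a i (L2conj u) = L2conj (@piece R m a i u).
Proof. by apply: L2restr_conj; [exact: start_le_lend|exact: rend_le_end]. Qed.

Lemma sq_integrable_extend i f : sq_integrable (lend a i) (rend a i) f ->
  sq_integrable A B (crestrict `[lend a i, rend a i[ f).
Proof.
move=> [m1 m2 I]; set D := `[lend a i, rend a i[%classic.
have mD : @measurable _ (measurableTypeR R) D by exact: measurable_itv.
have DS : D `<=` `[lend a i, rend a i].
  by move=> x; rewrite /D /= !in_itv /= => /andP[-> /ltW ->].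
have mI : @measurable _ (measurableTypeR R) `[lend a i, rend a i]%classic.
  exact: measurable_itv.
have mr (h : R -> R) : measurable_fun `[lend a i, rend a i] h -> measurable_fun setT (h \_ D).
  move=> mh; apply/(measurable_restrictT _ mD).
  exact: measurable_funS mh.
split.
- have -> : Re \o crestrict D f = (Re \o f) \_ D.
    by apply/funext => x /=; rewrite /crestrict !patchE; case: ifP.
  exact: measurable_funTS (mr _ m1).
- have -> : Im \o crestrict D f = (Im \o f) \_ D.
    by apply/funext => x /=; rewrite /crestrict !patchE; case: ifP.
  exact: measurable_funTS (mr _ m2).
- have -> : EFin \o (cnormsq \o crestrict D f) = (EFin \o (cnormsq \o f)) \_ D.
    apply/funext => x /=; rewrite /crestrict !patchE; case: ifP => // _.
    by rewrite /cnormsq /= expr0n /= addr0.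
  have : mu.-integrable setT ((EFin \o (cnormsq \o f)) \_ D).
    by rewrite -integrable_mkcond //; exact: integrableS I.
  by apply: integrableS.
Qed.

Lemma glue_pieces (v : forall i, L2 (lend a i) (rend a i)) :
  exists u : L2 A B, forall i, @piece R m a i u = v i.
Proof.
pose g i := crestrict `[lend a i, rend a i[ (L2repr (v i)).
have sg i : sq_integrable A B (g i) by apply: sq_integrable_extend; exact: L2repr_sq.
have sG : sq_integrable A B (\sum_i g i).
  elim/big_ind : _ => //; first exact: sq_integrable0.
  by move=> x y sx sy; rewrite -[x]scale1r; exact: sq_integrable_lin.
exists (L2class A B (\sum_i g i)) => i.
have h1 := start_le_lend i; have h3 := rend_le_end i.
rewrite /piece L2restr_class // -[RHS]L2class_repr; apply/L2class_eqP.
- exact: sq_integrable_sub sG.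
- exact: L2repr_sq.
(* The glued function is cut off on half-open intervals, so that the pieces do
   not overlap; a class does not see the value at one endpoint. *)
exists [set rend a i]; split.
- exact: measurable_set1.
- exact: lebesgue_measure_set1.
move=> x /= /not_implyP[xi]; apply: contra_notP => xr.
have {}xr : x < rend a i.
  by move: xi; rewrite in_itv /= lt_neqAle => /andP[_ ->]; rewrite andbT; apply/eqP.
have lx : lend a i <= x by move: xi; rewrite in_itv /= => /andP[].
rewrite fct_sumE (bigD1 i) //= big1 => [|j ji].
  by rewrite addr0 /g /crestrict mem_set //= in_itv /= lx xr.
rewrite /g /crestrict memNset //= in_itv /= => /andP[lj xj].
move: ji; rewrite neq_ltn => /orP[ji|ij].
  have : rend a j <= lend a i by apply: a_le; rewrite lift0.
  by move=> h; have := lt_le_trans xj (le_trans h lx); rewrite ltxx.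
have : rend a i <= lend a j by apply: a_le; rewrite lift0.
by move=> h; have := lt_le_trans xr (le_trans h lj); rewrite ltxx.
Qed.

End Pieces.

(** * Complex-valued absolutely continuous functions *)

Section ComplexCalculus.
Local Open Scope complex_scope.
Context {R : realType}.
Local Notation mu := (@lebesgue_measure R).
Local Notation Re := (@complex.Re R).
Local Notation Im := (@complex.Im R).
Implicit Types (a b x : R) (y z w : R -> R[i]).
Let aeF : Filter (almost_everywhere mu) := ae_filter_ringOfSetsType mu.

Lemma normc_ge_Im (z : R[i]) : `|Im z|%:C <= `|z|.
Proof.
rewrite normc_def lecR -sqrtr_sqr ler_wsqrtr // lerDr sqr_ge0 //.
Qed.

Lemma normc_le_ReIm (z : R[i]) : `|z| <= (`|Re z| + `|Im z|)%:C.
Proof.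
rewrite normc_def lecR -[leRHS]ger0_norm ?addr_ge0 // -sqrtr_sqr ler_wsqrtr //.
by rewrite sqrrD !real_normK ?num_real // lerD2r lerDl mulrn_wge0 // mulr_ge0.
Qed.

Lemma abs_continuousP a b y : abs_continuous a b y <->
  abscont a b (Re \o y) /\ abscont a b (Im \o y).
Proof.
split=> [H|[H1 H2] e e0].
  split=> e e0; have [d d0 Hd] := H e e0; exists d => // n s t st disj sumd;
    rewrite -ltcR; apply: le_lt_trans (Hd n s t st disj sumd); rewrite rmorph_sum /=;
    apply: ler_sum => k _.
    by rewrite -ReB; exact: normc_ge_Re.
  by rewrite -ImB; exact: normc_ge_Im.
have e2 : 0 < e / 2 by rewrite divr_gt0.
have [d1 d10 h1] := H1 _ e2; have [d2 d20 h2] := H2 _ e2.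
exists (Num.min d1 d2); first by rewrite lt_min d10.
move=> n s t st disj; rewrite lt_min => /andP[/(h1 n s t st disj) l1 /(h2 n s t st disj) l2].
apply: (@le_lt_trans _ _ (\sum_(k < n) (`|Re (y (t k)) - Re (y (s k))| +
                                       `|Im (y (t k)) - Im (y (s k))|))%:C).
  rewrite rmorph_sum /=; apply: ler_sum => k _.
  by rewrite -ReB -ImB; exact: normc_le_ReIm.
by rewrite ltcR big_split /= [ltRHS]splitr ltrD.
Qed.

Lemma abs_continuous_lin a b k y z : abs_continuous a b y -> abs_continuous a b z ->
  abs_continuous a b (k *: y + z).
Proof.
case: k => kr ki /abs_continuousP[y1 y2] /abs_continuousP[z1 z2].
apply/abs_continuousP; split.
- have h := abscont_sub (abscont_lin kr y1 z1) (abscont_lin ki y2 (abscont_cst a b 0)).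
  apply: eq_abscont h => x _ _ /=.
  rewrite [in RHS]/GRing.add /= /GRing.scale /=; case: (y x) (z x) => ? ? [? ?] /=; ring.
- have h := abscont_add (abscont_lin kr y2 z2) (abscont_lin ki y1 (abscont_cst a b 0)).
  apply: eq_abscont h => x _ _ /=.
  rewrite [in RHS]/GRing.add /= /GRing.scale /=; case: (y x) (z x) => ? ? [? ?] /=; ring.
Qed.

Lemma abs_continuous_mul a b y z : abs_continuous a b y -> abs_continuous a b z ->
  abs_continuous a b (fun x => y x * z x).
Proof.
move=> /abs_continuousP[y1 y2] /abs_continuousP[z1 z2].
apply/abs_continuousP; split.
- apply: eq_abscont (abscont_sub (abscont_mul y1 z1) (abscont_mul y2 z2)) => x _ _ /=.
  by case: (y x) (z x) => ? ? [].
- apply: eq_abscont (abscont_add (abscont_mul y1 z2) (abscont_mul y2 z1)) => x _ _ /=.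
  by case: (y x) (z x) => ? ? [].
Qed.

Lemma abs_continuous_conj a b y : abs_continuous a b y -> abs_continuous a b (cconj y).
Proof.
move=> /abs_continuousP[y1 y2]; apply/abs_continuousP; split.
- by apply: eq_abscont y1 => x _ _; rewrite /cconj /=; case: (y x).
- by apply: eq_abscont (abscont_opp y2) => x _ _; rewrite /cconj /=; case: (y x).
Qed.

Lemma abs_continuous_sq_integrable a b y : abs_continuous a b y -> sq_integrable a b y.
Proof.
move=> /abs_continuousP[y1 y2]; split.
- exact: continuous_itv_measurable (abscont_continuous y1).
- exact: continuous_itv_measurable (abscont_continuous y2).
- have := abscont_add (abscont_mul y1 y1) (abscont_mul y2 y2).
  by move=> /abscont_continuous /continuous_itv_integrable.
Qed.

Lemma abs_continuous0 a b : abs_continuous a b 0.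
Proof. by apply/abs_continuousP; split; exact: abscont_cst. Qed.

Lemma is_cderive_lin x k y z dy dz : is_cderive x y dy -> is_cderive x z dz ->
  is_cderive x (k *: y + z) (k * dy + dz).
Proof.
case: k => kr ki [y1 y2] [z1 z2]; split.
- have := is_deriveD (is_deriveB (is_deriveZ kr y1) (is_deriveZ ki y2)) z1.
  have <- : Re \o ((kr +i* ki) *: y + z) = kr \*: (Re \o y) - ki \*: (Im \o y) + (Re \o z).
    apply/funext => u /=; rewrite [in LHS]/GRing.add /= /GRing.scale /=.
    rewrite [in RHS]/GRing.add /= /GRing.add /= /GRing.opp /=.
    by case: (y u) (z u) => ? ? [].
  move=> h; apply: is_derive_eq h _; case: dy y1 y2 => dr di _ _; case: dz z1 z2 => er ei _ _ /=.
  reflexivity.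
- have := is_deriveD (is_deriveD (is_deriveZ kr y2) (is_deriveZ ki y1)) z2.
  have <- : Im \o ((kr +i* ki) *: y + z) = kr \*: (Im \o y) + ki \*: (Re \o y) + (Im \o z).
    apply/funext => u /=; rewrite [in LHS]/GRing.add /= /GRing.scale /=.
    rewrite [in RHS]/GRing.add /= /GRing.add /=.
    by case: (y u) (z u) => ? ? [].
  move=> h; apply: is_derive_eq h _; case: dy y1 y2 => dr di _ _; case: dz z1 z2 => er ei _ _ /=.
  reflexivity.
Qed.

Lemma is_cderive_mul x y z dy dz : is_cderive x y dy -> is_cderive x z dz ->
  is_cderive x (fun u => y u * z u) (dy * z x + y x * dz).
Proof.
move=> [y1 y2] [z1 z2]; split.
- have := is_deriveB (is_deriveM y1 z1) (is_deriveM y2 z2).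
  have <- : Re \o (fun u => y u * z u) = (Re \o y) * (Re \o z) - (Im \o y) * (Im \o z).
    apply/funext => u; rewrite [RHS](_ : _ = Re (y u) * Re (z u) - Im (y u) * Im (z u)) //=.
    by case: (y u) (z u) => ? ? [].
  move=> h; apply: is_derive_eq h _ => /=.
  move: y1 y2 z1 z2 => _ _ _ _; move: (y x) (z x) dy dz => [yr yi] [zr zi] [dr di] [er ei] /=.
  rewrite -![_ *: _]/(_ * _); ring.
- have := is_deriveD (is_deriveM y1 z2) (is_deriveM y2 z1).
  have <- : Im \o (fun u => y u * z u) = (Re \o y) * (Im \o z) + (Im \o y) * (Re \o z).
    apply/funext => u; rewrite [RHS](_ : _ = Re (y u) * Im (z u) + Im (y u) * Re (z u)) //=.
    by case: (y u) (z u) => ? ? [].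
  move=> h; apply: is_derive_eq h _ => /=.
  move: y1 y2 z1 z2 => _ _ _ _; move: (y x) (z x) dy dz => [yr yi] [zr zi] [dr di] [er ei] /=.
  rewrite -![_ *: _]/(_ * _); ring.
Qed.

Lemma is_cderive_conj x y dy : is_cderive x y dy -> is_cderive x (cconj y) dy^*.
Proof.
move=> [y1 y2]; split.
- have -> : Re \o cconj y = Re \o y by apply/funext => u; rewrite /cconj /=; case: (y u).
  by apply: is_derive_eq y1 _; case: (dy).
- have -> : Im \o cconj y = - (Im \o y).
    by apply/funext => u; rewrite [RHS](_ : _ = - Im (y u)) // /cconj /=; case: (y u).
  by apply: is_derive_eq (is_deriveN y2) _; case: (dy).
Qed.

Lemma is_cderive0 x : is_cderive x 0 0.
Proof. by split; exact: is_derive_cst. Qed.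

Lemma ae_in_open_itv a b (P : R -> Prop) : (\forall x \ae mu, x \in `[a, b] -> P x) ->
  \forall x \ae mu, a < x -> x < b -> P x.
Proof.
apply: (@filterS _ _ aeF) => x h ax xb; apply: h.
by rewrite in_itv /= !ltW.
Qed.

Lemma ae_in_closed_itv a b (P : R -> Prop) : (\forall x \ae mu, a < x -> x < b -> P x) ->
  \forall x \ae mu, x \in `[a, b] -> P x.
Proof.
have nz (c : R) : \forall x \ae mu, x != c.
  exists [set c]; split; [exact: measurable_set1|exact: lebesgue_measure_set1|].
  by move=> x /= /negP; rewrite negbK => /eqP.
move=> h; apply: (@filterS3 _ _ aeF) h (nz a) (nz b) => x h xa xb.
rewrite in_itv /= => /andP[ax xb']; apply: h; first by rewrite lt_neqAle eq_sym xa.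
by rewrite lt_neqAle xb.
Qed.

Lemma abs_continuous_FTC a b W w : a <= b -> abs_continuous a b W ->
  cintegrable a b w ->
  (\forall x \ae mu, x \in `[a, b] -> is_cderive x W (w x)) ->
  W b - W a = cintegral a b w.
Proof.
move=> ab /abs_continuousP[W1 W2] [w1 w2] /ae_in_open_itv dW.
have d1 : \forall x \ae mu, a < x -> x < b -> is_derive x (1 : R) (Re \o W) (Re (w x)).
  by apply: (@filterS _ _ aeF) dW => x h ax xb; have [] := h ax xb.
have d2 : \forall x \ae mu, a < x -> x < b -> is_derive x (1 : R) (Im \o W) (Im (w x)).
  by apply: (@filterS _ _ aeF) dW => x h ax xb; have [] := h ax xb.
have := abscont_FTC ab W1 w1 d1 ab (lexx b).
have := abscont_FTC ab W2 w2 d2 ab (lexx b).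
rewrite !primitiveE //= => h2 h1.
apply/eqP; rewrite eq_complex ReB ImB h1 h2 /cintegral /=.
by apply/andP; split; rewrite addrAC subrr add0r.
Qed.

Lemma ae_exists a b (P : R -> Prop) : a < b -> (\forall x \ae mu, x \in `[a, b] -> P x) ->
  exists2 x, a < x < b & P x.
Proof.
move=> ab [N [mN N0 HN]]; apply: contrapT => H.
have S : (`]a, b[%classic : set R) `<=` N.
  move=> x; rewrite /= in_itv /= => /andP[ax xb]; apply: HN => /= h.
  apply: H; exists x; first by rewrite ax.
  by apply: h; rewrite in_itv /= !ltW.
have : (mu `]a, b[ <= mu N)%E by apply: le_measure => //; rewrite inE //; exact: measurable_itv.
rewrite N0 lebesgue_measure_itv /= lte_fin ab -EFinB lee_fin.
by rewrite subr_le0 leNgt ab.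
Qed.

(** A continuous function that is nonzero at one point is nonzero on an interval of
    positive length, even when the point is [a] or [b]. *)
Lemma abscont_ae0 a b (f : R -> R) : a < b -> abscont a b f ->
  (\forall x \ae mu, x \in `[a, b] -> f x = 0) -> forall x, x \in `[a, b] -> f x = 0.
Proof.
move=> ab Hf f0 x; rewrite in_itv /= => /andP[ax xb].
apply: contrapT => /eqP fx0.
have e0 : 0 < `|f x| by rewrite normr_gt0.
have /subspace_continuousP /(_ x) := abscont_continuous Hf.
rewrite /= in_itv /= ax xb => /(_ isT) /cvgrPdist_lt /(_ _ e0).
rewrite near_withinE => -[d /= d0 Hd].
pose c := Num.max a (x - d / 2); pose c' := Num.min b (x + d / 2).
have d2 : 0 < d / 2 by rewrite divr_gt0.
have cc : c < c'.
  by rewrite /c /c' lt_min !gt_max ab /=; apply/andP; split; [|apply/andP; split]; lra.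
have sub (z : R) : z \in `[c, c'] -> z \in `[a, b] /\ `|x - z| < d.
  rewrite !in_itv /= /c /c' ge_max le_min => /andP[/andP[az xz] /andP[zb zx]].
  split; first by rewrite az.
  by rewrite ltr_norml; apply/andP; split; lra.
have [z /andP[cz zc] [fz zd]] : exists2 z, c < z < c' & f z = 0 /\ `|x - z| < d.
  apply: ae_exists => //; apply: (@filterS _ _ aeF) f0 => z h zc.
  by have [zab zd] := sub z zc; split => //; exact: h.
have zab : z \in `[a, b] by apply: (sub z _).1; rewrite in_itv /= !ltW.
have : `|f x - f z| < `|f x| := Hd z zd zab.
by rewrite fz subr0 ltxx.
Qed.

Lemma abs_continuous_ae0 a b y : a < b -> abs_continuous a b y ->
  (\forall x \ae mu, x \in `[a, b] -> y x = 0) -> forall x, x \in `[a, b] -> y x = 0.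
Proof.
move=> ab /abs_continuousP[y1 y2] y0 x xab.
have h1 : Re (y x) = 0.
  apply: (abscont_ae0 ab y1 _ xab).
  by apply: (@filterS _ _ aeF) y0 => u h /h /= ->.
have h2 : Im (y x) = 0.
  apply: (abscont_ae0 ab y2 _ xab).
  by apply: (@filterS _ _ aeF) y0 => u h /h /= ->.
by apply/eqP; rewrite eq_complex h1 h2 !eqxx.
Qed.

(** Outside [[a, b]] nothing is known of [f], so that [x] has to be an interior
    point. *)
Lemma is_derive_locally0 a b (f : R -> R) x l : (forall z : R, z \in `[a, b] -> f z = 0) ->
  a < x -> x < b -> is_derive x (1 : R) f l -> l = 0.
Proof.
move=> f0 ax xb df; apply/eqP; rewrite -normr_le0; apply/ler_addgt0Pl => e e0.
rewrite addr0.
have [d d0 H] := is_derive_near df e0.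
pose h := Num.min (d / 2) (b - x).
have h0 : 0 < h by rewrite /h lt_min divr_gt0 //= subr_gt0.
have hd : h < d by rewrite /h gt_min ltr_pdivrMr // ltr_pMr // ltr1n.
have hb : h <= b - x by rewrite /h ge_min lexx orbT.
have := H (x + h); rewrite [x + h - x]addrC addKr gtr0_norm // => /(_ hd).
rewrite !f0; last 2 first.
- by rewrite in_itv /= !ltW.
- by rewrite in_itv /=; apply/andP; split; lra.
by rewrite subrr sub0r normrN normrM (gtr0_norm h0) ler_pM2r.
Qed.

Lemma is_cderive_locally0 a b y x l : (forall z : R, z \in `[a, b] -> y z = 0) ->
  a < x -> x < b -> is_cderive x y l -> l = 0.
Proof.
move=> y0 ax xb [d1 d2].
have h1 : Re l = 0 by apply: (is_derive_locally0 _ ax xb d1) => z /y0 /= ->.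
have h2 : Im l = 0 by apply: (is_derive_locally0 _ ax xb d2) => z /y0 /= ->.
by apply/eqP; rewrite eq_complex h1 h2 !eqxx.
Qed.

Lemma sq_integrable_L1 a b f : sq_integrable a b f ->
  L1 a b (Re \o f) /\ L1 a b (Im \o f).
Proof.
move=> sf; have s1 : sq_integrable a b (fun=> 1).
  apply: abs_continuous_sq_integrable; apply/abs_continuousP.
  by split; exact: abscont_cst.
have [h1 h2] := cintegrable_cprod sf s1.
have E : cprod f (fun=> 1) = f.
  by apply/funext => x; rewrite /cprod [X in _ * X](_ : _ = 1) ?mulr1 //; exact: conjc1.
by rewrite E in h1 h2.
Qed.

End ComplexCalculus.

(** * The quasi-differential system on one interval *)

Section IntervalOperator.
Local Open Scope complex_scope.
Context {R : realType}.
Local Notation mu := (@lebesgue_measure R).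
Local Notation Re := (@complex.Re R).
Local Notation Im := (@complex.Im R).
Let aeF : Filter (almost_everywhere mu) := ae_filter_ringOfSetsType mu.
Variables (p Q : R -> R) (a b : R).
Hypothesis ab : a < b.
Hypothesis p_neq0 : \forall x \ae mu, x \in `[a, b] -> p x != 0.
Hypothesis p_L1 : lebesgue_L1 a b (fun x => 1 / p x).
Hypothesis Qp_L1 : lebesgue_L1 a b (fun x => Q x / p x).
Hypothesis Q2p_L1 : lebesgue_L1 a b (fun x => Q x ^+ 2 / p x).
Implicit Types (x : R) (y z f : R -> R[i]).

Local Notation r x := (Q x / p x)%:C.
Local Notation s x := (1 / p x)%:C.
Local Notation t x := (Q x ^+ 2 / p x)%:C.
Local Notation maxd := (max_domain p Q a b).

Local Notation conj := (@conjc R).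

Lemma conjc_comb2 (c d : R) (z w : R[i]) :
  conj (c%:C * z + d%:C * w) = c%:C * conj z + d%:C * conj w.
Proof. by case: z w => ? ? [? ?] /=; congr (_ +i* _); ring. Qed.

Lemma conjc_comb3 (c d : R) (u z w : R[i]) :
  conj (u - c%:C * z - d%:C * w) = conj u - c%:C * conj z - d%:C * conj w.
Proof. by case: u z w => ? ? [? ?] [? ?] /=; congr (_ +i* _); ring. Qed.

(** Lagrange identity: the coefficients [c = Q/p], [d = 1/p], [e = Q^2/p] of the
    system drop out of the derivative of [y conj(z1) - y1 conj(z)]. *)
Lemma green_identity (c d e : R) (y y1 y2 z z1 z2 : R[i]) :
  -1 * ((y2 - c%:C * y1 - e%:C * y) * conj z + y1 * conj (c%:C * z + d%:C * z1)) +
  ((c%:C * y + d%:C * y1) * conj z1 + y * conj (z2 - c%:C * z1 - e%:C * z)) =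
  y * conj z2 + -1 * (y2 * conj z).
Proof. by rewrite conjc_comb2 conjc_comb3; ring. Qed.

(** The quasi-differential equation [D^[2] y = y2] with [y1 = D^[1] y], solved for
    the derivatives of [y] and [y1]. *)
Definition solves_system y y1 y2 :=
  [/\ abs_continuous a b y, abs_continuous a b y1,
   \forall x \ae mu, x \in `[a, b] -> is_cderive x y (r x * y x + s x * y1 x),
   \forall x \ae mu, x \in `[a, b] ->
     is_cderive x y1 (y2 x - r x * y1 x - t x * y x)
   & sq_integrable a b y2].

(** Dividing by [p] is legitimate almost everywhere. *)
Lemma max_domainP y y1 y2 : maxd y y1 y2 <-> solves_system y y1 y2.
Proof.
split.
  move=> [_ [Ay Ay1] H1 H2 s2]; split => //.
    apply: (@filterS2 _ _ aeF) p_neq0 H1 => x p0 h xab; have {}p0 := p0 xab.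
    have [dy d E] := h xab; have -> : r x * y x + s x * y1 x = dy; last by [].
    by rewrite E !rmorphM !fmorphV rmorph1 /=; field; rewrite fmorph_eq0.
  apply: (@filterS _ _ aeF) H2 => x h xab; have [dy d E] := h xab.
  have -> : y2 x - r x * y1 x - t x * y x = dy; last by [].
  by rewrite E; ring.
move=> [Ay Ay1 H1 H2 s2]; split => //.
- exact: abs_continuous_sq_integrable.
- apply: (@filterS2 _ _ aeF) p_neq0 H1 => x p0 h xab; have {}p0 := p0 xab.
  exists (r x * y x + s x * y1 x); first exact: h.
  by rewrite !rmorphM !fmorphV rmorph1 /=; field; rewrite fmorph_eq0.
- apply: (@filterS _ _ aeF) H2 => x h xab.
  exists (y2 x - r x * y1 x - t x * y x); first exact: h.
  by ring.
Qed.

Lemma solves_system_lin k y y1 y2 z z1 z2 : solves_system y y1 y2 ->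
  solves_system z z1 z2 ->
  solves_system (k *: y + z) (k *: y1 + z1) (k *: y2 + z2).
Proof.
move=> [Ay Ay1 Hy Hy1 sy] [Az Az1 Hz Hz1 sz]; split.
- exact: abs_continuous_lin.
- exact: abs_continuous_lin.
- apply: (@filterS2 _ _ aeF) Hy Hz => x hy hz xab.
  have := is_cderive_lin k (hy xab) (hz xab); congr is_cderive.
  rewrite (_ : (k *: y + z) x = k * y x + z x) //.
  rewrite (_ : (k *: y1 + z1) x = k * y1 x + z1 x) //.
  by ring.
- apply: (@filterS2 _ _ aeF) Hy1 Hz1 => x hy hz xab.
  have := is_cderive_lin k (hy xab) (hz xab); congr is_cderive.
  rewrite (_ : (k *: y2 + z2) x = k * y2 x + z2 x) //.
  rewrite (_ : (k *: y1 + z1) x = k * y1 x + z1 x) //.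
  rewrite (_ : (k *: y + z) x = k * y x + z x) //.
  by ring.
- exact: sq_integrable_lin.
Qed.

Lemma solves_system0 : solves_system 0 0 0.
Proof.
split; [exact: abs_continuous0|exact: abs_continuous0|..|exact: sq_integrable0].
- apply: (@filterE _ _ aeF) => x xab; rewrite !mulr0 addr0; exact: is_cderive0.
- apply: (@filterE _ _ aeF) => x xab; rewrite !mulr0 !subr0; exact: is_cderive0.
Qed.

Lemma solves_system_conj y y1 y2 : solves_system y y1 y2 ->
  solves_system (cconj y) (cconj y1) (cconj y2).
Proof.
move=> [Ay Ay1 Hy Hy1 sy]; split.
- exact: abs_continuous_conj.
- exact: abs_continuous_conj.
- apply: (@filterS _ _ aeF) Hy => x hy xab.
  have := is_cderive_conj (hy xab); congr is_cderive.
  exact: conjc_comb2.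
- apply: (@filterS _ _ aeF) Hy1 => x hy xab.
  have := is_cderive_conj (hy xab); congr is_cderive.
  exact: conjc_comb3.
- exact: sq_integrable_conj.
Qed.

(** On the set where [1 / p] is nonzero, [y' = r y + s y1] gives [y1] back from [y];
    continuity extends this to the whole interval, and the second equation
    then gives [y2]. *)
Lemma solves_system_unique y y1 y2 : solves_system y y1 y2 ->
  (\forall x \ae mu, x \in `[a, b] -> y x = 0) ->
  [/\ forall x, x \in `[a, b] -> y x = 0,
      forall x, x \in `[a, b] -> y1 x = 0
    & \forall x \ae mu, x \in `[a, b] -> y2 x = 0].
Proof.
move=> [Ay Ay1 Hy Hy1 sy] yae.
have y0 := abs_continuous_ae0 ab Ay yae.
have y10 : forall x, x \in `[a, b] -> y1 x = 0.
  apply: abs_continuous_ae0 => //; apply: ae_in_closed_itv.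
  apply: (@filterS2 _ _ aeF) (ae_in_open_itv Hy) (ae_in_open_itv p_neq0) => x hy p0 ax xb.
  have /eqP := is_cderive_locally0 y0 ax xb (hy ax xb).
  rewrite y0; last by rewrite in_itv /= !ltW.
  by rewrite mulr0 add0r mulf_eq0 fmorph_eq0 div1r invr_eq0 (negbTE (p0 ax xb)) => /eqP.
split => //; apply: ae_in_closed_itv.
apply: (@filterS _ _ aeF) (ae_in_open_itv Hy1) => x hy ax xb.
have := is_cderive_locally0 y10 ax xb (hy ax xb).
have xab : x \in `[a, b] by rewrite in_itv /= !ltW.
by rewrite (y0 _ xab) (y10 _ xab) !mulr0 !subr0.
Qed.

(** The coefficients are replaced by Borel versions, for which the system is
    covered by [linear_system_solution]. *)
Lemma real_system_solution (f : R -> R) (c d : R) : L1 a b f ->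
  exists u v : R -> R,
   [/\ abscont a b u /\ abscont a b v, u a = c /\ v a = d,
     \forall x \ae mu, a < x -> x < b ->
       is_derive x (1 : R) u (Q x / p x * u x + 1 / p x * v x)
   & \forall x \ae mu, a < x -> x < b ->
       is_derive x (1 : R) v (f x - Q x / p x * v x - Q x ^+ 2 / p x * u x)].
Proof.
move=> If.
have [r' Ir rE] := lebesgue_L1_borel Qp_L1.
have [s' Is sE] := lebesgue_L1_borel p_L1.
have [t' It tE] := lebesgue_L1_borel Q2p_L1.
pose A (i j : 'I_2) (x : R) : R := if i == 0 then (if j == 0 then r' x else s' x)
  else (if j == 0 then - t' x else - r' x).
pose g (i : 'I_2) (x : R) : R := if i == 0 then 0 else f x.
pose c0 (i : 'I_2) : R := if i == 0 then c else d.
have IA i j : L1 a b (A i j).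
  by rewrite /A; case: (i == 0); case: (j == 0) => //; exact: L1_opp.
have Ig i : L1 a b (g i).
  by rewrite /g; case: (i == 0) => //; exact: integrable0.
have [u [ACu u0 du]] := linear_system_solution c0 (ltW ab) IA Ig.
have sum2 (F : 'I_2 -> R) : \sum_j F j = F 0 + F 1.
  rewrite !big_ord_recl big_ord0 addr0; congr (F _ + F _); exact: val_inj.
exists (u 0), (u 1); split.
- by [].
- by rewrite !u0.
- apply: (@filterS3 _ _ aeF) (du 0) (ae_in_open_itv rE) (ae_in_open_itv sE) => x h h1 h2 ax xb.
  by have := h ax xb; rewrite sum2 /A /g /= addr0 h1 // h2.
- apply: (@filterS3 _ _ aeF) (du 1) (ae_in_open_itv rE) (ae_in_open_itv tE) => x h h1 h2 ax xb.
  have := h ax xb; rewrite sum2 /A /g /= h1 // h2 // => h'.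
  by apply: is_derive_eq h' _; ring.
Qed.

(** As [p] and [Q] are real, real and imaginary parts solve the system separately. *)
Lemma solves_system_exists f (c d : R[i]) : sq_integrable a b f ->
  exists y y1, [/\ solves_system y y1 f, y a = c & y1 a = d].
Proof.
move=> sf; have [I1 I2] := sq_integrable_L1 sf.
have [u [v [[ACu ACv] [u0 v0] du dv]]] := real_system_solution (Re c) (Re d) I1.
have [u' [v' [[ACu' ACv'] [u0' v0'] du' dv']]] := real_system_solution (Im c) (Im d) I2.
exists (fun x => u x +i* u' x), (fun x => v x +i* v' x); split.
- split.
  + exact/abs_continuousP.
  + exact/abs_continuousP.
  + apply: ae_in_closed_itv; apply: (@filterS2 _ _ aeF) du du' => x h h' ax xb.
    split.
      apply: is_derive_eq (h ax xb) _ => /=; ring.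
    apply: is_derive_eq (h' ax xb) _ => /=; ring.
  + apply: ae_in_closed_itv; apply: (@filterS2 _ _ aeF) dv dv' => x h h' ax xb.
    split.
      apply: is_derive_eq (h ax xb) _ => /=; case: (f x) => f1 f2 /=; ring.
    apply: is_derive_eq (h' ax xb) _ => /=; case: (f x) => f1 f2 /=; ring.
  + by [].
- by rewrite u0 u0'; case: (c).
- by rewrite v0 v0'; case: (d).
Qed.

(** The boundary form: the Wronskian of [y] and of the complex conjugate of [z],
    built from first quasi-derivatives. *)
Definition wronskian y y1 z z1 x := y x * (z1 x)^* - y1 x * (z x)^*.

Lemma green_formula y y1 y2 z z1 z2 : solves_system y y1 y2 ->
  solves_system z z1 z2 ->
  L2dot (- L2class a b y2) (L2class a b z) - L2dot (L2class a b y) (- L2class a b z2) =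
  wronskian y y1 z z1 b - wronskian y y1 z z1 a.
Proof.
move=> [Ay Ay1 Hy Hy1 sy2] [Az Az1 Hz Hz1 sz2].
have sy := abs_continuous_sq_integrable Ay; have sz := abs_continuous_sq_integrable Az.
have I1 := cintegrable_cprod sy sz2; have I2 := cintegrable_cprod sy2 sz.
have I2' : cintegrable a b (fun x => - 1 * cprod y2 z x).
  have := cintegrable_cprod (sq_integrable_lin (-1) sy2 (@sq_integrable0 R a b)) sz.
  congr cintegrable; apply/funext => x; rewrite /cprod.
  by rewrite (_ : (-1 *: y2 + 0) x = - 1 * y2 x + 0) // addr0 mulrA.
have -> : L2dot (- L2class a b y2) (L2class a b z) - L2dot (L2class a b y) (- L2class a b z2) =
    cintegral a b (fun x => cprod y z2 x + - 1 * cprod y2 z x).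
  rewrite cintegralD // cintegralZ // -!L2dot_class //.
  rewrite -[- L2class a b y2]scaleN1r -[- L2class a b z2]scaleN1r L2dotZl L2dotZr.
  by rewrite rmorphN rmorph1; ring.
have AW : abs_continuous a b (wronskian y y1 z z1).
  have h := abs_continuous_lin (-1) (abs_continuous_mul Ay1 (abs_continuous_conj Az))
     (abs_continuous_mul Ay (abs_continuous_conj Az1)).
  move: h; congr abs_continuous; apply/funext => x; rewrite /wronskian /cconj.
  by rewrite [LHS](_ : _ = -1 * (y1 x * (z x)^*) + y x * (z1 x)^*) // mulN1r addrC.
symmetry; apply: abs_continuous_FTC => //; first exact: ltW.
  have [c1 c2] := I1; have [d1 d2] := I2'; split.
    have := L1_add c1 d1; congr (_.-integrable _ _); apply/funext => x /=; congr EFin.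
    by case: (cprod y z2 x) (-1 * cprod y2 z x) => ? ? [].
  have := L1_add c2 d2; congr (_.-integrable _ _); apply/funext => x /=; congr EFin.
  by case: (cprod y z2 x) (-1 * cprod y2 z x) => ? ? [].
have Hyy : \forall x \ae mu, x \in `[a, b] ->
    is_cderive x y (r x * y x + s x * y1 x) /\ is_cderive x y1 (y2 x - r x * y1 x - t x * y x).
  by apply: (@filterS2 _ _ aeF) Hy Hy1 => x h1 h2 xab; split; [exact: h1|exact: h2].
have Hzz : \forall x \ae mu, x \in `[a, b] ->
    is_cderive x z (r x * z x + s x * z1 x) /\ is_cderive x z1 (z2 x - r x * z1 x - t x * z x).
  by apply: (@filterS2 _ _ aeF) Hz Hz1 => x h1 h2 xab; split; [exact: h1|exact: h2].
apply: (@filterS2 _ _ aeF) Hyy Hzz => x hy hz xab.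
have [hy0 hy1] := hy xab; have [hz0 hz1] := hz xab.
have h := is_cderive_lin (-1) (is_cderive_mul hy1 (is_cderive_conj hz0))
   (is_cderive_mul hy0 (is_cderive_conj hz1)).
move: h; congr is_cderive.
  apply/funext => u; rewrite /wronskian /cconj.
  by rewrite [LHS](_ : _ = -1 * (y1 u * (z u)^*) + y u * (z1 u)^*) // mulN1r addrC.
exact: green_identity.
Qed.

End IntervalOperator.

(** * The boundary triplet of one interval *)

(** Two independent vectors have an invertible Gram matrix; Gram-Schmidt solves the
    resulting 2 by 2 linear system. *)
Lemma gram2 {C : numClosedFieldType} {V : lmodType C} (dot : {dot V for @Num.conj_op C})
    (z w : V) :
  (forall k l : C, k *: z + l *: w = 0 -> k = 0 /\ l = 0) ->
  forall g h : C, exists k l : C,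
    dot (k *: z + l *: w) z = g /\ dot (k *: z + l *: w) w = h.
Proof.
move=> indep g h.
have z0 : dot z z != 0.
  apply/eqP => /dot_eq0 z0; have := indep 1 0.
  by rewrite z0 scaler0 scale0r addr0 => /(_ erefl)[] /eqP; rewrite oner_eq0.
pose c := dot w z / dot z z; pose e := w - c *: z.
have ez : dot e z = 0.
  by rewrite /e dotBl dotZl /c divfK // subrr.
have ew : dot e w != 0.
  have -> : dot e w = dot e e by rewrite {3}/e dotBr dotZr ez mulr0 subr0.
  apply/eqP => /dot_eq0 e0; have := indep (- c) 1.
  by rewrite scaleNr scale1r addrC -/e e0 => /(_ erefl)[_] /eqP; rewrite oner_eq0.
pose k := g / dot z z; pose l := (h - k * dot z w) / dot e w.
exists (k - l * c), l.
have -> : (k - l * c) *: z + l *: w = k *: z + l *: e.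
  by rewrite /e scalerBr scalerA scalerBl addrA addrAC.
rewrite !dotDl !dotZl ez mulr0 addr0; split; first by rewrite /k divfK.
by rewrite /l divfK // addrC subrK.
Qed.

Section IntervalTriplet.
Local Open Scope complex_scope.
Context {R : realType}.
Local Notation mu := (@lebesgue_measure R).
Let aeF : Filter (almost_everywhere mu) := ae_filter_ringOfSetsType mu.
Variables (p Q : R -> R) (a b : R).
Hypothesis ab : a < b.
Hypothesis p_neq0 : \forall x \ae mu, x \in `[a, b] -> p x != 0.
Hypothesis p_L1 : lebesgue_L1 a b (fun x => 1 / p x).
Hypothesis Qp_L1 : lebesgue_L1 a b (fun x => Q x / p x).
Hypothesis Q2p_L1 : lebesgue_L1 a b (fun x => Q x ^+ 2 / p x).
Implicit Types (x : R) (y z f : R -> R[i]) (u v : L2 a b).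

Local Notation solves := (solves_system p Q a b).
Local Notation cls := (L2class a b).
Local Notation Lmax := (@Lmax_itv R p Q a b).
Local Notation Lmin := (@Lmin_itv R p Q a b).

Let exists_sol := solves_system_exists ab p_L1 Qp_L1 Q2p_L1.

Lemma solves_sq y y1 y2 : solves y y1 y2 -> sq_integrable a b y /\ sq_integrable a b y2.
Proof. by move=> [Ay _ _ _ sy2]; split => //; exact: abs_continuous_sq_integrable. Qed.

Lemma Lmax_itvP u u' : Lmax (u, u') <->
  exists y y1 y2, [/\ solves y y1 y2, u = cls y & u' = - cls y2].
Proof.
split.
  by move=> [y [y1 [y2 [/(@max_domainP R p Q a b p_neq0) Hy /= -> ->]]]]; exists y, y1, y2.
by move=> [y [y1 [y2 [/(@max_domainP R p Q a b p_neq0) Hy -> ->]]]]; exists y, y1, y2.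
Qed.

Lemma solves_class_eq y y1 y2 z z1 z2 : solves y y1 y2 -> solves z z1 z2 ->
  cls y = cls z ->
  [/\ forall x, x \in `[a, b] -> y x = z x, forall x, x \in `[a, b] -> y1 x = z1 x
    & cls y2 = cls z2].
Proof.
move=> Hy Hz; have [sy sy2] := solves_sq Hy; have [sz sz2] := solves_sq Hz.
move=> /(L2class_eqP sy sz) yz.
have H := solves_system_lin (-1) Hz Hy.
have [|h h1 h2] := solves_system_unique ab p_neq0 H.
  apply: (@filterS _ _ aeF) yz => x E xab.
  by rewrite (_ : (-1 *: z + y) x = -1 * z x + y x) // E // mulN1r addNr.
split.
- move=> x /h; rewrite (_ : (-1 *: z + y) x = -1 * z x + y x) // mulN1r addrC => /eqP.
  by rewrite subr_eq0 => /eqP.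
- move=> x /h1; rewrite (_ : (-1 *: z1 + y1) x = -1 * z1 x + y1 x) // mulN1r addrC => /eqP.
  by rewrite subr_eq0 => /eqP.
- apply/(L2class_eqP sy2 sz2); apply: (@filterS _ _ aeF) h2 => x + xab => /(_ xab).
  rewrite (_ : (-1 *: z2 + y2) x = -1 * z2 x + y2 x) // mulN1r addrC => /eqP.
  by rewrite subr_eq0 => /eqP.
Qed.

Let a_in : a \in `[a, b]. Proof. by rewrite in_itv /= lexx ltW. Qed.
Let b_in : b \in `[a, b]. Proof. by rewrite in_itv /= lexx ltW. Qed.

(** The representative chosen by [quasi_rep] can differ from [(y, y1)] only off the
    interval. *)
Lemma quasi_rep_endpoints y y1 y2 : solves y y1 y2 ->
  [/\ (quasi_rep p Q (cls y)).1 a = y a, (quasi_rep p Q (cls y)).1 b = y b,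
      (quasi_rep p Q (cls y)).2 a = y1 a & (quasi_rep p Q (cls y)).2 b = y1 b].
Proof.
move=> Hy; rewrite /quasi_rep; set P := [set _ | _].
have [z2 [/(@max_domainP R p Q a b p_neq0) Hz E]] : P (xget (0, 0) P).
  apply: (@xgetPex _ (0, 0) P); exists (y, y1), y2; split => //.
  exact/(@max_domainP R p Q a b p_neq0).
have [h h1 _] := solves_class_eq Hy Hz E.
by rewrite !h // !h1.
Qed.

Lemma Gamma1_itvE y y1 y2 : solves y y1 y2 ->
  Gamma1_itv p Q (cls y) = \row_(j < 2) (if j == 0 then y1 a else - y1 b).
Proof.
move=> /quasi_rep_endpoints; rewrite /Gamma1_itv; case: (quasi_rep _ _ _) => z z1 /=.
by move=> [_ _ -> ->].
Qed.

Lemma Gamma2_itvE y y1 y2 : solves y y1 y2 ->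
  Gamma2_itv p Q (cls y) = \row_(j < 2) (if j == 0 then y a else y b).
Proof.
move=> /quasi_rep_endpoints; rewrite /Gamma2_itv; case: (quasi_rep _ _ _) => z z1 /=.
by move=> [-> -> _ _].
Qed.

Lemma class_lin k y y1 y2 z z1 z2 : solves y y1 y2 -> solves z z1 z2 ->
  cls (k *: y + z) = k *: cls y + cls z /\
  - cls (k *: y2 + z2) = k *: (- cls y2) + - cls z2.
Proof.
move=> /solves_sq[sy sy2] /solves_sq[sz sz2].
by rewrite !L2class_lin // opprD scalerN.
Qed.

Lemma Lmax_itv_linear : is_linear_operator Lmax.
Proof.
split.
- apply/Lmax_itvP; exists 0, 0, 0; split; first exact: solves_system0.
    by rewrite L2class0.
  by rewrite L2class0 oppr0.
- move=> k u u' v v' /Lmax_itvP[y [y1 [y2 [Hy -> ->]]]] /Lmax_itvP[z [z1 [z2 [Hz -> ->]]]].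
  apply/Lmax_itvP; exists (k *: y + z), (k *: y1 + z1), (k *: y2 + z2).
  have [h1 h2] := class_lin k Hy Hz.
  by split; [exact: solves_system_lin|rewrite h1|rewrite h2].
- move=> u u' u'' /Lmax_itvP[y [y1 [y2 [Hy -> ->]]]] /Lmax_itvP[z [z1 [z2 [Hz E ->]]]].
  by have [_ _ ->] := solves_class_eq Hy Hz E.
Qed.

Lemma Gamma_itv_linear k u v : dom Lmax u -> dom Lmax v ->
  Gamma1_itv p Q (k *: u + v) = k *: Gamma1_itv p Q u + Gamma1_itv p Q v /\
  Gamma2_itv p Q (k *: u + v) = k *: Gamma2_itv p Q u + Gamma2_itv p Q v.
Proof.
move=> [u' /Lmax_itvP[y [y1 [y2 [Hy -> _]]]]] [v' /Lmax_itvP[z [z1 [z2 [Hz -> _]]]]].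
have [<- _] := class_lin k Hy Hz; have H := solves_system_lin k Hy Hz.
rewrite (Gamma1_itvE H) (Gamma1_itvE Hy) (Gamma1_itvE Hz).
rewrite (Gamma2_itvE H) (Gamma2_itvE Hy) (Gamma2_itvE Hz).
split; apply/rowP => j; rewrite !mxE; case: ifP => // _.
rewrite (_ : (k *: y1 + z1) b = k * y1 b + z1 b) //.
by rewrite opprD mulrN.
Qed.

Lemma Green_itv u u' v v' : Lmax (u, u') -> Lmax (v, v') ->
  L2dot u' v - L2dot u v' =
  dotmx (Gamma1_itv p Q u) (Gamma2_itv p Q v) - dotmx (Gamma2_itv p Q u) (Gamma1_itv p Q v).
Proof.
move=> /Lmax_itvP[y [y1 [y2 [Hy -> ->]]]] /Lmax_itvP[z [z1 [z2 [Hz -> ->]]]].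
rewrite (green_formula ab Hy Hz) (Gamma1_itvE Hy) (Gamma1_itvE Hz).
rewrite (Gamma2_itvE Hy) (Gamma2_itvE Hz) !dotmxE !mxE !big_ord_recl !big_ord0 !mxE /=.
rewrite /wronskian !addr0.
ring.
Qed.

Lemma Lmin_itvP u u' : Lmin (u, u') <->
  [/\ Lmax (u, u'), Gamma1_itv p Q u = 0 & Gamma2_itv p Q u = 0].
Proof.
split.
  move=> [y [y1 [y2 [/(@max_domainP R p Q a b p_neq0) Hy [ya yb y1a y1b] /= -> ->]]]].
  split; first by apply/Lmax_itvP; exists y, y1, y2.
    rewrite (Gamma1_itvE Hy); apply/rowP => j; rewrite !mxE y1a y1b oppr0.
    by case: ifP.
  by rewrite (Gamma2_itvE Hy); apply/rowP => j; rewrite !mxE ya yb; case: ifP.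
move=> [/Lmax_itvP[y [y1 [y2 [Hy -> ->]]]]].
rewrite (Gamma1_itvE Hy) (Gamma2_itvE Hy) => /rowP G1 /rowP G2.
exists y, y1, y2; split => //; first by apply/(@max_domainP R p Q a b p_neq0).
have := G1 0; have := G1 1; have := G2 0; have := G2 1; rewrite !mxE /=.
by move=> -> -> /eqP; rewrite oppr_eq0 => /eqP -> ->.
Qed.

Lemma Lmax_itv_conj u u' : Lmax (u, u') -> Lmax (L2conj u, L2conj u').
Proof.
move=> /Lmax_itvP[y [y1 [y2 [Hy -> ->]]]]; have [sy sy2] := solves_sq Hy.
apply/Lmax_itvP; exists (cconj y), (cconj y1), (cconj y2); split.
- exact: solves_system_conj.
- exact: L2conj_class.
- rewrite -scaleN1r L2conj_scale L2conj_class //.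
  by rewrite -[RHS]scaleN1r; congr (_ *: _); rewrite rmorphN1.
Qed.

Section FundamentalSystem.
Variables (z z1 w w1 : R -> R[i]).
Hypotheses (Hz : solves z z1 0) (Hw : solves w w1 0).
Hypotheses (za : z a = 1) (z1a : z1 a = 0) (wa : w a = 0) (w1a : w1 a = 1).

(** The Green formula for [z] and the conjugate of [w], both homogeneous solutions:
    the Wronskian is the same at both ends. *)
Lemma fundamental_wronskian : z b * w1 b - z1 b * w b = 1.
Proof.
have := green_formula ab Hz (solves_system_conj Hw).
have -> : cconj 0 = (0 : R -> R[i]) by apply/funext => x; rewrite /cconj; exact: conjc0.
have CK f x : ((cconj f x)^*)%R = f x by exact: conjcK.
rewrite L2class0 oppr0 L2dot0l L2dot0r subrr /wronskian !CK.
by rewrite za z1a wa w1a mulr1 mulr0 subr0 => /esym/eqP; rewrite subr_eq0 => /eqP.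
Qed.

Lemma fundamental_indep (k l : R[i]) : k *: cls z + l *: cls w = 0 -> k = 0 /\ l = 0.
Proof.
have H := solves_system_lin k Hz (solves_system_lin l Hw (solves_system0 p Q a b)).
have [sz _] := solves_sq Hz; have [sw _] := solves_sq Hw.
have s0 := @sq_integrable0 R a b.
have -> : k *: cls z + l *: cls w = cls (k *: z + (l *: w + 0)).
  by rewrite (L2class_lin k sz (sq_integrable_lin l sw s0)) (L2class_lin l sw s0) L2class0 addr0.
rewrite -(L2class0 a b) => E.
have [h h1 _] := solves_class_eq H (solves_system0 p Q a b) E.
have := h a a_in; have := h1 a a_in.
rewrite (_ : (k *: z1 + (l *: w1 + 0)) a = k * z1 a + (l * w1 a + 0)) //.
rewrite (_ : (k *: z + (l *: w + 0)) a = k * z a + (l * w a + 0)) //.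
by rewrite za z1a wa w1a !mulr1 !mulr0 !addr0 add0r.
Qed.

(** Cramer's rule; the determinant is the conjugate of the Wronskian of [z] and [w]. *)
Lemma endpoint_data_eq (c d c' d' : R[i]) :
  c * (z1 b)^* - d * (z b)^* = c' * (z1 b)^* - d' * (z b)^* ->
  c * (w1 b)^* - d * (w b)^* = c' * (w1 b)^* - d' * (w b)^* -> c = c' /\ d = d'.
Proof.
have := congr1 (@conjc R) fundamental_wronskian.
rewrite (rmorphB (@conjc R)) !(rmorphM (@conjc R)) (rmorph1 (@conjc R)) /=.
set A1 := (z b)^*; set B1 := (z1 b)^*; set A2 := (w b)^*; set B2 := (w1 b)^* => D E1 E2.
have F1 : (c - c') * B1 = (d - d') * A1.
  by apply/eqP; rewrite -subr_eq0; apply/eqP; move/eqP: E1; rewrite -subr_eq0 => /eqP <-; ring.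
have F2 : (c - c') * B2 = (d - d') * A2.
  by apply/eqP; rewrite -subr_eq0; apply/eqP; move/eqP: E2; rewrite -subr_eq0 => /eqP <-; ring.
split; apply/eqP; rewrite -subr_eq0; apply/eqP.
  rewrite -[LHS]mulr1 -D.
  have -> : (c - c') * (A1 * B2 - B1 * A2) = (c - c') * B2 * A1 - (c - c') * B1 * A2 by ring.
  by rewrite F1 F2; ring.
rewrite -[LHS]mulr1 -D.
have -> : (d - d') * (A1 * B2 - B1 * A2) = (d - d') * A1 * B2 - (d - d') * A2 * B1 by ring.
by rewrite -F1 -F2; ring.
Qed.

(** The Green formula against homogeneous solutions: the right-hand side of the
    equation controls the boundary values at [b]. *)
Lemma transfer y y1 y2 : solves y y1 y2 ->
  [/\ L2dot (- cls y2) (cls z) = wronskian y y1 z z1 b - wronskian y y1 z z1 a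
    & L2dot (- cls y2) (cls w) = wronskian y y1 w w1 b - wronskian y y1 w w1 a].
Proof.
move=> Hy; rewrite -(green_formula ab Hy Hz) -(green_formula ab Hy Hw).
by rewrite L2class0 oppr0 L2dot0r !subr0.
Qed.

(** The solution with image [f] and initial values [c], [d] has the values [c'],
    [d'] at [b] as soon as [f] has the scalar products with [z] and [w] that
    [transfer] predicts. *)
Lemma solution_with_image (f : L2 a b) (c d c' d' : R[i]) :
  L2dot f (cls z) = c' * (z1 b)^* - d' * (z b)^* - (c * (z1 a)^* - d * (z a)^*) ->
  L2dot f (cls w) = c' * (w1 b)^* - d' * (w b)^* - (c * (w1 a)^* - d * (w a)^*) ->
  exists y y1 y2, [/\ solves y y1 y2, - cls y2 = f,
    y a = c /\ y1 a = d & y b = c' /\ y1 b = d'].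
Proof.
move=> fz fw; have sf := L2repr_sq f; have sNf := sq_integrableN sf.
have [y [y1 [Hy ya y1a]]] := exists_sol c d sNf.
have Ef : - cls (- L2repr f) = f by rewrite L2classN // opprK L2class_repr.
exists y, y1, (- L2repr f); split => //.
have [h1 h2] := transfer Hy; move: h1 h2; rewrite Ef fz fw /wronskian ya y1a.
by move=> /addIr e1 /addIr e2; apply: endpoint_data_eq.
Qed.

Lemma solution_with_endpoints (c d c' d' : R[i]) : exists y y1 y2,
  [/\ solves y y1 y2, y a = c /\ y1 a = d & y b = c' /\ y1 b = d'].
Proof.
have [k [l [h1 h2]]] := gram2 (@L2dot R a b) fundamental_indep
  (c' * (z1 b)^* - d' * (z b)^* - (c * (z1 a)^* - d * (z a)^*))
  (c' * (w1 b)^* - d' * (w b)^* - (c * (w1 a)^* - d * (w a)^*)).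
have [y [y1 [y2 [Hy _ e1 e2]]]] := solution_with_image h1 h2.
by exists y, y1, y2.
Qed.

(** Let [L y = v'], and let [f] be the component of [v - y] orthogonal to [z] and
    [w].  By [solution_with_image], [f] is the image of some [g] in the
    minimal domain, and then the adjoint relation and the Green formula give
    [f] orthogonal to [v - y], so that [f = 0] and [v - y] is a combination of
    [z] and [w]. *)
Lemma adjoint_Lmin_itv_sub v v' : adjoint (@L2dot R a b) Lmin (v, v') -> Lmax (v, v').
Proof.
move=> adj; have [ML0 MLD _] := Lmax_itv_linear.
have [y [y1 [Hy _ _]]] := exists_sol 0 0 (sq_integrableN (L2repr_sq v')).
have Ey : - cls (- L2repr v') = v'.
  by rewrite L2classN ?opprK ?L2class_repr //; exact: L2repr_sq.
have My : Lmax (cls y, v') by apply/Lmax_itvP; exists y, y1, (- L2repr v').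
have Mz : Lmax (cls z, 0).
  by apply/Lmax_itvP; exists z, z1, 0; rewrite L2class0 oppr0.
have Mw : Lmax (cls w, 0).
  by apply/Lmax_itvP; exists w, w1, 0; rewrite L2class0 oppr0.
pose x := v - cls y.
have [k [l [h1 h2]]] := gram2 (@L2dot R a b) fundamental_indep (L2dot x (cls z)) (L2dot x (cls w)).
pose n := k *: cls z + l *: cls w; pose f := x - n.
have fz : L2dot f (cls z) = 0 by rewrite L2dotBl [X in _ - X]h1 subrr.
have fw : L2dot f (cls w) = 0 by rewrite L2dotBl [X in _ - X]h2 subrr.
have [|| g [g1 [g2 [Hg Eg [ga g1a] [gb g1b]]]]] := @solution_with_image f 0 0 0 0.
- by rewrite fz !mul0r !subr0.
- by rewrite fw !mul0r !subr0.
have Tg : Lmin (cls g, f).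
  exists g, g1, g2; split => //; first by apply/(@max_domainP R p Q a b p_neq0).
have E1 := adj _ _ Tg; rewrite /= in E1.
have Mg : Lmax (cls g, f) by have /Lmin_itvP[] := Tg.
have E2 : L2dot f (cls y) = L2dot (cls g) v'.
  apply/eqP; rewrite -subr_eq0 (Green_itv Mg My).
  have /Lmin_itvP[_ -> ->] := Tg.
  by rewrite !linear0l subrr.
have fx : L2dot f x = 0 by rewrite L2dotBr E1 E2 subrr.
have fn : L2dot f n = 0 by rewrite L2dotDr !L2dotZr fz fw !mulr0 addr0.
have f0 : f = 0 by apply: (dot_eq0 (dot := @L2dot R a b)); rewrite {2}/f [LHS]L2dotBr fx fn subrr.
have -> : v = k *: cls z + (l *: cls w + cls y).
  by move/eqP: f0; rewrite subr_eq0 /x subr_eq => /eqP ->; rewrite addrA.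
have -> : v' = k *: 0 + (l *: 0 + v') by rewrite !scaler0 !add0r.
by apply: (MLD) => //; exact: MLD.
Qed.

End FundamentalSystem.

Lemma fundamental_system_exists : exists z z1 w w1,
  [/\ solves z z1 0, solves w w1 0, z a = 1 /\ z1 a = 0 & w a = 0 /\ w1 a = 1].
Proof.
have [z [z1 [Hz za z1a]]] := exists_sol 1 0 (@sq_integrable0 R a b).
have [w [w1 [Hw wa w1a]]] := exists_sol 0 1 (@sq_integrable0 R a b).
by exists z, z1, w, w1.
Qed.

Lemma adjoint_Lmin_itv v v' : adjoint (@L2dot R a b) Lmin (v, v') -> Lmax (v, v').
Proof.
have [z [z1 [w [w1 [Hz Hw [za z1a] [wa w1a]]]]]] := fundamental_system_exists.
exact: adjoint_Lmin_itv_sub Hz Hw za z1a wa w1a v v'.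
Qed.

Lemma Gamma_itv_onto (g1 g2 : 'rV[R[i]]_2) :
  exists u u', [/\ Lmax (u, u'), Gamma1_itv p Q u = g1 & Gamma2_itv p Q u = g2].
Proof.
have [z [z1 [w [w1 [Hz Hw [za z1a] [wa w1a]]]]]] := fundamental_system_exists.
have [y [y1 [y2 [Hy [ya y1a] [yb y1b]]]]] :=
  solution_with_endpoints Hz Hw za z1a wa w1a (g2 0 0) (g1 0 0) (g2 0 1) (- g1 0 1).
exists (cls y), (- cls y2); split.
- by apply/Lmax_itvP; exists y, y1, y2.
- rewrite (Gamma1_itvE Hy) y1a y1b opprK; apply/rowP => j; rewrite mxE.
  by case: ifPn => [/eqP -> //|]; case: j => [[|[|//]]] //= h _; congr (g1 0 _); exact: val_inj.
- rewrite (Gamma2_itvE Hy) ya yb; apply/rowP => j; rewrite mxE.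
  by case: ifPn => [/eqP -> //|]; case: j => [[|[|//]]] //= h _; congr (g2 0 _); exact: val_inj.
Qed.

End IntervalTriplet.

(** * The direct sum over the partition *)

Lemma dotmx_mxvec {C : numClosedFieldType} (m n : nat) (A B : 'M[C]_(m, n)) :
  dotmx (mxvec A) (mxvec B) = \sum_i dotmx (row i A) (row i B).
Proof.
rewrite dotmxE mxE (reindex _ (curry_mxvec_bij m n)) /=.
under [RHS]eq_bigr => i _ do rewrite dotmxE mxE.
rewrite pair_bigA /=; apply: eq_bigr => -[i j] _.
by rewrite !mxE /= !mxvecE.
Qed.

Section PartitionTriplet.
Local Open Scope complex_scope.
Context {R : realType}.
Local Notation mu := (@lebesgue_measure R).
Variables (m : nat) (a : 'I_m.+1 -> R) (p Q : 'I_m -> R -> R).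
Hypothesis a_incr : forall i j : 'I_m.+1, (i < j)%N -> a i < a j.
Hypothesis p_neq0 : forall i, \forall x \ae mu, x \in `[lend a i, rend a i] -> p i x != 0.
Hypothesis p_L1 : forall i, lebesgue_L1 (lend a i) (rend a i) (fun x => 1 / p i x).
Hypothesis Qp_L1 : forall i, lebesgue_L1 (lend a i) (rend a i) (fun x => Q i x / p i x).
Hypothesis Q2p_L1 : forall i,
  lebesgue_L1 (lend a i) (rend a i) (fun x => Q i x ^+ 2 / p i x).

Local Notation V := (L2 (a ord0) (a ord_max)).
Local Notation piece i := (@piece R m a i).
Local Notation M := (Lmax a p Q).
Local Notation T := (Lmin a p Q).
Local Notation Mi i := (@Lmax_itv R (p i) (Q i) (lend a i) (rend a i)).
Local Notation Ti i := (@Lmin_itv R (p i) (Q i) (lend a i) (rend a i)).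

Let lt_i := lend_lt_rend a_incr.
Let lin_i i := Lmax_itv_linear (Q i) (lt_i i) (p_neq0 i).

Lemma piece0 i : piece i 0 = 0.
Proof.
have := piece_lin a_incr i (-1) 0 0.
by rewrite scaler0 addr0 scaleN1r addNr.
Qed.

Lemma pieces_inj (u v : V) : (forall i, piece i u = piece i v) -> u = v.
Proof.
move=> uv; apply/eqP; rewrite -subr_eq0 -opprB oppr_eq0 -scaleN1r addrC; apply/eqP.
apply: (dot_eq0 (dot := @L2dot R _ _)); rewrite [LHS](L2dot_pieces a_incr) big1 // => i _.
by rewrite (piece_lin a_incr) uv scaleN1r addNr L2dot0l.
Qed.

Lemma Lmax_linear : is_linear_operator M.
Proof.
split.
- by move=> i /=; rewrite piece0; have [] := lin_i i.
- move=> k u u' v v' Mu Mv i /=; rewrite !(piece_lin a_incr).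
  by have [_ h _] := lin_i i; apply: h; [exact: Mu|exact: Mv].
- move=> u u' u'' Mu Mu'; apply: pieces_inj => i.
  by have [_ _ h] := lin_i i; apply: h (Mu i) (Mu' i).
Qed.

Let dom_piece u i : dom M u -> dom (Mi i) (piece i u).
Proof. by move=> [u' Mu]; exists (piece i u'); exact: Mu. Qed.

Lemma Gamma1_linear k (u v : V) : dom M u -> dom M v ->
  Gamma1 a p Q (k *: u + v) = k *: Gamma1 a p Q u + Gamma1 a p Q v.
Proof.
move=> du dv; rewrite /Gamma1 -linearP; congr mxvec; apply/row_matrixP => i.
rewrite linearP /= !rowK (piece_lin a_incr).
by have [-> _] := Gamma_itv_linear (lt_i i) (p_neq0 i) k (dom_piece i du) (dom_piece i dv).
Qed.

Lemma Gamma2_linear k (u v : V) : dom M u -> dom M v ->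
  Gamma2 a p Q (k *: u + v) = k *: Gamma2 a p Q u + Gamma2 a p Q v.
Proof.
move=> du dv; rewrite /Gamma2 -linearP; congr mxvec; apply/row_matrixP => i.
rewrite linearP /= !rowK (piece_lin a_incr).
by have [_ ->] := Gamma_itv_linear (lt_i i) (p_neq0 i) k (dom_piece i du) (dom_piece i dv).
Qed.

Lemma Green_partition (u u' v v' : V) : M (u, u') -> M (v, v') ->
  L2dot u' v - L2dot u v' =
  dotmx (Gamma1 a p Q u) (Gamma2 a p Q v) - dotmx (Gamma2 a p Q u) (Gamma1 a p Q v).
Proof.
move=> Mu Mv; rewrite !(L2dot_pieces a_incr) !dotmx_mxvec -!sumrB.
apply: eq_bigr => i _; rewrite !rowK.
by have /= -> := Green_itv (lt_i i) (p_neq0 i) (Mu i) (Mv i).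
Qed.

Lemma Gamma_onto (g1 g2 : 'rV[R[i]]_(m * 2)) :
  exists u : V, [/\ dom M u, Gamma1 a p Q u = g1 & Gamma2 a p Q u = g2].
Proof.
have H i : exists uu : L2 (lend a i) (rend a i) * L2 (lend a i) (rend a i),
    [/\ Mi i uu, Gamma1_itv (p i) (Q i) uu.1 = row i (vec_mx g1) &
        Gamma2_itv (p i) (Q i) uu.1 = row i (vec_mx g2)].
  have [u [u' [h1 h2 h3]]] := Gamma_itv_onto (lt_i i) (p_neq0 i) (p_L1 i)
    (Qp_L1 i) (Q2p_L1 i) (row i (vec_mx g1)) (row i (vec_mx g2)).
  by exists (u, u').
have [u Hu] := glue_pieces a_incr (fun i => (projT1 (cid (H i))).1).
have [u' Hu'] := glue_pieces a_incr (fun i => (projT1 (cid (H i))).2).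
exists u; split.
- exists u' => i /=; rewrite Hu Hu'; case: (cid (H i)) => -[v v'] [h _ _] /=; apply: h.
- rewrite /Gamma1 -[RHS]vec_mxK; congr mxvec; apply/row_matrixP => i; rewrite rowK Hu.
  by case: (cid (H i)) => -[v v'] [].
- rewrite /Gamma2 -[RHS]vec_mxK; congr mxvec; apply/row_matrixP => i; rewrite rowK Hu.
  by case: (cid (H i)) => -[v v'] [].
Qed.

Lemma LminP (u u' : V) : T (u, u') <->
  [/\ M (u, u'), Gamma1 a p Q u = 0 & Gamma2 a p Q u = 0].
Proof.
split=> [Tu|[Mu G1 G2] i].
  have Tu' i := (Lmin_itvP (Q _) (lt_i i) (p_neq0 i) _ _).1 (Tu i).
  split.
  - by move=> i; have [] := Tu' i.
  - rewrite /Gamma1 -[RHS](linear0 mxvec); congr mxvec; apply/row_matrixP => i.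
    by rewrite rowK row0; have [] := Tu' i.
  - rewrite /Gamma2 -[RHS](linear0 mxvec); congr mxvec; apply/row_matrixP => i.
    by rewrite rowK row0; have [] := Tu' i.
apply/(Lmin_itvP (Q _) (lt_i i) (p_neq0 i)); split; first exact: Mu.
- move: G1 => /(congr1 vec_mx); rewrite mxvecK linear0 => /row_matrixP /(_ i).
  by rewrite rowK row0.
- move: G2 => /(congr1 vec_mx); rewrite mxvecK linear0 => /row_matrixP /(_ i).
  by rewrite rowK row0.
Qed.

(** The minimal operator contains the functions supported on one piece, so the
    adjoint relation can be tested piece by piece. *)
Lemma adjoint_Lmin : adjoint (@L2dot R (a ord0) (a ord_max)) T `<=` M.
Proof.
move=> [v v'] adj i; apply: (adjoint_Lmin_itv (lt_i i) (p_neq0 i) (p_L1 i) (Qp_L1 i) (Q2p_L1 i)).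
move=> u u' Tu /=.
pose ext (w : L2 (lend a i) (rend a i)) :=
  @eqtype.dfwith _ (fun j => L2 (lend a j) (rend a j)) (fun j => 0) i w.
have [w Hw] := glue_pieces a_incr (ext u).
have [w' Hw'] := glue_pieces a_incr (ext u').
have Tw : T (w, w').
  move=> j; rewrite /= Hw Hw' /ext; have [<-|ij] := eqVneq i j.
    by rewrite !dfwith_in.
  rewrite !dfwith_out //; apply/(Lmin_itvP (Q _) (lt_i j) (p_neq0 j)).
  have [M0 _ _] := lin_i j; split => //; apply: (linear_on_dom0 M0) => k f g df dg.
    exact: (Gamma_itv_linear (lt_i j) (p_neq0 j) k df dg).1.
  exact: (Gamma_itv_linear (lt_i j) (p_neq0 j) k df dg).2.
have := adj _ _ Tw; rewrite /= !(L2dot_pieces a_incr) (bigD1 i) //= [in RHS](bigD1 i) //=.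
rewrite !big1 ?addr0; last 2 first.
- by move=> j ji; rewrite Hw /ext dfwith_out ?L2dot0l // eq_sym.
- by move=> j ji; rewrite Hw' /ext dfwith_out ?L2dot0l // eq_sym.
by rewrite Hw Hw' /ext !dfwith_in.
Qed.

Lemma Lmax_conj (u u' : V) : M (u, u') -> M (L2conj u, L2conj u').
Proof.
move=> Mu i /=; rewrite !(piece_conj a_incr).
by have := Lmax_itv_conj (p_neq0 i) (Mu i).
Qed.

End PartitionTriplet.

Theorem theorem1 (R : realType) (m : nat) (a : 'I_m.+1 -> R)
    (p Q : 'I_m -> R -> R)
    (m_gt0 : (0 < m)%N)
    (a_incr : forall i j : 'I_m.+1, (i < j)%N -> a i < a j)
    (p_meas : forall i, lebesgue_measurable_fun (lend a i) (rend a i) (p i))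
    (Q_meas : forall i, lebesgue_measurable_fun (lend a i) (rend a i) (Q i))
    (p_neq0 : forall i, \forall x \ae @lebesgue_measure R,
       x \in `[lend a i, rend a i] -> p i x != 0)
    (p_L1 : forall i,
       lebesgue_L1 (lend a i) (rend a i) (fun x => 1 / p i x))
    (Qp_L1 : forall i,
       lebesgue_L1 (lend a i) (rend a i) (fun x => Q i x / p i x))
    (Q2p_L1 : forall i,
       lebesgue_L1 (lend a i) (rend a i) (fun x => Q i x ^+ 2 / p i x)) :
  boundary_triplet (@L2dot R (a ord0) (a ord_max)) (@dotmx R[i] (m * 2))
    (Lmin a p Q) (dom (Lmax a p Q)) (Gamma1 a p Q) (Gamma2 a p Q).
Proof.
apply: (boundary_triplet_of_green (J := @L2conj R (a ord0) (a ord_max))).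
- exact: Lmax_linear.
- exact: Gamma1_linear.
- exact: Gamma2_linear.
- exact: Green_partition.
- exact: Gamma_onto.
- exact: LminP.
- exact: adjoint_Lmin.
- by move=> D Dlin D0 Dperp u e e0; exact: L2_orth_dense.
- exact: L2conj_dot.
- exact: L2conjK.
- exact: L2conj_scale.
- exact: Lmax_conj.
Qed.
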